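(* There is a function $\rho:(0,1)\to\mathbb{R}$, continuous on $(0,1)$ and differentiable at every irrational point of $(0,1)$, such that for $0<\lambda<1$ $$A(\lambda)=\rho(\lambda)-\frac{\Upsilon(\lambda)}{2\lambda}.$$
   Context: $\{t\}$ is the fractional part of $t$, and $A(\lambda)=\int_0^\infty\{t\}\{\lambda t\}\,t^{-2}dt$ for $\lambda\ge0$. For $x\in X=(0,1)\setminus\mathbb{Q}$ put $\alpha(x)=\{1/x\}$, $\alpha_0(x)=x$, $\alpha_k(x)=\alpha(\alpha_{k-1}(x))$ for $k\ge1$, $\beta_{-1}=1$, $\beta_k(x)=\alpha_0(x)\cdots\alpha_k(x)$, $\gamma_k(x)=\beta_{k-1}(x)\log(1/\alpha_k(x))$. The Wilton function is $\mathcal{W}(x)=\sum_{k\ge0}(-1)^k\gamma_k(x)$; this series converges for almost every $x\in(0,1)$ and defines an element of $L^1(0,1)$. Its primitive is $\Upsilon(x)=\int_0^x\mathcal{W}(t)\,dt$ for $0\le x\le1$. *)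

(* Defs.v *)
From HB Require Import structures.
From mathcomp Require Export all_boot all_order all_algebra.
From mathcomp Require Export all_classical all_reals all_analysis.

Set Implicit Arguments.
Unset Strict Implicit.
Unset Printing Implicit Defensive.

Import Order.TTheory GRing.Theory Num.Theory.
Import numFieldNormedType.Exports.

Local Open Scope classical_set_scope.
Local Open Scope ring_scope.

Definition frac {R : realType} (t : R) : R := t - (Num.floor t)%:~R.

Definition autocorrelation {R : realType} (l : R) : R :=
  \int[lebesgue_measure]_(t in `]0, +oo[) (frac t * frac (l * t) / t ^+ 2).

Definition gauss_map {R : realType} (x : R) : R := frac (1 / x).

Definition gauss_iter {R : realType} (k : nat) (x : R) : R :=
  iter k gauss_map x.

(* The index is shifted by one to accommodate [beta_{-1} = 1]:
   [cf_beta k x] is the product alpha_0(x) ... alpha_{k-1}(x), usually written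
   beta_{k-1}(x). *)
Definition cf_beta {R : realType} (k : nat) (x : R) : R :=
  \prod_(i < k) gauss_iter i x.

Definition cf_gamma {R : realType} (k : nat) (x : R) : R :=
  cf_beta k x * ln (1 / gauss_iter k x).

(* The series converges at almost every point of (0, 1).  The formula is
   meaningful at the irrational x in (0, 1) where it converges; the values
   elsewhere (rational points, divergence) are conventional, and inside (0, 1)
   they only concern a null set. *)
Definition wilton {R : realType} (x : R) : R :=
  limn (series (fun k => (-1) ^+ k * cf_gamma k x)).

Definition wilton_primitive {R : realType} (x : R) : R :=
  \int[lebesgue_measure]_(t in `[0, x]) wilton t.

(* Main.v *)
From HB Require Import structures.
Require Import Defs.
From mathcomp Require Import measurable_realfun ring lra zify.

Set Implicit Arguments.
Unset Strict Implicit.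
Unset Printing Implicit Defensive.

Import Order.TTheory GRing.Theory Num.Theory.
Import numFieldNormedType.Exports.
Local Open Scope classical_set_scope.
Local Open Scope ring_scope.

(** Let [bern t = ({t}^2 - {t}) / 2], let [Phi x] be the sum over [n >= 1] of
[bern (n x) / n^2], and let [M x] be the integral of [u Phi(1/u)] over [0, x].
In the variable [u = 1/t], the fractional part [{l/u}] is [l/u] minus the number
of [n >= 1] with [u <= l/n]. This reduces the autocorrelation to primitives of
[{1/u}], and yields for every [v > 0] the formula ([autocorrelation_formula_inv])

  A(v) = cA + ln v / 2 + Phi(v) / v - 2 v M(1/v).

All terms but [Phi(v) / v] are continuously differentiable, so the question is to
show that [Phi + Upsilon / 2] is the primitive, on (0, 1), of an integrable
function which is continuous at the irrational points.

If [f] is the derivative of [Phi], it is 1-periodic, and the symmetry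
[A(v) = v A(1/v)] becomes, after differentiation, [f(x) + x f(1/x) = Fhat(x)],
that is, [f(x) + x f(alpha(x)) = Fhat(x)] on (0, 1), where
[Fhat(x) = (cA - 1/2)(1 + x) + (1 - x) ln x / 2 - A(x)]. Iterating,
[f] is the series of the [(-1)^k beta_(k-1) Fhat(alpha_k)]. Since
[Fhat = ln / 2 + F] with [F] bounded and continuous on (0, 1), this series is
[- W / 2 + G], where [G] is the same series formed with [F]. The products
[beta_k] decay geometrically ([cf_beta_le]) and the [alpha_k] are continuous at
irrational points, hence so is [G] ([Gfun_continuous]).

As [Phi] is not known in advance to be absolutely continuous, the argument runs
in the other direction. The operator taking [h] to [x h(alpha(x))] contracts the
L1 norm with weight [(1 + x)^-2] by a factor 1/2 ([gauss_contraction]), so the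
series converges almost everywhere and in L1, and its sum [f] solves the
functional equation almost everywhere. Let [Psi] be the primitive of the periodic
extension of [f]. Then [Phi] and [Psi] have periodic increments, and they obey
the same integrated form of the functional equation, in which the weight
[(1 + x)^-3] makes the inversion [x -> 1/x] act symmetrically
([wprim_Phi_inversion], [wprim_Psi_inversion]). A continuous function with
periodic increments, vanishing at 0 and invariant in this sense under inversion
is zero, by a maximum principle ([wprim_uniqueness]). So [Phi = Psi], and

  rho(v) = cA + ln v / 2 - 2 v M(1/v) + (1/v) int_0^v G. *)

(** * Change of variables from the images of intervals *)

Section transfer_density.
Context d1 d2 (X : measurableType d1) (Y : measurableType d2) (R : realType).
Variables (mu : {measure set X -> \bar R}) (nu : {measure set Y -> \bar R}).
Variables (phi : X -> Y) (psi : X -> R).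
Hypothesis mphi : measurable_fun setT phi.
Hypothesis mpsi : measurable_fun setT psi.
Hypothesis psi0 : forall x, 0 <= psi x.
Hypothesis mu_nu : forall A, measurable A ->
  (\int[mu]_(x in phi @^-1` A) (psi x)%:E = nu A)%E.

Lemma measurable_preimage A : measurable A -> measurable (phi @^-1` A).
Proof. by move=> mA; rewrite -[X in measurable X]setTI; exact: mphi. Qed.

Import HBNNSimple.

(** The hypothesis [mu_nu] is the case of indicator functions; simple
functions follow by linearity and nonnegative measurable ones by monotone
convergence. *)
Lemma ge0_transfer_density D (g : Y -> \bar R) :
  measurable D -> measurable_fun D g -> (forall x, D x -> 0 <= g x)%E ->
  (\int[mu]_(x in phi @^-1` D) (g (phi x) * (psi x)%:E) = \int[nu]_(x in D) g x)%E.
Proof.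
move=> mD mg g0.
have mpD := measurable_preimage mD.
pose g_ := nnsfun_approx mD mg.
have mg_ n : measurable_fun setT (fun x => (g_ n (phi x))).
  by apply: measurableT_comp.
transitivity (limn (fun n => \int[mu]_(x in phi @^-1` D)
    ((g_ n (phi x))%:E * (psi x)%:E)))%E; last first.
  transitivity (limn (fun n => \int[nu]_(x in D) (g_ n x)%:E))%E; last first.
    rewrite -monotone_convergence//.
    - apply: eq_integral => y /[!inE] yD; apply/cvg_lim => //.
      by apply: cvg_nnsfun_approx.
    - by move=> n; apply/measurable_EFinP/measurable_funTS.
    - by move=> n y _; rewrite lee_fin.
    - by move=> y _ m n mn; rewrite lee_fin; exact/lefP/nd_nnsfun_approx.
  congr (limn _); apply/funext => n.
  have ms r : measurable (g_ n @^-1` [set r]) by exact: measurable_funPTI.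
  transitivity (\sum_(k \in range (g_ n))
    \int[mu]_(x in phi @^-1` D) ((k * \1_(g_ n @^-1` [set k]) (phi x))%:E * (psi x)%:E))%E.
    rewrite -ge0_integral_fsum//.
    - apply: eq_integral => x _; rewrite -ge0_mule_fsuml.
        by rewrite fsumEFin// -fimfunE.
      by move=> r; exact: nnfun_muleindic_ge0.
    - move=> r; apply/measurable_EFinP/measurable_funTS/measurable_funM => //.
      apply: measurable_funM => //.
      by apply: measurableT_comp mphi; exact: measurable_indic.
    - move=> r x _; apply: mule_ge0; last by rewrite lee_fin.
      exact: nnfun_muleindic_ge0.
  transitivity (\sum_(k \in range (g_ n))
    \int[nu]_(x in D) (k * \1_(g_ n @^-1` [set k]) x)%:E)%E; last first.
    rewrite -ge0_integral_fsum//.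
    - by apply: eq_integral => x _; rewrite fsumEFin// -fimfunE.
    - by move=> r; apply/measurable_EFinP/measurable_funM.
    - by move=> r x _; exact: nnfun_muleindic_ge0.
  apply: eq_fsbigr => k; rewrite inE => -[x0 _ kE].
  have k0 : 0 <= k by rewrite -kE.
  rewrite (@integralZl_indic _ _ _ nu D mD (fun r => g_ n @^-1` [set r]) k)//; last first.
    by move=> /lt_geF; rewrite k0.
  rewrite integral_indic// setIC.
  under eq_integral do rewrite EFinM -muleA.
  rewrite ge0_integralZl//; last 2 first.
  - suff : measurable_fun (phi @^-1` D) (EFin \o
      (fun x => \1_(g_ n @^-1` [set k]) (phi x) * psi x)) by [].
    apply/measurable_EFinP/measurable_funTS/measurable_funM => //.
    by apply: measurableT_comp mphi; exact: measurable_indic.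
  - by move=> x _; rewrite mule_ge0// lee_fin.
  congr (_ * _)%E.
  rewrite -mu_nu; last exact: measurableI.
  rewrite preimage_setI [RHS]integral_mkcondr.
  apply: eq_integral => x _; rewrite patchE -EFinM indicE.
  have [xk|xk] := pselect (g_ n (phi x) = k).
    by rewrite !mem_set//= mul1r.
  by rewrite !memNset//= mul0r.
rewrite -monotone_convergence//.
- apply: eq_integral => y /[!inE] yD; apply/esym/cvg_lim => //.
  apply: cvgeZr => //.
  by apply: cvg_nnsfun_approx.
- move=> n; apply/measurable_EFinP/measurable_funTS.
  exact: measurable_funM.
- by move=> n y _; rewrite mule_ge0// lee_fin.
- move=> y _ m n mn; rewrite lee_wpmul2r ?lee_fin//.
  exact/lefP/nd_nnsfun_approx.
Qed.

Lemma transfer_density D (g : Y -> R) :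
  measurable D -> measurable_fun D g ->
  (\int[mu]_(x in phi @^-1` D) (g (phi x) * psi x)%:E =
   \int[nu]_(x in D) (g x)%:E)%E.
Proof.
move=> mD mg; rewrite integralE [RHS]integralE.
rewrite -(@ge0_transfer_density D ((EFin \o g)^\+)%E)//; last first.
  by apply: measurable_funepos; exact/measurable_EFinP.
rewrite -(@ge0_transfer_density D ((EFin \o g)^\-)%E)//; last first.
  by apply: measurable_funeneg; exact/measurable_EFinP.
congr (_ - _)%E; apply: eq_integral => x _.
  by rewrite !funeposE/= -!EFin_max -EFinM maxr_pMl// mul0r.
by rewrite !funenegE/= -!EFin_max -EFinM maxr_pMl// mul0r mulNr.
Qed.

Lemma transfer_density_integrable D (g : Y -> R) :
  measurable D -> nu.-integrable D (EFin \o g) ->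
  mu.-integrable (phi @^-1` D) (fun x => (g (phi x) * psi x)%:E).
Proof.
move=> mD /integrableP[/measurable_EFinP mg gfin].
have mpD := measurable_preimage mD.
apply/integrableP; split.
  apply/measurable_EFinP/measurable_funM; last exact: measurable_funTS.
  apply: (measurable_comp mD) => //; last exact: measurable_funTS.
  by move=> _ [x Dx <-].
move: gfin; rewrite -ge0_transfer_density//; last first.
  by apply: measurableT_comp => //; exact/measurable_EFinP.
congr (_ < _)%E; apply: eq_integral => x _ /=.
by rewrite -EFinM normrM (ger0_norm (psi0 x)).
Qed.

End transfer_density.

Section change_of_variables.
Context {R : realType}.
Notation mu := (@lebesgue_measure R).
Variables (phi psi : R -> R).
Hypothesis mphi : measurable_fun setT phi.
Hypothesis mpsi : measurable_fun setT psi.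
Hypothesis psi0 : forall x, 0 <= psi x.
Hypothesis phi_psi : forall a b, a < b ->
  (\int[mu]_(x in phi @^-1` `]a, b]) (psi x)%:E = (b - a)%:E)%E.

(** The set function on the left is a measure which agrees with the Lebesgue
measure on half-open intervals, hence on all Borel sets. *)
Lemma lebesgue_jacobian A : measurable A ->
  (\int[mu]_(x in phi @^-1` A) (psi x)%:E = mu A)%E.
Proof.
move=> mA.
pose nu (B : set (measurableTypeR R)) : \bar R :=
  (\int[mu]_(x in phi @^-1` B) (psi x)%:E)%E.
have nu0 : nu set0 = 0%E by rewrite /nu preimage_set0 integral_set0.
have nu_ge0 B : (0 <= nu B)%E by apply: integral_ge0 => x _; rewrite lee_fin.
have nu_sa : semi_sigma_additive nu.
  move=> F mF tF mUF.
  apply: (@semi_sigma_additive_nng_induced _ _ _ mu (EFin \o psi) _ _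
    (fun k => phi @^-1` F k)).
  - exact/measurable_EFinP.
  - by move=> x; rewrite lee_fin.
  - move=> k; exact (measurable_preimage mphi (mF k)).
  - by move=> i j _ _ [x [Fi Fj]]; apply: tF => //; exists (phi x).
  - by rewrite -preimage_bigcup; exact (measurable_preimage mphi mUF).
pose nuM : {measure set (measurableTypeR R) -> \bar R} :=
  HB.pack nu (isMeasure.Build _ _ _ nu nu0 nu_ge0 nu_sa).
suff /(_ A mA) -> : forall B, (R.-ocitv.-measurable).-sigma.-measurable B ->
  mu B = nu B by [].
apply: (@lebesgue_measure_unique R nuM) => X [[a b] _ <-] /=; rewrite lebesgue_measure_itv/= lte_fin.
case: ltP => ab; first by rewrite /nu phi_psi.
by rewrite /nu set_itv_ge ?bnd_simp -?leNgt// preimage_set0 integral_set0.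
Qed.

End change_of_variables.

(** * Derivatives and integrals of real functions *)

Section derivatives.
Context {R : realType}.
Implicit Types (f g : R -> R) (x a b c : R).

(** The rules below have their functions in pointwise form and their
derivatives as explicit values, so that the derivative of a compound
expression is a term built from them, to be compared with the expected value
by [der_eq]. *)
Lemma der_cst c x : is_derive x (1 : R) (fun _ : R => c) 0.
Proof. exact: is_derive_cst. Qed.

Lemma der_id x : is_derive x (1 : R) (fun y : R => y) 1.
Proof. exact: is_derive_id. Qed.

Lemma derD f g x a b : is_derive x (1 : R) f a -> is_derive x (1 : R) g b ->
  is_derive x (1 : R) (fun y => f y + g y) (a + b).
Proof. exact: is_deriveD. Qed.

Lemma derN f x a : is_derive x (1 : R) f a ->
  is_derive x (1 : R) (fun y => - f y) (- a).
Proof. exact: is_deriveN. Qed.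

Lemma derB f g x a b : is_derive x (1 : R) f a -> is_derive x (1 : R) g b ->
  is_derive x (1 : R) (fun y => f y - g y) (a - b).
Proof. exact: is_deriveB. Qed.

Lemma derM f g x a b : is_derive x (1 : R) f a -> is_derive x (1 : R) g b ->
  is_derive x (1 : R) (fun y => f y * g y) (a * g x + f x * b).
Proof.
move=> fa gb; apply: is_derive_eq (is_deriveM fa gb) _.
by rewrite /GRing.scale/= addrC mulrC.
Qed.

Lemma derV f x a : f x != 0 -> is_derive x (1 : R) f a ->
  is_derive x (1 : R) (fun y => (f y)^-1) (- a / f x ^+ 2).
Proof.
move=> fx fa; apply: is_derive_eq (is_deriveV fx fa) _.
by rewrite /GRing.scale/= !mulNr mulrC.
Qed.

Lemma derX f n x a : is_derive x (1 : R) f a ->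
  is_derive x (1 : R) (fun y => f y ^+ n) (n%:R * f x ^+ n.-1 * a).
Proof.
move=> fa; have -> : (fun y => f y ^+ n) = (f : R -> R) ^+ n.
  by apply/funext => y; elim: n => [//|n IH]; rewrite exprS IH exprS.
exact: is_deriveX.
Qed.

Lemma der_ln x : 0 < x -> is_derive x (1 : R) (@ln R) x^-1.
Proof. exact: is_derive1_ln. Qed.

Lemma der_comp f g x a b : is_derive (g x) (1 : R) f a ->
  is_derive x (1 : R) g b -> is_derive x (1 : R) (fun y => f (g y)) (a * b).
Proof. exact: is_derive1_comp. Qed.

Lemma der_eq f x a b : is_derive x (1 : R) f a -> a = b ->
  is_derive x (1 : R) f b.
Proof. by move=> fa <-. Qed.

Lemma der_continuous f x a : is_derive x (1 : R) f a -> {for x, continuous f}.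
Proof.
by move=> [df _]; apply: differentiable_continuous; exact/derivable1_diffP.
Qed.

Lemma derivative0_cst f a b : a <= b ->
  (forall x, a < x < b -> is_derive x (1 : R) f 0) ->
  {within `[a, b], continuous f} -> f a = f b.
Proof.
rewrite le_eqVlt => /predU1P[->//|ab] df cf.
have df' x : x \in `]a, b[ -> is_derive x (1 : R) f (cst 0 x).
  by rewrite in_itv/=; exact: df.
have [c _] := MVT ab df' cf.
by rewrite mul0r => /eqP; rewrite subr_eq0 => /eqP.
Qed.

End derivatives.

Section integrals.
Context {R : realType}.
Notation mu := (@lebesgue_measure R).
Implicit Types (f g : R -> R) (x a b c : R).

Lemma Rint_point f a : \int[mu]_(x in `[a, a]) f x = 0.
Proof. by rewrite set_itv1 Rintegral_set1. Qed.

Lemma integrable_itvS f a b c d : c <= a -> b <= d ->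
  mu.-integrable `[c, d] (EFin \o f) -> mu.-integrable `[a, b] (EFin \o f).
Proof.
by move=> ca bd; apply: integrableS => //; apply: subset_itvScc; rewrite bnd_simp.
Qed.

Lemma Rint_split f a b c : a <= b -> b <= c ->
  mu.-integrable `[a, c] (EFin \o f) ->
  \int[mu]_(x in `[a, c]) f x =
  \int[mu]_(x in `[a, b]) f x + \int[mu]_(x in `[b, c]) f x.
Proof.
move=> ab bc fi.
have := @Rintegral_itvB R f (BLeft a) (BRight c) b fi.
rewrite !bnd_simp => /(_ ab bc) /eqP; rewrite subr_eq => /eqP ->.
rewrite addrC Rintegral_itv_obnd_cbnd//.
apply: integrableS fi => //; apply: subset_itv; by rewrite bnd_simp.
Qed.

Lemma continuous_integrable f a b : {within `[a, b], continuous f} ->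
  mu.-integrable `[a, b] (EFin \o f).
Proof.
by move=> cf; apply: continuous_compact_integrable => //; exact: segment_compact.
Qed.

Lemma continuous_withinW f a b : (forall x, a <= x <= b -> {for x, continuous f}) ->
  {within `[a, b], continuous f}.
Proof.
move=> cf; apply: continuous_in_subspaceT => x; rewrite inE/= in_itv/=.
exact: cf.
Qed.

Lemma Rint_FTC (F f : R -> R) a b : a <= b ->
  (forall x, a <= x <= b -> is_derive x (1 : R) F (f x)) ->
  (forall x, a <= x <= b -> {for x, continuous f}) ->
  \int[mu]_(x in `[a, b]) f x = F b - F a.
Proof.
rewrite le_eqVlt => /predU1P[->|ab] dF cf; first by rewrite Rint_point subrr.
rewrite /Rintegral (@continuous_FTC2 _ _ F)//.
- exact: continuous_withinW.
- split.
  + move=> x; rewrite in_itv/= => /andP[ax xb].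
    by have [] := dF x; rewrite ?(ltW ax) ?(ltW xb).
  + apply: cvg_at_right_filter; apply: (@der_continuous _ _ _ (f a)).
    by apply: dF; rewrite lexx ltW.
  + apply: cvg_at_left_filter; apply: (@der_continuous _ _ _ (f b)).
    by apply: dF; rewrite lexx ltW.
- move=> x; rewrite in_itv/= => /andP[ax xb].
  by rewrite derive1E; have [] := dF x; rewrite ?(ltW ax) ?(ltW xb).
Qed.

Lemma der_Rint f a x u : a < x -> x < u ->
  mu.-integrable `[a, u] (EFin \o f) -> {for x, continuous f} ->
  is_derive x (1 : R) (fun y => \int[mu]_(t in `[a, y]) f t) (f x).
Proof.
move=> ax xu fi cf.
have [d e] := continuous_FTC1_closed xu fi ax cf.
by split; [exact: d|rewrite -derive1E; exact: e].
Qed.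

(** Extending [f] by 0 on the negative axis makes 0 an interior point, so
that continuity on a segment around the point gives continuity at the point
on both sides. *)
Lemma Rint_continuous f : (forall b, mu.-integrable `[0, b] (EFin \o f)) ->
  continuous (fun y : R => \int[mu]_(t in `[0, y]) f t).
Proof.
move=> fi x.
pose c := `|x| + 1; pose g := f \_ `[0, +oo[.
have c0 : - c < c by rewrite gtrN// /c ltr_wpDl.
have sub y : `[- c, y] `&` `[0, +oo[ = `[0, y]%classic :> set R.
  apply/seteqP; split => z /=; rewrite !in_itv/= andbT.
    by move=> [/andP[_ ->] ->].
  move=> /andP[z0 ->]; rewrite z0 (le_trans _ z0)//.
  by rewrite oppr_le0 /c addr_ge0.
have gi : mu.-integrable `[- c, c] (EFin \o g).
  rewrite -restrict_EFin; apply/(integrable_restrict _ _ _ _) => //.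
  have := fi c; rewrite -(sub c); exact.
have := parameterized_integral_continuous (ltW c0) gi.
move=> /(continuous_within_itvP _ c0)[/(_ x)].
rewrite in_itv/=.
have -> : - c < x < c.
  by rewrite -ltr_norml /c ltrDl.
have -> : (fun y : R => parameterized_integral mu (- c) y g) =
          (fun y : R => \int[mu]_(t in `[0, y]) f t).
  by apply/funext => y; rewrite /parameterized_integral /g -Rintegral_mkcondr sub.
by move=> h _ _; exact: h.
Qed.

Lemma normr_Rint_le f a b M : a <= b -> mu.-integrable `[a, b] (EFin \o f) ->
  (forall x, a <= x <= b -> `|f x| <= M) ->
  `|\int[mu]_(x in `[a, b]) f x| <= M * (b - a).
Proof.
move=> ab fi fM.
apply: (le_trans (le_normr_Rintegral _ fi)) => //.
have <- : \int[mu]_(x in `[a, b]) M = M * (b - a).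
  by rewrite Rintegral_cst//= lebesgue_measure_itv/= lte_fin;
    move: ab; rewrite le_eqVlt => /predU1P[->|->]; rewrite ?ltxx ?subrr.
apply: le_Rintegral => //.
- exact: integrable_norm.
- by apply: continuous_integrable; apply: continuous_withinW => x _; exact: cst_continuous.
Qed.

End integrals.

(** * Inversion of the half-line *)

Lemma measurable_inv (R : realType) : measurable_fun setT (@GRing.inv R).
Proof.
have -> : [set: R] = `]-oo, 0[ `|` ([set 0] `|` `]0, +oo[).
  apply/esym/seteqP; split=> // x _ /=; rewrite !in_itv/= andbT.
  by have [| |] := ltgtP x 0; [left|right; right|right; left].
apply/measurable_funU => //; first exact: measurableU.
split.
  apply: open_continuous_measurable_fun => // x; rewrite inE/= in_itv/= => x0.
  by apply: inv_continuous; rewrite lt_eqF.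
apply/measurable_funU => //; split; first exact: measurable_fun_set1.
apply: open_continuous_measurable_fun => // x; rewrite inE/= in_itv/= andbT => x0.
by apply: inv_continuous; rewrite gt_eqF.
Qed.

Section lebesgue_substitution.
Context {R : realType}.
Notation mu := (@lebesgue_measure R).

Lemma der_Ninv (x : R) : x != 0 -> is_derive x (1 : R) (fun y : R => - y^-1) (x ^- 2).
Proof.
move=> x0; apply: der_eq (derN (derV x0 (der_id x))) _.
by rewrite mulNr opprK mul1r.
Qed.

Lemma continuous_invX2 (x : R) : x != 0 -> {for x, continuous (fun y : R => y ^- 2)}.
Proof.
by move=> x0; apply: continuousV; [rewrite sqrf_eq0|exact: exprn_continuous].
Qed.

Lemma integral_inv_sqr_tail (b : R) : 0 < b ->
  (\int[mu]_(x in `[(b^-1)%R, +oo[) (x ^- 2)%R%:E = b%:E)%E.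
Proof.
move=> b0; have bi0 : 0 < b^-1 by rewrite invr_gt0.
rewrite (@ge0_continuous_FTC2y _ _ (fun y : R => - y^-1) _ 0).
- by rewrite invrK -EFinD sub0r opprK.
- by move=> x _; rewrite invr_ge0 sqr_ge0.
- apply: continuous_in_subspaceT => x; rewrite inE/= in_itv/= andbT => bx.
  by apply: continuous_invX2; rewrite gt_eqF// (lt_le_trans bi0).
- rewrite -oppr0; apply: cvgN.
  apply/cvgrPdist_le => e e0; near=> x.
  have x0 : 0 < x by near: x; exact: nbhs_pinfty_gt.
  rewrite sub0r !normrN ger0_norm; last by rewrite invr_ge0 ltW.
  rewrite -[leRHS]invrK lef_pV2 ?posrE ?invr_gt0//.
- by move=> x bx; have [] := @der_Ninv x; rewrite // gt_eqF ?(lt_trans bi0 bx).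
- apply: cvg_at_right_filter.
  apply: (@der_continuous _ (fun y : R => - y^-1) _ (b^-1 ^- 2)).
  by apply: der_Ninv; rewrite gt_eqF.
- move=> x; rewrite in_itv/= andbT => bx.
  by rewrite derive1E; have [] := @der_Ninv x; rewrite // gt_eqF ?(lt_trans bi0 bx).
Unshelve. all: by end_near. Qed.

(** Extended by the identity on the nonpositive half-line, the inversion is a
bijection of the whole line, which is what the uniqueness of the Lebesgue
measure asks for. *)
Definition inversion (x : R) : R := if 0 < x then x^-1 else x.
Definition inversion_jacobian (x : R) : R := if 0 < x then x ^- 2 else 1.

Lemma measurable_pos : measurable_fun setT (fun x : R => 0 < x).
Proof. exact: measurable_fun_ltr. Qed.

Lemma measurable_inversion : measurable_fun setT inversion.
Proof.
apply: measurable_fun_if => //; first exact: measurable_pos.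
by apply: measurable_funTS; exact: measurable_inv.
Qed.

Lemma measurable_inversion_jacobian : measurable_fun setT inversion_jacobian.
Proof.
apply: measurable_fun_if => //; first exact: measurable_pos.
apply: measurable_funTS; apply: (measurableT_comp (@measurable_inv R)).
exact: exprn_measurable.
Qed.

Lemma inversion_jacobian_ge0 x : 0 <= inversion_jacobian x.
Proof. by rewrite /inversion_jacobian; case: ifP => // _; rewrite invr_ge0 sqr_ge0. Qed.

Local Lemma integral_inversion_pos (a b : R) : 0 <= a -> a < b ->
  (\int[mu]_(x in inversion @^-1` `]a, b]) (inversion_jacobian x)%:E = (b - a)%:E)%E.
Proof.
move=> a0 ab; have b0 := le_lt_trans a0 ab.
have bi0 : 0 < b^-1 by rewrite invr_gt0.
have tail c : 0 < c -> (\int[mu]_(x in `[(c^-1)%R, +oo[) (inversion_jacobian x)%:E = c%:E)%E.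
  move=> c0; rewrite -[RHS]integral_inv_sqr_tail//; apply: eq_integral => x.
  rewrite inE/= in_itv/= andbT => cx.
  by rewrite /inversion_jacobian (lt_le_trans _ cx)// invr_gt0.
move: a0; rewrite le_eqVlt => /predU1P[a0|a0].
  rewrite -a0 subr0 -[RHS]tail//; congr (integral _ _ _).
  apply/seteqP; split => x /=; rewrite /inversion !in_itv/= andbT; case: ifPn.
  - by move=> x0 /andP[_]; rewrite -[leRHS]invrK lef_pV2 ?posrE ?invr_gt0.
  - by move=> /negPf ->.
  - by move=> x0 bx; rewrite invr_gt0 x0/= -[leRHS]invrK lef_pV2 ?posrE ?invr_gt0.
  - by move=> + bx; rewrite (lt_le_trans bi0).
have ai0 : 0 < a^-1 by rewrite invr_gt0.
have iab : b^-1 < a^-1 by rewrite ltf_pV2.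
have -> : inversion @^-1` `]a, b] = `[b^-1, a^-1[%classic.
  apply/seteqP; split => x /=; rewrite /inversion !in_itv/=; case: ifPn.
  - move=> x0; rewrite -{1}[a]invrK -{1}[b]invrK ltf_pV2 ?lef_pV2 ?posrE ?invr_gt0//.
    by move=> /andP[-> ->].
  - by rewrite -leNgt => x0 /andP[ax _]; move: (lt_le_trans ax x0); rewrite ltNge (ltW a0).
  - move=> x0; rewrite -{2}[a]invrK -{2}[b]invrK ltf_pV2 ?lef_pV2 ?posrE ?invr_gt0//.
    by move=> /andP[-> ->].
  - by move=> + /andP[bx _]; rewrite (lt_le_trans bi0).
have := tail _ b0.
have -> : `[b^-1, +oo[%classic = `[b^-1, a^-1[%classic `|` `[a^-1, +oo[%classic :> set R.
  by rewrite -itv_bndbnd_setU ?bnd_simp// ltW.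
rewrite ge0_integral_setU//=.
- by rewrite tail// => /(congr1 (fun z => z - a%:E)%E); rewrite addeK.
- by apply/measurable_EFinP/measurable_funTS; exact: measurable_inversion_jacobian.
- by move=> x _; rewrite lee_fin inversion_jacobian_ge0.
- apply/disj_setPS => x [/=]; rewrite !in_itv/= andbT => /andP[_ xa].
  by rewrite leNgt xa.
Qed.

Local Lemma integral_inversion_neg (a b : R) : a < b -> b <= 0 ->
  (\int[mu]_(x in inversion @^-1` `]a, b]) (inversion_jacobian x)%:E = (b - a)%:E)%E.
Proof.
move=> ab b0.
have -> : inversion @^-1` `]a, b] = `]a, b]%classic.
  apply/seteqP; split => x /=; rewrite /inversion !in_itv/=; case: ifPn => //.
    by move=> x0 /andP[_ xb]; move: (le_trans xb b0); rewrite invr_le0 leNgt x0.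
  by move=> x0 /andP[_ xb]; move: (le_trans xb b0); rewrite leNgt x0.
transitivity (\int[mu]_(x in `]a, b]) (cst 1%:E x))%E.
  apply: eq_integral => x; rewrite inE/= in_itv/= => /andP[_ xb].
  by rewrite /inversion_jacobian ltNge (le_trans xb b0).
by rewrite integral_cst//= mul1e lebesgue_measure_itv/= lte_fin ab.
Qed.

Lemma integral_inversion (a b : R) : a < b ->
  (\int[mu]_(x in inversion @^-1` `]a, b]) (inversion_jacobian x)%:E = (b - a)%:E)%E.
Proof.
move=> ab; have [a0|a0] := leP 0 a; first exact: integral_inversion_pos.
have [b0|b0] := leP b 0; first exact: integral_inversion_neg.
have -> : `]a, b]%classic = `]a, 0]%classic `|` `]0, b]%classic :> set R.
  by rewrite -itv_bndbnd_setU ?bnd_simp// ltW.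
rewrite preimage_setU ge0_integral_setU//=.
- by rewrite integral_inversion_neg// integral_inversion_pos// -EFinD sub0r subr0 addrC.
- exact (measurable_preimage measurable_inversion (measurable_itv _)).
- exact (measurable_preimage measurable_inversion (measurable_itv _)).
- by apply/measurable_EFinP/measurable_funTS; exact: measurable_inversion_jacobian.
- by move=> x _; rewrite lee_fin inversion_jacobian_ge0.
- apply/disj_setPS => x [/=]; rewrite !in_itv/= => /andP[_ xa].
  by rewrite ltNge xa.
Qed.

End lebesgue_substitution.

(** * Affine substitutions and inversion under the integral *)

Section substitutions.
Context {R : realType}.
Notation mu := (@lebesgue_measure R).

Lemma measurable_affine (c d : R) : measurable_fun setT (fun x : R => c * x + d).
Proof. by apply: measurable_funD => //; apply: measurable_funM. Qed.

Lemma integral_affine (c d a b : R) : 0 < c -> a < b ->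
  (\int[mu]_(x in (fun x : R => c * x + d)%R @^-1` `]a, b]) (c)%:E = (b - a)%:E)%E.
Proof.
move=> c0 ab.
have -> : (fun x => c * x + d) @^-1` `]a, b] =
    `](a - d) / c, (b - d) / c]%classic.
  apply/seteqP; split => x /=; rewrite !in_itv/= ltr_pdivrMr// ler_pdivlMr//;
  by rewrite ltrBlDr lerBrDr mulrC.
rewrite integral_cst//= lebesgue_measure_itv/= lte_fin ltr_pM2r ?invr_gt0// ltrD2r ab.
by rewrite -EFinB -EFinM; congr (_%:E); field; rewrite gt_eqF.
Qed.

Lemma ge0_integral_affine (c d : R) D (g : R -> \bar R) : 0 < c ->
  measurable D -> measurable_fun D g -> (forall x, D x -> 0 <= g x)%E ->
  (\int[mu]_(x in (fun x : R => c * x + d)%R @^-1` D) (g (c * x + d)%R * c%:E) =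
   \int[mu]_(x in D) g x)%E.
Proof.
move=> c0 mD mg g0.
apply: (@ge0_transfer_density _ _ _ _ _ mu mu (fun x => c * x + d) (cst c)) => //.
- exact: measurable_affine.
- by move=> x; exact: ltW.
- apply: lebesgue_jacobian => //; first exact: measurable_affine.
  + by move=> x; exact: ltW.
  + by move=> a b ab; exact: integral_affine.
Qed.

Lemma integral_affine_real (c d : R) D (g : R -> R) : 0 < c ->
  measurable D -> measurable_fun D g ->
  (\int[mu]_(x in (fun x : R => c * x + d)%R @^-1` D) (g (c * x + d)%R * c)%:E =
   \int[mu]_(x in D) (g x)%:E)%E.
Proof.
move=> c0 mD mg.
apply: (@transfer_density _ _ _ _ _ mu mu (fun x => c * x + d) (cst c)) => //.
- exact: measurable_affine.
- by move=> x; exact: ltW.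
- apply: lebesgue_jacobian => //; first exact: measurable_affine.
  + by move=> x; exact: ltW.
  + by move=> a b ab; exact: integral_affine.
Qed.

Lemma Rint_scale (c a b : R) (g : R -> R) : 0 < c ->
  measurable_fun `[c * a, c * b] g ->
  \int[mu]_(x in `[a, b]) (g (c * x) * c) = \int[mu]_(x in `[c * a, c * b]) g x.
Proof.
move=> c0 mg; rewrite /Rintegral -(@integral_affine_real c 0 `[c * a, c * b]%classic g)//.
congr fine; transitivity (\int[mu]_(x in (fun x : R => c * x + 0)%R @^-1`
    `[(c * a)%R, (c * b)%R]) (g (c * x) * c)%R%:E)%E.
  by congr (integral _ _ _); apply/seteqP; split => x /=;
    rewrite !in_itv/= addr0 !ler_pM2l.
by apply: eq_integral => x _; rewrite addr0.
Qed.

Lemma shift_itv (a b c : R) :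
  (fun x => 1 * x + c) @^-1` `[a + c, b + c] = `[a, b]%classic.
Proof. by apply/seteqP; split => x /=; rewrite !in_itv/= mul1r !lerD2r. Qed.

Lemma Rint_shift (c a b : R) (g : R -> R) :
  measurable_fun `[a + c, b + c] g ->
  \int[mu]_(x in `[a, b]) g (x + c) = \int[mu]_(x in `[a + c, b + c]) g x.
Proof.
move=> mg; rewrite /Rintegral -(@integral_affine_real 1 c `[a + c, b + c]%classic g)//.
congr fine; transitivity (\int[mu]_(x in (fun x : R => 1 * x + c)%R @^-1`
    `[(a + c)%R, (b + c)%R]) (g (x + c)%R)%:E)%E.
  by congr (integral _ _ _); rewrite shift_itv.
by apply: eq_integral => x _; rewrite mul1r mulr1.
Qed.

Lemma ge0_integral_shift (c : R) D (g : R -> \bar R) :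
  measurable D -> measurable_fun D g -> (forall x, D x -> 0 <= g x)%E ->
  (\int[mu]_(x in (fun x : R => x + c)%R @^-1` D) (g (x + c)%R) =
   \int[mu]_(x in D) g x)%E.
Proof.
move=> mD mg g0; rewrite -(@ge0_integral_affine 1 c D g)//.
transitivity (\int[mu]_(x in (fun x => 1 * x + c)%R @^-1` D) g (x + c)%R)%E.
  by congr (integral _ _ _); apply/seteqP; split=> x /=; rewrite mul1r.
by apply: eq_integral => x _; rewrite mul1r mule1.
Qed.

Lemma lebesgue_inversion A : measurable A ->
  (\int[mu]_(x in inversion @^-1` A) (inversion_jacobian x)%:E = mu A)%E.
Proof.
apply: lebesgue_jacobian.
- exact: measurable_inversion.
- exact: measurable_inversion_jacobian.
- exact: inversion_jacobian_ge0.
- exact: integral_inversion.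
Qed.

Lemma inversion_preimage (D : set R) : (forall x : R, D x -> 0 < x) ->
  inversion @^-1` D = [set x | 0 < x /\ D x^-1].
Proof.
move=> D0; apply/seteqP; split => x /=; rewrite /inversion.
  by case: ifPn => [x0 Dx|x0 /D0]; rewrite ?(negPf x0).
by move=> [-> ].
Qed.

Lemma ge0_integral_inv (D : set R) (g : R -> \bar R) : (forall x : R, D x -> 0 < x) ->
  measurable D -> measurable_fun D g -> (forall x, D x -> 0 <= g x)%E ->
  (\int[mu]_(x in [set x | (0 < x)%R /\ D (x^-1)%R]) (g (x^-1)%R * (x ^- 2)%R%:E) =
   \int[mu]_(x in D) g x)%E.
Proof.
move=> D0 mD mg g0.
rewrite -(@ge0_transfer_density _ _ _ _ _ mu mu _ _ measurable_inversion
  measurable_inversion_jacobian inversion_jacobian_ge0 lebesgue_inversion D g)//.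
rewrite inversion_preimage//; apply: eq_integral => x /[!inE]/= -[x0 _].
by rewrite /inversion /inversion_jacobian x0.
Qed.

Lemma inv_itv (a b : R) : 0 < a -> 0 < b ->
  [set x | 0 < x /\ `[a, b]%classic x^-1] = `[b^-1, a^-1]%classic :> set R.
Proof.
move=> a0 b0; have bi0 : 0 < b^-1 by rewrite invr_gt0.
apply/seteqP; split => x /=; rewrite !in_itv/=.
  move=> [x0]; rewrite -{1}[a]invrK -{1}[b]invrK !lef_pV2 ?posrE ?invr_gt0//.
  by move=> /andP[-> ->].
move=> /andP[bx xa]; have x0 := lt_le_trans bi0 bx; split => //.
by rewrite -[a]invrK -[b]invrK !lef_pV2 ?posrE ?invr_gt0// bx xa.
Qed.

Lemma integral_inv_real (D : set R) (g : R -> R) : (forall x : R, D x -> 0 < x) ->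
  measurable D -> measurable_fun D g ->
  (\int[mu]_(x in [set x | (0 < x)%R /\ D (x^-1)%R]) (g (x^-1) * x ^- 2)%R%:E =
   \int[mu]_(x in D) (g x)%:E)%E.
Proof.
move=> D0 mD mg.
rewrite -(@transfer_density _ _ _ _ _ mu mu _ _ measurable_inversion
  measurable_inversion_jacobian inversion_jacobian_ge0 lebesgue_inversion D g)//.
rewrite inversion_preimage//; apply: eq_integral => x /[!inE]/= -[x0 _].
by rewrite /inversion /inversion_jacobian x0.
Qed.

Lemma Rint_inv (a b : R) (g : R -> R) : 0 < a -> 0 < b ->
  measurable_fun `[a, b] g ->
  \int[mu]_(x in `[b^-1, a^-1]) (g x^-1 * x ^- 2) = \int[mu]_(x in `[a, b]) g x.
Proof.
move=> a0 b0 mg; rewrite /Rintegral -(@integral_inv_real `[a, b]%classic g)//.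
  by rewrite inv_itv.
by move=> x /=; rewrite in_itv/= => /andP[ax _]; exact: lt_le_trans ax.
Qed.

Lemma integrable_inv (a b : R) (g : R -> R) : 0 < a -> 0 < b ->
  mu.-integrable `[a, b] (EFin \o g) ->
  mu.-integrable `[b^-1, a^-1] (fun x => (g x^-1 * x ^- 2)%:E).
Proof.
move=> a0 b0 gi.
have := @transfer_density_integrable _ _ _ _ _ mu mu inversion inversion_jacobian.
move=> /(_ measurable_inversion measurable_inversion_jacobian).
move=> /(_ inversion_jacobian_ge0 lebesgue_inversion _ _ _ gi).
rewrite inversion_preimage; last first.
  by move=> x /=; rewrite in_itv/= => /andP[ax _]; exact: lt_le_trans ax.
rewrite inv_itv// => /(_ (measurable_itv _)); apply: eq_integrable => //.
move=> x /[!inE]/=; rewrite in_itv/= => /andP[bx _].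
have x0 : 0 < x by rewrite (lt_le_trans _ bx)// invr_gt0.
by rewrite /inversion /inversion_jacobian x0.
Qed.

End substitutions.

(** * Integration by parts for an integrable factor *)

Section by_parts.
Context {R : realType}.
Notation mu := (@lebesgue_measure R).

Lemma integrable_measurable (D : set R) (f : R -> R) :
  mu.-integrable D (EFin \o f) -> measurable_fun D f.
Proof. by move=> /integrableP[/measurable_EFinP]. Qed.

Lemma integrable_scale (D : set R) (f : R -> R) (c : R) : measurable D ->
  mu.-integrable D (EFin \o f) -> mu.-integrable D (EFin \o (fun x => c * f x)).
Proof.
move=> mD fi; have := @integrableZl _ _ _ mu D mD c _ fi.
by apply: eq_integrable => // x _ /=; rewrite EFinM.
Qed.

Lemma integrable_add (D : set R) (f g : R -> R) : measurable D ->
  mu.-integrable D (EFin \o f) -> mu.-integrable D (EFin \o g) ->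
  mu.-integrable D (EFin \o (fun x => f x + g x)).
Proof.
move=> mD fi gi; have := @integrableD _ _ _ mu D mD _ _ fi gi.
by apply: eq_integrable => // x _ /=; rewrite EFinD.
Qed.

Lemma integrable_sub (D : set R) (f g : R -> R) : measurable D ->
  mu.-integrable D (EFin \o f) -> mu.-integrable D (EFin \o g) ->
  mu.-integrable D (EFin \o (fun x => f x - g x)).
Proof.
move=> mD fi gi; have := @integrableB _ _ _ mu D mD _ _ fi gi.
by apply: eq_integrable => // x _ /=; rewrite EFinB.
Qed.

Lemma integrable_boundedM (D : set R) (f w : R -> R) (M : R) :
  measurable D -> mu.-integrable D (EFin \o f) -> measurable_fun D w ->
  (forall x, D x -> `|w x| <= M) ->
  mu.-integrable D (fun x => (w x * f x)%:E).
Proof.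
move=> mD fi mw wM; have mf := integrable_measurable fi.
apply: (@le_integrable _ _ _ mu D mD _ (fun x => M%:E * (EFin \o f) x)%E).
- by apply/measurable_EFinP/measurable_funM.
- move=> x Dx /=; rewrite lee_fin !normrM ler_wpM2r//.
  by rewrite (le_trans (wM _ Dx)) ?ler_norm.
- exact: integrableZl.
Qed.

Lemma continuous_segment_bounded (w : R -> R) (a b : R) :
  {within `[a, b], continuous w} ->
  exists2 M, 0 <= M & forall x, a <= x <= b -> `|w x| <= M.
Proof.
move=> cw; have [M [_ wM]] := compact_bounded (continuous_compact cw (@segment_compact R a b)).
exists (`|M| + 1) => [|x xab]; first by rewrite addr_ge0.
apply: (wM (`|M| + 1)); first by rewrite (le_lt_trans (ler_norm M))// ltrDl.
by exists x => //=; rewrite in_itv.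
Qed.

Lemma integrable_continuousM (f w : R -> R) (a b : R) :
  mu.-integrable `[a, b] (EFin \o f) ->
  {within `[a, b], continuous w} ->
  mu.-integrable `[a, b] (fun x => (w x * f x)%:E).
Proof.
move=> fi cw; have [M _ wM] := continuous_segment_bounded cw.
apply: (@integrable_boundedM _ _ _ M) => //.
by apply: subspace_continuous_measurable_fun.
Qed.

Lemma in_segment (a b x : R) : (x \in `[a, b]%classic) = (a <= x <= b).
Proof. by apply/idP/idP; rewrite inE/= in_itv. Qed.

Section triangle.
Variables (f v : R -> R) (a b : R).
Hypothesis fi : mu.-integrable `[a, b] (EFin \o f).
Hypothesis vi : mu.-integrable `[a, b] (EFin \o v).

Let f0 := f \_ `[a, b].
Let v0 := v \_ `[a, b].
Let F (z : R * R) : R := f0 z.1 * v0 z.2 * (z.1 <= z.2)%R%:R.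

Let f0i : mu.-integrable setT (EFin \o f0).
Proof. by rewrite -restrict_EFin; apply/(integrable_mkcond _ _).1. Qed.

Let v0i : mu.-integrable setT (EFin \o v0).
Proof. by rewrite -restrict_EFin; apply/(integrable_mkcond _ _).1. Qed.

Let mF : measurable_fun setT F.
Proof.
have mf := integrable_measurable f0i; have mv := integrable_measurable v0i.
apply: measurable_funM.
  apply: measurable_funM.
    exact: (measurableT_comp mf measurable_fst).
  exact: (measurableT_comp mv measurable_snd).
suff -> : (fun z : R * R => (z.1 <= z.2)%R%:R : R) =
   (fun z : R * R => if z.1 <= z.2 then 1 else 0).
  apply: measurable_fun_ifT => //.
  apply: measurable_fun_ler; [exact: measurable_fst|exact: measurable_snd].
by apply/funext => z; case: ifP.
Qed.

Let Fi : (mu \x mu)%E.-integrable setT (EFin \o F).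
Proof.
apply/integrable12ltyP; first exact/measurable_EFinP.
have /integrableP[_ fy] := f0i.
have vfin : (\int[mu]_u `|(v0 u)%:E| \is a fin_num)%E.
  rewrite ge0_fin_numE; first by case/integrableP : v0i.
  exact: integral_ge0.
apply: (@le_lt_trans _ _ (\int[mu]_t (`|(f0 t)%:E| * \int[mu]_u `|(v0 u)%:E|))%E).
  apply: ge0_le_integral => //.
  - by move=> t _; exact: integral_ge0.
  - have mabsF : measurable_fun setT (fun z : R * R => `|(F z)%:E|%E).
      by apply: measurableT_comp => //; exact/measurable_EFinP.
    exact (@measurable_fun_fubini_tonelli_F _ _ (measurableTypeR R) (measurableTypeR R) R mu
      (fun z : R * R => `|(F z)%:E|%E) mabsF (fun z => abse_ge0 _)).
  - rewrite -(fineK vfin); apply: emeasurable_funM => //.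
    apply: measurableT_comp => //; apply/measurable_EFinP.
    exact: integrable_measurable f0i.
  move=> t _; rewrite -ge0_integralZl//.
  - apply: ge0_le_integral => //.
    + apply: measurableT_comp => //; apply/measurable_EFinP.
      exact: (measurableT_comp mF (measurable_pair1 t)).
    + apply: emeasurable_funM => //; apply: measurableT_comp => //.
      by apply/measurable_EFinP; exact: integrable_measurable v0i.
    + move=> u _; rewrite /= lee_fin /F/= !normrM ler_piMr ?mulr_ge0//.
      by case: (t <= u); rewrite ?normr1 ?normr0.
  - by apply: measurableT_comp => //; apply/measurable_EFinP;
      exact: integrable_measurable v0i.
rewrite ge0_integralZr//.
- rewrite -(fineK vfin); apply: lte_mul_pinfty => //.
  + exact: integral_ge0.
  + rewrite ge0_fin_numE//; exact: integral_ge0.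
  + by rewrite ltry.
- apply: measurableT_comp => //; apply/measurable_EFinP.
  exact: integrable_measurable f0i.
- exact: integral_ge0.
Qed.

(** Both sides are iterated integrals of [f t * v u] over the triangle [t <=
u]; this is Fubini. *)
Lemma Rint_triangle :
  \int[mu]_(t in `[a, b]) (f t * \int[mu]_(u in `[t, b]) v u) =
  \int[mu]_(u in `[a, b]) (v u * \int[mu]_(t in `[a, u]) f t).
Proof.
have := Fubini Fi; rewrite /=.
have -> : (fun t => \int[mu]_u (F (t, u))%:E)%E =
    EFin \o ((fun t => f t * \int[mu]_(u in `[t, b]) v u) \_ `[a, b]).
  apply/funext => t /=; rewrite patchE; case: ifPn => tab; last first.
    rewrite -[RHS](integral0 mu setT); apply: eq_integral => u _.
    by rewrite /F /f0 /= patchE (negPf tab) !mul0r.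
  move: (tab); rewrite inE/= in_itv/= => /andP[at_ tb].
  rewrite /Rintegral.
  have vti : mu.-integrable `[t, b] (EFin \o v) by exact: integrable_itvS vi.
  rewrite EFinM fineK; last exact: integrable_fin_num.
  rewrite -integralZl// [RHS]integral_mkcond; apply: eq_integral => u _.
  rewrite /F /f0 /v0 /= !patchE tab !in_segment.
  have [tu|tu] /= := leP t u; last by rewrite mulr0.
  by rewrite (le_trans at_ tu)/=; case: ifP; rewrite !(mulr1, mulr0).
have -> : (fun u => \int[mu]_t (F (t, u))%:E)%E =
    EFin \o ((fun u => v u * \int[mu]_(t in `[a, u]) f t) \_ `[a, b]).
  apply/funext => u /=; rewrite patchE; case: ifPn => uab; last first.
    rewrite -[RHS](integral0 mu setT); apply: eq_integral => t _.
    by rewrite /F /v0 /= patchE (negPf uab) mulr0 mul0r.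
  move: (uab); rewrite inE/= in_itv/= => /andP[au ub].
  rewrite /Rintegral.
  have fui : mu.-integrable `[a, u] (EFin \o f) by exact: integrable_itvS fi.
  rewrite EFinM fineK; last exact: integrable_fin_num.
  rewrite -integralZl// [RHS]integral_mkcond; apply: eq_integral => t _.
  rewrite /F /f0 /v0 /= !patchE uab !in_segment.
  have [tu|tu] /= := leP t u; last by rewrite mulr0 andbF.
  by rewrite (le_trans tu ub) !andbT mulr1 mulrC; case: ifP; rewrite ?mulr0.
by rewrite /Rintegral -!restrict_EFin -!integral_mkcond => ->.
Qed.

End triangle.

(** As [f] is only integrable, its primitive need not be differentiable at
every point: [w b - w x] is written as the integral of [w'] and the order of
integration exchanged by [Rint_triangle]. *)
Lemma Rint_by_parts (f w w' : R -> R) (a b : R) : a <= b ->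
  mu.-integrable `[a, b] (EFin \o f) ->
  (forall x, a <= x <= b -> is_derive x (1 : R) w (w' x)) ->
  (forall x, a <= x <= b -> {for x, continuous w'}) ->
  \int[mu]_(x in `[a, b]) (w x * f x) =
  w b * \int[mu]_(x in `[a, b]) f x -
  \int[mu]_(x in `[a, b]) (w' x * \int[mu]_(t in `[a, x]) f t).
Proof.
move=> ab fi dw cw'.
have cw : {within `[a, b], continuous w}.
  by apply: continuous_withinW => x /dw; exact: der_continuous.
rewrite -Rint_triangle//; last first.
  by apply: continuous_integrable; exact: continuous_withinW.
rewrite -RintegralZl//.
transitivity (\int[mu]_(x in `[a, b]) (w b * f x - (w b - w x) * f x)).
  by apply: eq_Rintegral => x _; ring.
rewrite RintegralB//; last 2 first.
- by apply: (integrable_continuousM (w := fun=> w b)) => // x; exact: cst_continuous.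
- apply: (integrable_continuousM (w := fun x => w b - w x)) => // x.
  by apply: continuousB; [exact: cst_continuous|exact: cw].
congr (_ - _); apply: eq_Rintegral => x; rewrite in_segment => /andP[ax xb].
suff -> : \int[mu]_(y in `[x, b]) w' y = w b - w x by rewrite mulrC.
apply: Rint_FTC => //.
- by move=> y /andP[xy yb]; apply: dw; rewrite yb (le_trans ax).
- by move=> y /andP[xy yb]; apply: cw'; rewrite yb (le_trans ax).
Qed.

End by_parts.

(** * Series with telescoping bounds, fractional part, second Bernoulli function *)

Section telescoping_series.
Context {R : realType}.
Variables (a : nat -> R -> R) (t : nat -> R) (D : set R).
Hypothesis at_ : forall n x, D x -> `|a n x| <= t n - t n.+1.
Hypothesis t0 : forall n, 0 <= t n.
Hypothesis tcvg : t n @[n --> \oo] --> (0 : R).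

(** If the terms are dominated by the differences of a sequence [t]
decreasing to 0, the tails are dominated by [t] itself. This gives explicit
error bounds and uniform convergence without summing the dominating series. *)
Definition series_fun (x : R) : R := limn (series (fun n => a n x)).

Let tail n k x : D x -> `|series (a^~ x) (n + k)%N - series (a^~ x) n| <= t n - t (n + k)%N.
Proof.
move=> Dx; elim: k => [|k IH]; first by rewrite addn0 !subrr normr0.
rewrite addnS seriesSr; have := at_ (n + k) Dx.
set s := series _ _; set s' := series _ _; set b := a _ x.
move: IH; rewrite -/s -/s' => IH h.
rewrite (_ : s + b - s' = (s - s') + b); last by ring.
by rewrite (le_trans (ler_normD _ _))//; move: IH h; lra.
Qed.

Lemma series_fun_cvg x : D x -> cvgn (series (fun n => a n x)).
Proof.
move=> Dx; apply: normed_cvg.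
apply: (@series_le_cvg _ _ (fun n => t n - t n.+1)) => [n|n|n|].
- exact: normr_ge0.
- exact: le_trans (at_ n Dx).
- exact: at_.
have -> : series (fun n => t n - t n.+1) = (fun n => t 0%N - t n).
  apply/funext; elim => [|n IH]; first by rewrite seriesEnat/= big_geq// subrr.
  by rewrite seriesSr IH; ring.
by apply: is_cvgB; [exact: is_cvg_cst|apply/cvg_ex; exists 0].
Qed.

Lemma series_fun_tail n x : D x -> `|series_fun x - series (a^~ x) n| <= t n.
Proof.
move=> Dx; have cx := series_fun_cvg Dx.
have h : `|series (a^~ x) (k + n)%N - series (a^~ x) n| @[k --> \oo] -->
    `|series_fun x - series (a^~ x) n|.
  apply: cvg_norm; apply: cvgB; last exact: cvg_cst.
  by rewrite (cvg_shiftn n (series (a^~ x)) _).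
rewrite -(cvg_lim _ h)//; apply: limr_le; first by apply/cvg_ex; eexists; exact: h.
near=> k; rewrite addnC (le_trans (tail _ _ Dx))//.
by rewrite lerBlDr lerDl.
Unshelve. all: by end_near. Qed.

Lemma series_fun_continuous x : nbhs x D -> (forall n, {for x, continuous (a n)}) ->
  {for x, continuous series_fun}.
Proof.
move=> nD ca; have Dx := nbhs_singleton nD.
have cs n : {for x, continuous (fun y => series (a^~ y) n)}.
  elim: n => [|n IH].
    rewrite (_ : (fun y => _) = cst 0); first exact: cst_continuous.
    by apply/funext => y; rewrite seriesEnat/= big_geq.
  rewrite (_ : (fun y => _) = (fun y => series (a^~ y) n + a n y)).
    by apply: continuousD; [exact: IH|exact: ca].
  by apply/funext => y; rewrite seriesSr.
apply/cvgrPdist_le => e e0.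
have e3 : 0 < e / 3 by rewrite divr_gt0.
have [n tn] : exists n, t n <= e / 3.
  have /cvgrPdist_le/(_ _ e3)[n _ /(_ n (leqnn n))] := tcvg.
  by rewrite sub0r normrN => h; exists n; exact: le_trans (ler_norm _) h.
have /cvgrPdist_le/(_ _ e3) cn := cs n.
near=> y.
have Dy : D y by near: y.
have h1 := le_trans (series_fun_tail n Dx) tn.
have h2 := le_trans (series_fun_tail n Dy) tn.
have h3 : `|series (a^~ x) n - series (a^~ y) n| <= e / 3 by near: y.
rewrite (_ : series_fun x - series_fun y = (series_fun x - series (a^~ x) n) +
  ((series (a^~ x) n - series (a^~ y) n) - (series_fun y - series (a^~ y) n)));
  last by ring.
rewrite (le_trans (ler_normD _ _))//.
rewrite (le_trans (lerD h1 (ler_normB _ _)))//.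
by move: h2 h3; lra.
Unshelve. all: by end_near. Qed.

End telescoping_series.

Section fractional_part.
Context {R : realType}.
Notation mu := (@lebesgue_measure R).
Implicit Types x y : R.

Lemma frac_ge0 x : 0 <= frac x.
Proof. by rewrite /frac subr_ge0 Num.Theory.floor_le. Qed.

Lemma frac_lt1 x : frac x < 1.
Proof. by rewrite /frac ltrBlDr addrC -intrD1 Num.Theory.floorD1_gt. Qed.

Lemma frac_itv x : 0 <= frac x < 1.
Proof. by rewrite frac_ge0 frac_lt1. Qed.

Lemma frac_intD (m : int) x : frac (m%:~R + x) = frac x.
Proof.
rewrite /frac Num.Theory.floorDzr ?intr_int// Num.Theory.intrKfloor intrD.
by ring.
Qed.

Lemma frac_id x : 0 <= x < 1 -> frac x = x.
Proof.
by move=> x01; rewrite /frac (@Num.Theory.floor_def _ x 0) ?subr0// add0r.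
Qed.

Lemma fracD1 x : frac (x + 1) = frac x.
Proof. by rewrite addrC (frac_intD 1). Qed.

Lemma fracD x n : frac (x + n%:R) = frac x.
Proof. by rewrite addrC (frac_intD n). Qed.

Lemma frac_nat n : frac (n%:R : R) = 0.
Proof. by rewrite -[n%:R]add0r fracD frac_id// lexx ltr01. Qed.

Lemma frac_bounded x : `|frac x| <= 1.
Proof. by rewrite ger0_norm ?frac_ge0// ltW// frac_lt1. Qed.

Lemma measurable_frac : measurable_fun setT (@frac R).
Proof.
apply: measurable_funB => //.
apply: nondecreasing_measurable => // x y xy.
by rewrite ler_int; exact: Num.Theory.le_floor.
Qed.

Lemma frac_continuous x : frac x != 0 -> {for x, continuous (@frac R)}.
Proof.
move=> fx0; have f0 : 0 < frac x by rewrite lt_neqAle eq_sym fx0 frac_ge0.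
have f1 := frac_lt1 x.
pose m := Num.floor x.
have nm : \forall y \near x, y - m%:~R = frac y.
  near=> y.
  suff : 0 <= y - m%:~R < 1.
    by move=> /frac_id <-; rewrite -[X in frac X](addrC (- _)) -[RHS](frac_intD (- m)) intrN.
  have : `|x - y| < Num.min (frac x) (1 - frac x).
    by near: y; apply: cvgr_dist_lt => //; rewrite lt_min f0 subr_gt0.
  rewrite lt_min !ltr_norml => /andP[/andP[h1 h2] /andP[h3 h4]].
  by move: h1 h2 h3 h4; rewrite /frac -/m; lra.
apply: cvg_trans (near_eq_cvg nm) _; rewrite /frac.
by apply: cvgB; [exact: cvg_id|exact: cvg_cst].
Unshelve. all: by end_near. Qed.

(** A primitive of [frac x - 1 / 2] on the line which is periodic: half of
the second Bernoulli polynomial of the fractional part, normalized to vanish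
at integers. *)
Definition bern (x : R) : R := (frac x ^+ 2 - frac x) / 2.

Lemma bernD1 x : bern (x + 1) = bern x. Proof. by rewrite /bern fracD1. Qed.

Lemma bernD x n : bern (x + n%:R) = bern x. Proof. by rewrite /bern fracD. Qed.

Lemma bern_nat n : bern n%:R = 0.
Proof. by rewrite /bern frac_nat expr0n subrr mul0r. Qed.

Lemma bern_le1 x : `|bern x| <= 1.
Proof.
have /andP[f0 f1] := frac_itv x; rewrite /bern ler_norml.
by apply/andP; split; nra.
Qed.

(** The slopes are at most 1/2 in absolute value. Past distance 1 the bound
on the oscillation is enough; below it, the two points lie in the same unit
cell or in consecutive ones. *)
Lemma bern_lipschitz x y : `|bern x - bern y| <= `|x - y|.
Proof.
wlog xy : x y / x <= y.
  move=> h; have [/h//|/ltW/h] := leP x y.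
  by rewrite distrC [leRHS]distrC.
have [xy1|xy1] := leP (y - x) 1; last first.
  rewrite (@le_trans _ _ 1)//; last by rewrite ler0_norm; lra.
  have /andP[f0 f1] := frac_itv x; have /andP[g0 g1] := frac_itv y.
  by rewrite /bern ler_norml; apply/andP; split; nra.
rewrite [leRHS]distrC [leRHS]ger0_norm ?subr_ge0//.
have /andP[f0 f1] := frac_itv x.
pose m := Num.floor x; have xE : x = m%:~R + frac x by rewrite /frac addrC subrK.
have [ym|ym] := ltP (y - m%:~R) 1.
  have yE : frac y = y - m%:~R.
    rewrite -[LHS](frac_intD (- m)) intrN addrC frac_id//.
    by rewrite ym andbT; move: xE; lra.
  rewrite /bern ler_norml; have /andP[g0 g1] := frac_itv y.
  have -> : y - x = frac y - frac x by move: xE yE; lra.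
  have sr : 0 <= frac y - frac x by move: xE yE; lra.
  have h1 : 0 <= (frac y - frac x) * (1 - frac y) by apply: mulr_ge0; lra.
  have h2 : 0 <= (frac y - frac x) * frac x by apply: mulr_ge0.
  by apply/andP; split; nra.
have yE : frac y = y - m%:~R - 1.
  rewrite -[LHS](frac_intD (- (m + 1))) intrN intrD addrC opprD addrA frac_id//.
  by move: xE; lra.
have /andP[g0 g1] := frac_itv y.
rewrite /bern ler_norml.
have -> : y - x = 1 + frac y - frac x by move: xE yE; lra.
have h1 : 0 <= frac x * (1 - frac x) by apply: mulr_ge0; lra.
have h2 : 0 <= frac y * (1 - frac y) by apply: mulr_ge0; lra.
by apply/andP; split; nra.
Qed.

Lemma bern_continuous : continuous bern.
Proof.
move=> x; apply/cvgrPdist_le => e e0; near=> y.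
rewrite (le_trans (bern_lipschitz _ _))//.
Unshelve. all: by end_near. Qed.

Lemma bounded_integrable (f : R -> R) (a b M : R) : measurable_fun `[a, b] f ->
  (forall x, a <= x <= b -> `|f x| <= M) -> mu.-integrable `[a, b] (EFin \o f).
Proof.
move=> mf fM; have ci : mu.-integrable `[a, b] (EFin \o cst (1 : R)).
  by apply: continuous_integrable; apply: continuous_withinW => x _; exact: cst_continuous.
have := integrable_boundedM (M := M) (measurable_itv _) ci mf.
have h x : `[a, b]%classic x -> `|f x| <= M by rewrite /= in_itv/=; exact: fM.
by move=> /(_ h); apply: eq_integrable => // x _ /=; rewrite mulr1.
Qed.

Lemma frac_half_integrable a b : mu.-integrable `[a, b] (EFin \o (fun x => frac x - 1 / 2)).
Proof.
apply: (@bounded_integrable _ _ _ 1).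
  by apply: measurable_funTS; apply: measurable_funB => //; exact: measurable_frac.
move=> x _; have /andP[f0 f1] := frac_itv x.
by rewrite ler_norml; apply/andP; split; lra.
Qed.

Let int01 x : 0 <= x <= 1 -> \int[mu]_(t in `[0, x]) (frac t - 1 / 2) = bern x.
Proof.
move=> /andP[x0 x1].
rewrite -Rintegral_itv_bndo_bndc; last first.
  by apply: integrableS (frac_half_integrable 0 x) => //; exact: subset_itv_co_cc.
transitivity (\int[mu]_(t in `[0, x[) (t - 1 / 2)).
  apply: eq_Rintegral => t; rewrite inE/= in_itv/= => /andP[t0 tx].
  by rewrite frac_id// t0 (lt_le_trans tx).
have ct : continuous (fun t : R => t - 1 / 2).
  by move=> t; apply: cvgB; [exact: cvg_id|exact: cvg_cst].
rewrite Rintegral_itv_bndo_bndc; last first.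
  apply: (@integrableS _ _ _ mu `[0, x]) => //; first exact: subset_itv_co_cc.
  by apply: continuous_integrable; apply: continuous_withinW => t _; exact: ct.
have -> : bern x = (x ^+ 2 - x) / 2.
  move: x1; rewrite le_eqVlt => /predU1P[->|x1]; last by rewrite /bern frac_id// x0.
  by rewrite /bern (frac_nat 1) expr0n/= expr1n !subrr.
rewrite (_ : (x ^+ 2 - x) / 2 = (x ^+ 2 - x) / 2 - (0 ^+ 2 - 0) / 2); last first.
  by rewrite expr0n/= subrr mul0r subr0.
apply: (@Rint_FTC _ (fun t => (t ^+ 2 - t) / 2)) => // t _.
- apply: der_eq (derM (derB (derX 2 (der_id t)) (der_id t)) (der_cst _ _)) _.
  by rewrite /= expr1; field.
- exact: ct.
Qed.

Lemma Rint_frac_half x : 0 <= x -> \int[mu]_(t in `[0, x]) (frac t - 1 / 2) = bern x.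
Proof.
have [n] : exists n : nat, x <= n.+1%:R.
  exists (Num.trunc x); have [x0|x0] := leP 0 x; first exact/ltW/truncnS_gt.
  by rewrite (le_trans (ltW x0)).
elim: n x => [|n IH] x xn x0; first by apply: int01; rewrite x0.
have [x1|x1] := leP x 1; first by apply: int01; rewrite x0.
rewrite (@Rint_split _ _ 0 1 x) ?ltW//; last exact: frac_half_integrable.
rewrite int01 ?lexx ?ler01// (bern_nat 1) add0r.
have mf A : measurable_fun A (fun t : R => frac t - 1 / 2).
  by apply: measurable_funTS; apply: measurable_funB => //; exact: measurable_frac.
transitivity (\int[mu]_(t in `[0 + 1, (x - 1) + 1]) (frac t - 1 / 2)).
  by rewrite add0r subrK.
rewrite -(@Rint_shift _ 1 0 (x - 1) (fun t => frac t - 1 / 2))//.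
under eq_Rintegral do rewrite fracD1.
have h1 : x - 1 <= n.+1%:R by rewrite lerBlDr natr1.
have h0 : 0 <= x - 1 by rewrite subr_ge0 ltW.
by rewrite IH// -[in RHS](subrK 1 x) bernD1.
Qed.

Lemma Rint_frac_half_itv a b : 0 <= a -> a <= b ->
  \int[mu]_(t in `[a, b]) (frac t - 1 / 2) = bern b - bern a.
Proof.
move=> a0 ab; rewrite -Rint_frac_half ?(le_trans a0)// -Rint_frac_half//.
by rewrite (@Rint_split _ _ 0 a b)//; [ring|exact: frac_half_integrable].
Qed.

End fractional_part.

(** * The function Phi *)

Section phi_function.
Context {R : realType}.
Notation mu := (@lebesgue_measure R).
Implicit Types x y u : R.

Definition Phi_term (n : nat) x : R := bern (n.+1%:R * x) / n.+1%:R ^+ 2.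
(** Up to a factor 1/2 and an additive constant, this is the sum of the
second Bernoulli functions of the multiples of [x], weighted by inverse
squares. It carries the whole irregularity of the autocorrelation. *)
Definition Phi x : R := series_fun Phi_term x.
Definition PhiN (n : nat) x : R := series (Phi_term^~ x) n.

(** The bound 1/a^2 <= 2/a - 2/(a+1) puts the series in telescoping form. *)
Lemma Phi_term_le n x : `|Phi_term n x| <= 2 / n.+1%:R - 2 / n.+2%:R.
Proof.
rewrite /Phi_term normrM (@le_trans _ _ (n.+1%:R ^- 2))//.
  rewrite [X in _ * X]ger0_norm ?invr_ge0 ?sqr_ge0//.
  by rewrite ler_piMl ?bern_le1// invr_ge0 sqr_ge0.
have a1 : 1 <= n.+1%:R :> R by rewrite ler1n.
rewrite -(natr1 n.+1); set a := n.+1%:R in a1 *.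
have a0 : 0 < a by rewrite (lt_le_trans ltr01).
have a2 : 0 < a + 1 by rewrite addr_gt0.
rewrite -subr_ge0 (_ : _ - _ = (a - 1) / (a ^+ 2 * (a + 1))); last first.
  by field; rewrite !gt_eqF.
by rewrite divr_ge0 ?subr_ge0// mulr_ge0 ?sqr_ge0// ltW.
Qed.

Let t0 n : 0 <= 2 / n.+1%:R :> R. Proof. by rewrite divr_ge0. Qed.

Let tcvg : (2 / n.+1%:R : R) @[n --> \oo] --> (0 : R).
Proof. by rewrite -[X in _ --> X](mulr0 2); apply: cvgMr; exact: cvg_harmonic. Qed.

Let term_le n x : [set: R] x -> `|Phi_term n x| <= 2 / n.+1%:R - 2 / n.+2%:R.
Proof. by move=> _; exact: Phi_term_le. Qed.

Lemma Phi_tail n x : `|Phi x - PhiN n x| <= 2 / n.+1%:R.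
Proof. exact: (series_fun_tail term_le t0 tcvg). Qed.

Lemma Phi_term_continuous n : continuous (Phi_term n).
Proof.
move=> x; apply: cvgM; last exact: cvg_cst.
apply: (@continuous_comp _ _ _ (fun y => n.+1%:R * y) bern).
  by apply: cvgM; [exact: cvg_cst|exact: cvg_id].
exact: bern_continuous.
Qed.

Lemma PhiN_continuous n : continuous (PhiN n).
Proof.
move=> x; rewrite /PhiN; elim: n => [|n IH].
  rewrite (_ : (fun y => _) = cst 0); first exact: cst_continuous.
  by apply/funext => y; rewrite seriesEnat/= big_geq.
rewrite (_ : (fun y => _) = (fun y => series (Phi_term^~ y) n + Phi_term n y)).
  by apply: cvgD; [exact: IH|exact: Phi_term_continuous].
by apply/funext => y; rewrite seriesSr.
Qed.

Lemma Phi_continuous : continuous Phi.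
Proof.
move=> x; apply: (series_fun_continuous term_le t0 tcvg); first exact: filterT.
by move=> n; exact: Phi_term_continuous.
Qed.

Lemma PhiD1 x : Phi (x + 1) = Phi x.
Proof.
rewrite /Phi /series_fun; congr (limn (series _)); apply/funext => n.
by rewrite /Phi_term mulrDr mulr1 bernD.
Qed.

Lemma Phi0 : Phi 0 = 0.
Proof.
rewrite /Phi /series_fun (_ : (fun n => _) = cst 0); last first.
  by apply/funext => n; rewrite /Phi_term mulr0 (bern_nat 0) mul0r.
rewrite (_ : series _ = cst 0) ?lim_cst//.
by apply/funext => n; rewrite seriesEnat/= big1.
Qed.

Lemma Phi1 : Phi 1 = 0. Proof. by rewrite -[1]add0r PhiD1 Phi0. Qed.

Lemma Phi_le2 x : `|Phi x| <= 2.
Proof.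
have := Phi_tail 0 x; rewrite divr1 /PhiN seriesEnat/= big_geq// subr0.
by [].
Qed.

Lemma PhiN_le4 n x : `|PhiN n x| <= 4.
Proof.
have h := Phi_tail n x; have h2 := Phi_le2 x.
rewrite (_ : PhiN n x = Phi x - (Phi x - PhiN n x)); last by ring.
rewrite (le_trans (ler_normB _ _))// (_ : 4 = 2 + 2) ?lerD//; last by ring.
by rewrite (le_trans h)// ler_pdivrMr// ler_peMr// ler1n.
Qed.

(** The boundedness of [f] gives continuity at 0, where the value is 0. *)
Lemma mul_inv_continuous (f : R -> R) (C : R) : continuous f ->
  (forall x, `|f x| <= C) -> continuous (fun u : R => u * f u^-1).
Proof.
move=> cf fC x; have [->|x0] := eqVneq x 0; last first.
  apply: cvgM; first exact: cvg_id.
  apply: (@continuous_comp _ _ _ (@GRing.inv R) f); first exact: inv_continuous.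
  exact: cf.
have C0 : 0 <= C by rewrite (le_trans _ (fC 0)).
apply/cvgrPdist_le => e e0.
have eC : 0 < e / (C + 1) by rewrite divr_gt0// ltr_wpDl.
near=> y; rewrite mul0r sub0r normrN normrM.
rewrite (@le_trans _ _ (e / (C + 1) * (C + 1)))//; last first.
  by rewrite divfK// gt_eqF// ltr_wpDl.
apply: ler_pM => //; last by rewrite (le_trans (fC _))// lerDl.
Unshelve. all: by end_near. Qed.

Definition M x : R := \int[mu]_(u in `[0, x]) (u * Phi u^-1).

Lemma mulPhi_continuous : continuous (fun u => u * Phi u^-1).
Proof. exact: (mul_inv_continuous Phi_continuous Phi_le2). Qed.

Lemma continuous_integrableT (f : R -> R) a b : continuous f ->
  mu.-integrable `[a, b] (EFin \o f).
Proof.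
by move=> cf; apply: continuous_integrable; apply: continuous_withinW => x _; exact: cf.
Qed.

Lemma der_M x : 0 < x -> is_derive x (1 : R) M (x * Phi x^-1).
Proof.
move=> x0; apply: (@der_Rint _ _ 0 x (x + 1)) => //; first by rewrite ltrDl.
  exact: continuous_integrableT mulPhi_continuous.
exact: mulPhi_continuous.
Qed.

Lemma mulbern_continuous : continuous (fun u : R => u * bern u^-1).
Proof. exact: (mul_inv_continuous bern_continuous bern_le1). Qed.

Lemma frac_inv_integrable a b : mu.-integrable `[a, b] (EFin \o (fun u => frac u^-1)).
Proof.
apply: (@bounded_integrable _ _ _ _ 1) => [|x _]; last exact: frac_bounded.
apply: measurable_funTS; apply: measurableT_comp; first exact: measurable_frac.
exact: measurable_inv.
Qed.

Lemma frac_inv_half_integrable a b :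
  mu.-integrable `[a, b] (EFin \o (fun u => frac u^-1 - 1 / 2)).
Proof.
apply: (@bounded_integrable _ _ _ _ 1).
  apply: measurable_funTS; apply: measurable_funB => //.
  by apply: measurableT_comp; [exact: measurable_frac|exact: measurable_inv].
move=> x _; have /andP[f0 f1] := frac_itv x^-1.
by rewrite ler_norml; apply/andP; split; lra.
Qed.

Lemma der_invX2 x : x != 0 -> is_derive x (1 : R) (fun s : R => s ^- 2) (- 2 * x ^- 3).
Proof.
move=> x0; apply: der_eq (derV _ (derX 2 (der_id x))) _; first by rewrite sqrf_eq0.
by rewrite /= expr1; field.
Qed.

Lemma continuous_invX3 x : x != 0 -> {for x, continuous (fun y : R => - 2 * y ^- 3)}.
Proof.
move=> x0; apply: continuousM; first exact: cst_continuous.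
by apply: continuousV; [rewrite expf_eq0|exact: exprn_continuous].
Qed.

Let by_parts a b : 0 < a -> a <= b ->
  \int[mu]_(s in `[a, b]) (s ^- 2 * (frac s - 1 / 2)) =
  b ^- 2 * bern b - a ^- 2 * bern a
  + 2 * \int[mu]_(s in `[a, b]) (s ^- 3 * bern s).
Proof.
move=> a0 ab.
have pos x : a <= x <= b -> x != 0.
  by move=> /andP[ax _]; rewrite gt_eqF// (lt_le_trans a0).
have -> := @Rint_by_parts _ (fun s => frac s - 1 / 2) (fun s => s ^- 2)
  (fun s => - 2 * s ^- 3) a b ab (frac_half_integrable a b)
  (fun x h => der_invX2 (pos x h)) (fun x h => continuous_invX3 (pos x h)).
have i3 : mu.-integrable `[a, b] (EFin \o (fun s => - 2 * s ^- 3)).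
  by apply: continuous_integrable; apply: continuous_withinW => x /pos; exact: continuous_invX3.
have i3b : mu.-integrable `[a, b] (EFin \o (fun s => s ^- 3 * bern s)).
  apply: continuous_integrable; apply: continuous_withinW => x /pos x0.
  apply: continuousM; last exact: bern_continuous.
  by apply: continuousV; [rewrite expf_eq0|exact: exprn_continuous].
have -> : \int[mu]_(x in `[a, b]) (- 2 * x ^- 3 * \int[mu]_(t in `[a, x]) (frac t - 1 / 2)) =
    \int[mu]_(x in `[a, b]) ((- 2) * (x ^- 3 * bern x) - bern a * (- 2 * x ^- 3)).
  apply: eq_Rintegral => x; rewrite in_segment => /andP[ax xb].
  by rewrite Rint_frac_half_itv// ?ltW//; ring.
have FTC : \int[mu]_(x in `[a, b]) (- 2 * x ^- 3) = b ^- 2 - a ^- 2.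
  apply: (@Rint_FTC _ (fun s => s ^- 2)) => // x /pos; first exact: der_invX2.
  exact: continuous_invX3.
rewrite (@RintegralB _ _ _ mu `[a, b]%classic (fun x => - 2 * (x ^- 3 * bern x))
  (fun x => bern a * (- 2 * x ^- 3)))//; last 2 first.
- exact: integrable_scale.
- exact: integrable_scale.
rewrite (@RintegralZl _ _ _ mu _ (fun x => x ^- 3 * bern x))//.
rewrite (@RintegralZl _ _ _ mu _ (fun x => - 2 * x ^- 3))// FTC.
by rewrite Rint_frac_half_itv ?(ltW a0)//; ring.
Qed.

(** With [s = u^-1] this is an integration by parts, [bern] being a primitive
of [frac s - 1 / 2]. *)
Lemma Rint_frac_inv_eps e y : 0 < e -> e <= y ->
  \int[mu]_(u in `[e, y]) (frac u^-1 - 1 / 2) =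
  e ^+ 2 * bern e^-1 - y ^+ 2 * bern y^-1
  + 2 * \int[mu]_(u in `[e, y]) (u * bern u^-1).
Proof.
move=> e0 ey; have y0 := lt_le_trans e0 ey.
have ei : 0 < e^-1 by rewrite invr_gt0.
have yi : 0 < y^-1 by rewrite invr_gt0.
have pos x : e <= x <= y -> x != 0.
  by move=> /andP[ax _]; rewrite gt_eqF// (lt_le_trans e0).
have minv n : measurable_fun setT (fun s : R => s ^- n).
  by apply: (measurableT_comp (@measurable_inv R)); exact: exprn_measurable.
have E1 : \int[mu]_(u in `[e, y]) (frac u^-1 - 1 / 2) =
    \int[mu]_(s in `[y^-1, e^-1]) (s ^- 2 * (frac s - 1 / 2)).
  rewrite -[RHS]Rint_inv// ?invrK; last first.
    apply: measurable_funTS; apply: measurable_funM => //.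
    by apply: measurable_funB => //; exact: measurable_frac.
  apply: eq_Rintegral => x; rewrite in_segment => /pos x0.
  by rewrite exprVn invrK mulrAC divff ?mul1r// sqrf_eq0.
have E2 : \int[mu]_(u in `[e, y]) (u * bern u^-1) =
    \int[mu]_(s in `[y^-1, e^-1]) (s ^- 3 * bern s).
  rewrite -[RHS]Rint_inv// ?invrK; last first.
    apply: measurable_funTS; apply: measurable_funM => //.
    by apply: continuous_measurable_fun; exact: bern_continuous.
  apply: eq_Rintegral => x; rewrite in_segment => /pos x0.
  by rewrite exprVn invrK; field.
rewrite E1 E2 by_parts//; last by rewrite lef_pV2.
by rewrite !exprVn !invrK.
Qed.

(** Letting [e] tend to 0 in [Rint_frac_inv_eps]: every term carried by [0,
e] is O(e). *)
Lemma Rint_frac_inv y : 0 < y ->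
  \int[mu]_(u in `[0, y]) frac u^-1 =
  y / 2 - y ^+ 2 * bern y^-1 + 2 * \int[mu]_(u in `[0, y]) (u * bern u^-1).
Proof.
move=> y0.
have half : \int[mu]_(u in `[0, y]) (1 / 2 : R) = y / 2.
  rewrite Rintegral_cst//= lebesgue_measure_itv/= lte_fin y0 /= subr0.
  by rewrite mul1r mulrC.
suff H : \int[mu]_(u in `[0, y]) (frac u^-1 - 1 / 2) =
    - (y ^+ 2 * bern y^-1) + 2 * \int[mu]_(u in `[0, y]) (u * bern u^-1).
  rewrite -addrA -H (@RintegralB _ _ _ mu `[0, y]%classic (fun u => frac u^-1) (fun=> 1 / 2))//.
  - by rewrite half; ring.
  - exact: frac_inv_integrable.
  - exact/continuous_integrableT/cst_continuous.
apply/eqP; rewrite -subr_eq0 -normr_le0; apply/ler_addgt0Pr => d d0; rewrite add0r.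
(* The terms on [0, e] are bounded by [e], by [2 * e ^+ 2] and by [e ^+ 2], and
   [e ^+ 2 <= e]. *)
pose e := Num.min y (Num.min 1 (d / 4)).
have e0 : 0 < e by rewrite !lt_min y0 ltr01 divr_gt0.
have ey : e <= y by rewrite ge_min lexx.
have e1 : e <= 1 by rewrite !ge_min lexx orbT.
have ed : 4 * e <= d by rewrite mulrC -ler_pdivlMr// !ge_min lexx !orbT.
have i1 := frac_inv_half_integrable 0 y.
have i2 : mu.-integrable `[0, y] (EFin \o (fun u => u * bern u^-1)).
  exact: continuous_integrableT mulbern_continuous.
rewrite (Rint_split (ltW e0) ey i1) (Rint_split (ltW e0) ey i2) (Rint_frac_inv_eps e0 ey).
have h1 : `|\int[mu]_(u in `[0, e]) (frac u^-1 - 1 / 2)| <= 1 * (e - 0).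
  apply: normr_Rint_le; [exact: ltW|exact: integrable_itvS i1|].
  move=> x _; have /andP[f0 f1] := frac_itv x^-1.
  by rewrite ler_norml; apply/andP; split; lra.
have h2 : `|\int[mu]_(u in `[0, e]) (u * bern u^-1)| <= e * (e - 0).
  apply: normr_Rint_le; [exact: ltW|exact: integrable_itvS i2|].
  move=> x /andP[x0 xe]; rewrite normrM ger0_norm// -[leRHS]mulr1.
  by apply: ler_pM => //; exact: bern_le1.
have h3 : `|e ^+ 2 * bern e^-1| <= e ^+ 2.
  by rewrite normrM ger0_norm ?sqr_ge0// ler_piMr ?sqr_ge0// bern_le1.
have e2 : e ^+ 2 <= e by rewrite expr2 ler_piMl// ltW.
move: h1 h2 h3; rewrite !ler_norml => /andP[? ?] /andP[? ?] /andP[? ?].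
have e2' : e * (e - 0) <= e by rewrite subr0 -expr2.
by apply/andP; split; lra.
Qed.

End phi_function.

(** * The autocorrelation integral after inversion *)

Section inverted_integral.
Context {R : realType}.
Notation mu := (@lebesgue_measure R).
Implicit Types l m u x y : R.

Let mfrac_lin l : measurable_fun setT (fun t : R => frac (l * t)).
Proof.
by apply: (measurableT_comp (@measurable_frac R)); exact: measurable_funM.
Qed.

Let minvX n : measurable_fun setT (fun s : R => s ^- n).
Proof. by apply: (measurableT_comp (@measurable_inv R)); exact: exprn_measurable. Qed.

Let mintegrand l : measurable_fun setT (fun t : R => frac t * frac (l * t) / t ^+ 2).
Proof.
apply: measurable_funM => //; apply: measurable_funM; last exact: mfrac_lin.
exact: measurable_frac.
Qed.

(** The substitution [t -> l * t] exchanges the two fractional parts. *)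
Lemma autocorrelation_inv l : 0 < l -> autocorrelation l = l * autocorrelation l^-1.
Proof.
move=> l0; have l1 : l != 0 by rewrite gt_eqF.
have lfin : (l^-1)%:E \is a fin_num by [].
rewrite /autocorrelation /Rintegral.
rewrite -(@integral_affine_real R l 0 `]0, +oo[%classic
  (fun t => frac t * frac (l^-1 * t) / t ^+ 2))//; last exact: measurable_funTS (mintegrand _).
transitivity (l * fine (\int[mu]_(t in `]0%R, +oo[)
    ((l^-1)%:E * (frac t * frac (l * t) / t ^+ 2)%:E))%E); last first.
  congr (l * fine _); transitivity (\int[mu]_(t in (fun x => l * x + 0)%R @^-1` `]0%R, +oo[)
    ((l^-1)%:E * (frac t * frac (l * t) / t ^+ 2)%:E))%E.
    congr (integral _ _ _); apply/seteqP; split => x /=;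
    by rewrite !in_itv/= !andbT addr0 pmulr_rgt0.
  apply: eq_integral => x; rewrite inE/= in_itv/= andbT addr0 pmulr_rgt0// => x0.
  rewrite -EFinM mulKf//; congr (_%:E).
  by field; rewrite l1 gt_eqF.
rewrite ge0_integralZl//.
- have [fin|] := boolP ((\int[mu]_(t in `]0%R, +oo[) (frac t * frac (l * t) / t ^+ 2)%:E)%E \is a fin_num).
    by rewrite fineM//= mulrA divff// mul1r.
  rewrite ge0_fin_numE -?leNgt ?leye_eq; last first.
    by apply: integral_ge0 => x _; rewrite lee_fin divr_ge0 ?sqr_ge0// mulr_ge0// frac_ge0.
  by move=> /eqP ->; rewrite gt0_muley ?lte_fin ?invr_gt0//= mulr0.
- by apply/measurable_EFinP; apply: measurable_funTS (mintegrand _).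
- by move=> x _; rewrite lee_fin divr_ge0 ?sqr_ge0// mulr_ge0// frac_ge0.
- by rewrite lee_fin invr_ge0 ltW.
Qed.

(** The integrand of the autocorrelation in the variable [u = t^-1], for
which the singularity at [t = 0] moves to infinity and the measure becomes
[du]. *)
Definition inv_integrand l u : R := frac u^-1 * frac (l * u^-1).

Lemma inv_integrand_ge0 l u : 0 <= inv_integrand l u. Proof. by rewrite mulr_ge0// frac_ge0. Qed.

Lemma inv_integrand_le1 l u : inv_integrand l u <= 1.
Proof. by rewrite -[1]mulr1 ler_pM ?frac_ge0// ltW// frac_lt1. Qed.

Lemma measurable_inv_integrand l : measurable_fun setT (inv_integrand l).
Proof.
apply: measurable_funM; first exact: measurableT_comp (@measurable_frac R) (@measurable_inv R).
exact: measurableT_comp (mfrac_lin l) (@measurable_inv R).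
Qed.

Lemma inv_integrand_integrable l a b : mu.-integrable `[a, b] (EFin \o inv_integrand l).
Proof.
apply: (@bounded_integrable _ _ _ _ 1) => [|x _].
  exact: measurable_funTS (measurable_inv_integrand l).
by rewrite ger0_norm ?inv_integrand_ge0// inv_integrand_le1.
Qed.

Lemma autocorrelation_inv_integrand l :
  autocorrelation l = fine (\int[mu]_(u in `]0%R, +oo[) (inv_integrand l u)%:E)%E.
Proof.
rewrite /autocorrelation /Rintegral; congr fine.
rewrite -(@integral_inv_real R `]0, +oo[%classic (inv_integrand l))//; last 2 first.
- by move=> x /=; rewrite in_itv/= andbT.
- exact: measurable_funTS (measurable_inv_integrand l).
transitivity (\int[mu]_(t in `]0%R, +oo[) (inv_integrand l t^-1 * t ^- 2)%:E)%E.
  by apply: eq_integral => x _; rewrite /inv_integrand invrK.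
congr (integral _ _ _); apply/seteqP; split => x /=; rewrite !in_itv/= !andbT.
  by move=> x0; rewrite invr_gt0.
by case.
Qed.

(** For [u > U] both [u^-1] and [l / u] are their own fractional parts, so
that the tail is the integral of [l / u ^ 2]. *)
Lemma autocorrelation_tail l U : 0 < l -> l <= U -> 1 <= U ->
  autocorrelation l = \int[mu]_(u in `[0, U]) inv_integrand l u + l / U.
Proof.
move=> l0 lU U1; have U0 : 0 < U := lt_le_trans l0 lU.
rewrite autocorrelation_inv_integrand.
have -> : `]0, +oo[%classic = `]0, U]%classic `|` `]U, +oo[%classic :> set R.
  by rewrite -itv_bndbnd_setU ?bnd_simp// ltW.
have mq A : measurable_fun A (EFin \o inv_integrand l).
  by apply/measurable_EFinP; exact: measurable_funTS (measurable_inv_integrand l).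
rewrite ge0_integral_setU//=; last 3 first.
- exact: mq.
- by move=> x _; rewrite lee_fin inv_integrand_ge0.
- apply/disj_setPS => x [/=]; rewrite !in_itv/= andbT => /andP[_ xU].
  by rewrite ltNge xU.
have -> : (\int[mu]_(x in `]U, +oo[) (inv_integrand l x)%:E = (l / U)%:E)%E.
  transitivity (\int[mu]_(x in `]U, +oo[) (l%:E * (x ^- 2)%:E))%E.
    apply: eq_integral => x; rewrite inE/= in_itv/= andbT => Ux.
    have x0 := lt_trans U0 Ux.
    rewrite /inv_integrand !frac_id; first by rewrite -EFinM; congr (_%:E); field; rewrite gt_eqF.
      by rewrite divr_ge0 ?(ltW l0) ?(ltW x0)// ltr_pdivrMr// mul1r (le_lt_trans lU).
    by rewrite invr_ge0 (ltW x0) invf_lt1// (le_lt_trans U1).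
  have m2 A : measurable_fun A (fun x : R => (x ^- 2)%:E).
    by apply/measurable_EFinP; exact: measurable_funTS (minvX 2).
  rewrite ge0_integralZl//; last 3 first.
  - exact: m2.
  - by move=> x _; rewrite lee_fin invr_ge0 sqr_ge0.
  - by rewrite lee_fin ltW.
  rewrite integral_itv_obnd_cbnd; last exact: m2.
  have Ui : 0 < U^-1 by rewrite invr_gt0.
  by have := integral_inv_sqr_tail Ui; rewrite invrK => ->.
have qi : mu.-integrable `]0, U] (EFin \o inv_integrand l).
  by apply: integrableS (inv_integrand_integrable l 0 U) => //; exact: subset_itv_oc_cc.
rewrite fineD//; last exact: integrable_fin_num.
by rewrite /= -[fine _]/(Rintegral mu _ (inv_integrand l)) Rintegral_itv_obnd_cbnd.
Qed.

Lemma floor_sum y N : 0 <= y -> y <= N%:R ->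
  (Num.floor y)%:~R = \sum_(i < N) (i.+1%:R <= y)%R%:R :> R.
Proof.
move=> y0 yN.
have H n : \sum_(i < n) (i.+1%:R <= y)%R%:R = (minn n (Num.truncn y))%:R :> R.
  elim: n => [|n IH]; first by rewrite big_ord0 min0n.
  rewrite big_ord_recr/= IH -natrD -truncn_ge_nat//; congr (_%:R).
  by case: (leqP n.+1 (Num.truncn y)) => h; lia.
have f0 : 0 <= Num.floor y by rewrite -Num.Theory.floor_ge0 in y0 *.
rewrite H (minn_idPr _).
  by rewrite Num.Theory.truncn_floor y0; case: (Num.floor y) f0.
rewrite -(@ler_nat R) (le_trans _ yN)//; by rewrite Num.Theory.truncn_le.
Qed.

Lemma integrable_bigsum (D : set R) (F : nat -> R -> R) n : measurable D ->
  (forall i, mu.-integrable D (EFin \o F i)) ->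
  mu.-integrable D (EFin \o (fun x => \sum_(i < n) F i x)).
Proof.
move=> mD Fi; elim: n => [|n IH].
  rewrite (_ : EFin \o _ = cst 0%E); first exact: integrable0.
  by apply/funext => x /=; rewrite big_ord0.
rewrite (_ : EFin \o _ = EFin \o (fun x => \sum_(i < n) F i x + F n x)).
  exact: integrable_add.
by apply/funext => x /=; rewrite big_ord_recr.
Qed.

Lemma Rint_sum (D : set R) (F : nat -> R -> R) N : measurable D ->
  (forall i, mu.-integrable D (EFin \o F i)) ->
  \int[mu]_(x in D) (\sum_(i < N) F i x) = \sum_(i < N) \int[mu]_(x in D) F i x.
Proof.
move=> mD Fi; have si n := integrable_bigsum n mD Fi.
elim: N => [|n IH].
  by rewrite big_ord0; under eq_Rintegral do rewrite big_ord0; rewrite Rintegral_cst// mul0r.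
rewrite big_ord_recr/= -IH -RintegralD//.
by apply: eq_Rintegral => x _; rewrite big_ord_recr.
Qed.

Let finv_int a b := @frac_inv_integrable R a b.

(** Only finitely many integers are below [l / u] when [u >= l / N], so that
the second fractional part is [l / u] minus a finite sum of indicators of
intervals. *)
Lemma Rint_inv_integrand l N U : 0 < l -> (0 < N)%N -> l <= U ->
  \int[mu]_(u in `[l / N%:R, U]) inv_integrand l u =
  l * \int[mu]_(u in `[l / N%:R, U]) (u^-1 * frac u^-1)
  - \sum_(i < N) \int[mu]_(u in `[l / N%:R, l / i.+1%:R]) frac u^-1.
Proof.
move=> l0 N0 lU; have N0' : 0 < N%:R :> R by rewrite ltr0n.
set e := l / N%:R; have e0 : 0 < e by rewrite divr_gt0.
pose F (i : nat) (u : R) : R := (u <= l / i.+1%:R)%R%:R * frac u^-1.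
have Fi i : mu.-integrable `[e, U] (EFin \o F i).
  apply: (integrable_boundedM (M := 1) (w := fun u => (u <= l / i.+1%:R)%R%:R)) => //.
    rewrite (_ : (fun u => _) = (fun u => if u <= l / i.+1%:R then 1 else 0)).
      by apply: measurable_funTS; apply: measurable_fun_ifT => //; apply: measurable_fun_ler.
    by apply/funext => u; case: ifP.
  by move=> x _; case: (x <= l / i.+1%:R); rewrite ?normr1 ?normr0.
have i1 : mu.-integrable `[e, U] (EFin \o (fun u => u^-1 * frac u^-1)).
  apply: integrable_continuousM => //; apply: continuous_withinW => x /andP[ex _].
  by apply: inv_continuous; rewrite gt_eqF// (lt_le_trans e0).
transitivity (\int[mu]_(u in `[e, U]) (l * (u^-1 * frac u^-1) - \sum_(i < N) F i u)).
  apply: eq_Rintegral => u; rewrite in_segment => /andP[eu uU].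
  have u0 := lt_le_trans e0 eu.
  have lu0 : 0 <= l * u^-1 by rewrite mulr_ge0 ?invr_ge0// ltW.
  have luN : l * u^-1 <= N%:R.
    by rewrite ler_pdivrMr// mulrC -ler_pdivrMr.
  rewrite /inv_integrand {2}/frac (floor_sum lu0 luN) mulrBr mulr_sumr; congr (_ - _).
    by ring.
  apply: eq_bigr => i _; rewrite /F mulrC; congr (_%:R * _).
  by congr nat_of_bool; rewrite ler_pdivlMr// mulrC -ler_pdivlMr.
rewrite (@RintegralB _ _ _ mu `[e, U]%classic (fun u => l * (u^-1 * frac u^-1))
  (fun u => \sum_(i < N) F i u))//; last 2 first.
- exact: integrable_scale.
- exact: integrable_bigsum.
rewrite (@RintegralZl _ _ _ mu _ (fun u => u^-1 * frac u^-1))// Rint_sum//.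
congr (_ - _); apply: eq_bigr => i _.
have -> : `[e, l / i.+1%:R]%classic = `[e, U]%classic `&` `]-oo, l / i.+1%:R]%classic :> set R.
  apply/seteqP; split => x /=; rewrite !in_itv/=.
    move=> /andP[-> h]; split => //; apply: le_trans h (le_trans _ lU).
    by rewrite ler_pdivrMr// ler_peMr ?ler1n// ltW.
  by move=> [/andP[-> _] ->].
rewrite Rintegral_mkcondr; apply: eq_Rintegral => x _.
rewrite /F patchE; case: ifPn; first by rewrite inE/= in_itv/= => ->; rewrite mul1r.
by rewrite notin_setE/= in_itv/= => /negP/negPf ->; rewrite mul0r.
Qed.

End inverted_integral.

(** * Asymptotic expansion of the truncated integral *)

Section expansion.
Context {R : realType}.
Notation mu := (@lebesgue_measure R).
Implicit Types l m u x y a b : R.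

(** The deviation of the primitive of [frac u^-1] from its main term [y / 2]. *)
Definition frac_inv_err y : R :=
  - (y ^+ 2 * bern y^-1) + 2 * \int[mu]_(u in `[0, y]) (u * bern u^-1).

Lemma frac_inv_err_le y : 0 < y -> `|frac_inv_err y| <= 3 * y ^+ 2.
Proof.
move=> y0; rewrite /frac_inv_err.
have h2 : `|\int[mu]_(u in `[0, y]) (u * bern u^-1)| <= y * (y - 0).
  apply: normr_Rint_le; first exact: ltW.
    exact: continuous_integrableT mulbern_continuous.
  move=> x /andP[x0 xe]; rewrite normrM ger0_norm// -[leRHS]mulr1.
  by apply: ler_pM => //; exact: bern_le1.
have h3 : `|y ^+ 2 * bern y^-1| <= y ^+ 2.
  by rewrite normrM ger0_norm ?sqr_ge0// ler_piMr ?sqr_ge0// bern_le1.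
rewrite subr0 -expr2 in h2.
move: h2 h3; rewrite !ler_norml => /andP[? ?] /andP[? ?].
by apply/andP; split; lra.
Qed.

Definition MN N l : R := \int[mu]_(v in `[0, l]) (v * PhiN N v^-1).

(** The scaling [u = v / n] turns the primitive of [u * bern u^-1] at [l / n]
into the contribution of the [n]-th term of [Phi] to [M]. *)
Lemma Rint_scale_bern l i : 0 < l ->
  \int[mu]_(u in `[0, l / i.+1%:R]) (u * bern u^-1) =
  \int[mu]_(v in `[0, l]) (v * Phi_term i v^-1).
Proof.
move=> l0; have i0 : 0 < i.+1%:R^-1 :> R by rewrite invr_gt0.
have := @Rint_scale R _ 0 l (fun u => u * bern u^-1) i0.
rewrite mulr0 mulrC => <-; last first.
  by apply: measurable_funTS; apply: continuous_measurable_fun; exact: mulbern_continuous.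
apply: eq_Rintegral => v _; rewrite /Phi_term invfM invrK.
by field.
Qed.

Lemma mulPhi_term_continuous i : continuous (fun v : R => v * Phi_term i v^-1).
Proof.
apply: (mul_inv_continuous (C := 2)); first exact: Phi_term_continuous.
move=> x; rewrite (le_trans (Phi_term_le i x))//.
have h1 : 2 / i.+1%:R <= 2 :> R by rewrite ler_pdivrMr// ler_peMr// ler1n.
by rewrite lerBlDr (le_trans h1)// lerDl divr_ge0.
Qed.

Lemma MN_sum N l : 0 < l ->
  MN N l = \sum_(i < N) \int[mu]_(u in `[0, l / i.+1%:R]) (u * bern u^-1).
Proof.
move=> l0; under eq_bigr do rewrite Rint_scale_bern//.
rewrite -(@Rint_sum _ _ (fun i v => v * Phi_term i v^-1))//; last first.
  by move=> i; exact: continuous_integrableT (@mulPhi_term_continuous i).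
apply: eq_Rintegral => v _; rewrite /PhiN seriesEnat/= big_mkord mulr_sumr.
by [].
Qed.

Lemma MN_le N l : 0 < l -> `|MN N l - M l| <= 2 / N.+1%:R * l ^+ 2.
Proof.
move=> l0; rewrite /MN /M.
have iN : mu.-integrable `[0, l] (EFin \o (fun v => v * PhiN N v^-1)).
  apply: continuous_integrableT; apply: (mul_inv_continuous (C := 4)).
    exact: PhiN_continuous.
  exact: PhiN_le4.
have iP : mu.-integrable `[0, l] (EFin \o (fun v => v * Phi v^-1)).
  exact: continuous_integrableT mulPhi_continuous.
rewrite -(@RintegralB _ _ _ mu _ (fun v => v * PhiN N v^-1) (fun v => v * Phi v^-1))//.
rewrite (_ : 2 / N.+1%:R * l ^+ 2 = (2 / N.+1%:R * l) * (l - 0)); last by ring.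
apply: normr_Rint_le; [exact: ltW|exact: integrable_sub|].
move=> x /andP[x0 xl]; rewrite -mulrBr normrM (ger0_norm x0) mulrC.
by apply: ler_pM => //; rewrite distrC; exact: Phi_tail.
Qed.

(** [JN] and the harmonic sum diverge as [N] grows. The upper bound [U] and
the index [N] are kept common to two values of [l], so that the divergent
parts cancel in the difference of the two expansions. *)
Definition JN N l U : R := \int[mu]_(u in `[l / N%:R, U]) (u^-1 * frac u^-1).
Definition harm N : R := \sum_(i < N) i.+1%:R^-1.

Let g y : R := \int[mu]_(u in `[0, y]) frac u^-1.

Let gE y : 0 < y -> g y = y / 2 + frac_inv_err y.
Proof. by move=> y0; rewrite /g Rint_frac_inv// /frac_inv_err addrA. Qed.

(** [Rint_frac_inv] evaluates the integrals of [frac u^-1] in [Rint_inv_integrand]; the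
sums over [i < N] of its boundary and integral terms are the partial sums of
[Phi] and [M]. The last term comes from the common lower bound [l / N], which
occurs [N] times, and is O(1/N). *)
Lemma Rint_inv_integrand_expand l N U : 0 < l -> (0 < N)%N -> l <= U ->
  (\int[mu]_(u in `[l / N%:R, U]) inv_integrand l u) / l =
  JN N l U - harm N / 2 + 1 / 2 + l * PhiN N l^-1 - 2 / l * MN N l
  + N%:R / l * frac_inv_err (l / N%:R).
Proof.
move=> l0 N0 lU; have N0' : 0 < N%:R :> R by rewrite ltr0n.
have l1 : l != 0 by rewrite gt_eqF.
have e0 : 0 < l / N%:R by rewrite divr_gt0.
rewrite Rint_inv_integrand// MN_sum//.
have step (i : 'I_N) : \int[mu]_(u in `[l / N%:R, l / i.+1%:R]) frac u^-1 =
    l / 2 * i.+1%:R^-1 - l ^+ 2 * Phi_term i l^-1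
    + 2 * \int[mu]_(u in `[0, l / i.+1%:R]) (u * bern u^-1) - g (l / N%:R).
  have il : l / N%:R <= l / i.+1%:R.
    by rewrite ler_pM2l// lef_pV2 ?posrE// ler_nat.
  have i0 : 0 < l / i.+1%:R by rewrite divr_gt0.
  have -> : \int[mu]_(u in `[l / N%:R, l / i.+1%:R]) frac u^-1 =
      g (l / i.+1%:R) - g (l / N%:R).
    rewrite /g (@Rint_split _ _ 0 (l / N%:R) (l / i.+1%:R)) ?(ltW e0)//.
      by rewrite addrC addKr.
    exact: frac_inv_integrable.
  rewrite gE// /frac_inv_err invfM invrK /Phi_term [l^-1 * _]mulrC; field.
  by rewrite gt_eqF.
under eq_bigr do rewrite step.
rewrite /PhiN seriesEnat/= big_mkord /JN /harm.
rewrite 2!big_split/= sumrB -!mulr_sumr sumr_const card_ord gE//.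
rewrite -[(- _) *+ N]mulr_natl.
set X := Rintegral _ _ _; set H := \sum_(i < N) _; set Y := \sum_(i < N) _.
set Z := \sum_(i < N) _; set W := frac_inv_err _.
by field; rewrite l1 gt_eqF.
Qed.

Lemma Rint_remainder_le a b x : 0 < a -> a <= x -> x <= b ->
  `|\int[mu]_(u in `[a, x]) (frac u^-1 - 1 / 2)| <= 4 * b ^+ 2.
Proof.
move=> a0 ax xb; have x0 := lt_le_trans a0 ax; rewrite Rint_frac_inv_eps//.
have h2 : `|\int[mu]_(u in `[a, x]) (u * bern u^-1)| <= x * (x - a).
  apply: normr_Rint_le => //; first exact: continuous_integrableT mulbern_continuous.
  move=> y /andP[ay yx]; have y0 := le_trans (ltW a0) ay.
  by rewrite normrM ger0_norm// -[leRHS]mulr1; apply: ler_pM => //; exact: bern_le1.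
have h3 y : 0 <= y -> y <= b -> `|y ^+ 2 * bern y^-1| <= b ^+ 2.
  move=> y0 yb; rewrite normrM ger0_norm ?sqr_ge0// -[leRHS]mulr1.
  by apply: ler_pM => //; [exact: sqr_ge0|rewrite ler_sqr ?nnegrE ?(le_trans y0)|exact: bern_le1].
have h4 : x * (x - a) <= b ^+ 2.
  rewrite expr2; apply: ler_pM => //; [exact: ltW|by rewrite subr_ge0|].
  by rewrite lerBlDr (le_trans xb)// lerDl ltW.
have := h3 a (ltW a0) (le_trans ax xb); have := h3 x (ltW x0) xb.
move: h2; rewrite !ler_norml => /andP[? ?] /andP[? ?] /andP[? ?].
by apply/andP; split; lra.
Qed.

(** In the mean, [frac u^-1] is 1/2. The weight [u^-1] varies by a bounded
factor on [a, b], so an integration by parts against the O(b^2) primitive of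
[frac u^-1 - 1 / 2] leaves an error O(b). *)
Lemma Rint_log_frac a b r : 0 < a -> a <= b -> b <= r * a ->
  `|\int[mu]_(u in `[a, b]) (u^-1 * frac u^-1) - (ln b - ln a) / 2| <=
  4 * (1 + r ^+ 2) * b.
Proof.
move=> a0 ab bra; have b0 := lt_le_trans a0 ab.
have pos x : a <= x <= b -> 0 < x by move=> /andP[ax _]; exact: lt_le_trans ax.
have ci x : a <= x <= b -> {for x, continuous (@GRing.inv R)}.
  by move=> /pos x0; apply: inv_continuous; rewrite gt_eqF.
have ii : mu.-integrable `[a, b] (EFin \o @GRing.inv R).
  by apply: continuous_integrable; exact: continuous_withinW ci.
have fhi := @frac_inv_half_integrable R a b.
have ifi : mu.-integrable `[a, b] (EFin \o (fun u => u^-1 * (frac u^-1 - 1 / 2))).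
  by apply: (integrable_continuousM fhi); exact: continuous_withinW ci.
have E1 : \int[mu]_(u in `[a, b]) (u^-1 * frac u^-1) =
    \int[mu]_(u in `[a, b]) (u^-1 * (frac u^-1 - 1 / 2)) + (ln b - ln a) / 2.
  have <- : \int[mu]_(u in `[a, b]) (1 / 2 * u^-1) = (ln b - ln a) / 2.
    rewrite (@RintegralZl _ _ _ mu _ (@GRing.inv R))//.
    have -> : \int[mu]_(u in `[a, b]) u^-1 = ln b - ln a.
      by apply: (@Rint_FTC _ (@ln R)) => // x /pos; exact: der_ln.
    by ring.
  rewrite -(@RintegralD _ _ _ mu _ (fun u => u^-1 * (frac u^-1 - 1 / 2))
    (fun u => 1 / 2 * u^-1))//; last exact: integrable_scale.
  by apply: eq_Rintegral => x _; ring.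
rewrite E1 addrK.
have di x : a <= x <= b -> is_derive x (1 : R) (@GRing.inv R) (- x ^- 2).
  move=> /pos x0; apply: der_eq (derV _ (der_id x)) _; first by rewrite gt_eqF.
  by rewrite mulN1r.
have cdi x : a <= x <= b -> {for x, continuous (fun y : R => - y ^- 2)}.
  move=> /pos x0; apply: continuousN; apply: continuous_invX2.
  by rewrite gt_eqF.
have -> := @Rint_by_parts _ (fun u => frac u^-1 - 1 / 2) (@GRing.inv R)
  (fun y => - y ^- 2) a b ab fhi di cdi.
pose G x := \int[mu]_(u in `[a, x]) (frac u^-1 - 1 / 2).
have Gb x : a <= x -> x <= b -> `|G x| <= 4 * b ^+ 2 by move=> *; exact: Rint_remainder_le.
have h1 : `|b^-1 * G b| <= 4 * b.
  rewrite normrM ger0_norm ?invr_ge0 ?(ltW b0)//.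
  rewrite (_ : 4 * b = b^-1 * (4 * b ^+ 2)); last by field; rewrite gt_eqF.
  by rewrite ler_pM2l ?invr_gt0// Gb.
have h2 : `|\int[mu]_(x in `[a, b]) (- x ^- 2 * G x)| <= (a ^- 2 * (4 * b ^+ 2)) * (b - a).
  apply: normr_Rint_le => //.
    apply: continuous_integrable.
    have cG : {within `[a, b], continuous G}.
      exact: parameterized_integral_continuous.
    move=> x; apply: cvgM; last exact: cG.
    exact: (continuous_withinW cdi).
  move=> x axb; have /andP[ax xb] := axb; have x0 := pos x axb.
  have x2 : 0 <= x ^- 2 by rewrite invr_ge0 sqr_ge0.
  rewrite normrM normrN (ger0_norm x2); apply: ler_pM => //.
    by rewrite lef_pV2 ?posrE ?exprn_gt0// ler_sqr ?nnegrE ?(ltW a0) ?(ltW x0).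
  exact: Gb.
have h3 : (a ^- 2 * (4 * b ^+ 2)) * (b - a) <= 4 * r ^+ 2 * b.
  have h4 : a ^- 2 * b ^+ 2 <= r ^+ 2.
    rewrite mulrC ler_pdivrMr ?exprn_gt0// -exprMn ler_sqr ?nnegrE ?(ltW b0)//.
    by rewrite (le_trans (ltW b0)).
  rewrite (_ : _ * (b - a) = 4 * (a ^- 2 * b ^+ 2) * (b - a)); last by ring.
  apply: ler_pM; rewrite ?subr_ge0//.
  - by rewrite mulr_ge0// mulr_ge0 ?invr_ge0 ?sqr_ge0.
  - by rewrite ler_pM2l.
  - by rewrite lerBlDr lerDl ltW.
have := le_trans h2 h3; move: h1; rewrite -/(G b) !ler_norml => /andP[? ?] /andP[? ?].
by apply/andP; split; lra.
Qed.

End expansion.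

(** * The autocorrelation in terms of Phi *)

Section closed_formula.
Context {R : realType}.
Notation mu := (@lebesgue_measure R).
Implicit Types l m u x y a b : R.

Lemma autocorrelation_approx l N U : 0 < l -> (0 < N)%N -> l <= U -> 1 <= U ->
  `|autocorrelation l / l - U^-1 -
    (JN N l U - harm N / 2 + 1 / 2 + l * Phi l^-1 - 2 / l * M l)|
  <= (1 + 9 * l) / N%:R.
Proof.
move=> l0 N0 lU U1; have N0' : 0 < N%:R :> R by rewrite ltr0n.
have U0 := lt_le_trans l0 lU; have l1 : l != 0 by rewrite gt_eqF.
have e0 : 0 < l / N%:R by rewrite divr_gt0.
have eU : l / N%:R <= U by rewrite (le_trans _ lU)// ler_pdivrMr// ler_peMr ?ler1n// ltW.
have Es := Rint_split (ltW e0) eU (inv_integrand_integrable l 0 U).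
have Eq := Rint_inv_integrand_expand l0 N0 lU.
have EA := autocorrelation_tail l0 lU U1; rewrite Es in EA; move: EA Eq.
set I := Rintegral mu `[0, _]%classic (inv_integrand l).
set X := Rintegral mu _ (inv_integrand l).
set E := frac_inv_err _ => EA Eq.
have {}EA : autocorrelation l / l = I / l + X / l + U^-1.
  by rewrite EA; field; rewrite l1 gt_eqF.
rewrite EA Eq.
have h1 : `|I / l| <= N%:R^-1.
  rewrite normrM (ger0_norm (_ : 0 <= l^-1)) ?invr_ge0 ?(ltW l0)//.
  rewrite ler_pdivrMr// mulrC.
  have := @normr_Rint_le _ (inv_integrand l) 0 (l / N%:R) 1 (ltW e0) (inv_integrand_integrable _ _ _).
  rewrite mul1r subr0; apply => x _.
  by rewrite ger0_norm ?inv_integrand_ge0// inv_integrand_le1.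
have NN : 2 / N.+1%:R <= 2 / N%:R :> R.
  by rewrite ler_pM2l// lef_pV2 ?posrE// ler_nat.
have h2 : `|l * (PhiN N l^-1 - Phi l^-1)| <= 2 * l / N%:R.
  rewrite normrM (ger0_norm (ltW l0)) [2 * l]mulrC -mulrA ler_pM2l// distrC.
  exact: le_trans (Phi_tail _ _) NN.
have h3 : `|2 / l * (MN N l - M l)| <= 4 * l / N%:R.
  have l2 : 0 < 2 / l by rewrite divr_gt0.
  rewrite normrM (ger0_norm (ltW l2)).
  rewrite (_ : 4 * l / N%:R = 2 / l * (2 / N%:R * l ^+ 2)); last first.
    by field; rewrite l1 gt_eqF.
  by rewrite ler_pM2l// (le_trans (MN_le _ l0))// ler_wpM2r// sqr_ge0.
have h4 : `|N%:R / l * E| <= 3 * l / N%:R.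
  have nl : 0 < N%:R / l by rewrite divr_gt0.
  rewrite normrM (ger0_norm (ltW nl)).
  rewrite (_ : 3 * l / N%:R = N%:R / l * (3 * (l / N%:R) ^+ 2)); last first.
    by field; rewrite l1 gt_eqF.
  by rewrite ler_pM2l// frac_inv_err_le.
rewrite (_ : (1 + 9 * l) / N%:R = N%:R^-1 + 2 * l / N%:R + 4 * l / N%:R + 3 * l / N%:R); last by ring.
rewrite (_ : _ - _ = I / l + l * (PhiN N l^-1 - Phi l^-1) - 2 / l * (MN N l - M l) + N%:R / l * E); last by ring.
rewrite (le_trans (ler_normD _ _))// lerD//.
rewrite (le_trans (ler_normB _ _))// lerD//.
by rewrite (le_trans (ler_normD _ _))// lerD.
Qed.

Lemma eq_of_inv_bound x C : (forall N, (0 < N)%N -> `|x| <= C / N%:R) -> x = 0.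
Proof.
move=> h; apply/eqP; rewrite -normr_le0; apply/ler_addgt0Pr => e e0; rewrite add0r.
have [N NC] : exists N : nat, C / e <= N.+1%:R.
  exists (Num.truncn (C / e)).
  have [C0|C0] := leP 0 (C / e); first by apply/ltW; rewrite Num.Theory.truncnS_gt.
  by rewrite (le_trans (ltW C0)).
rewrite (le_trans (h N.+1 _))// ler_pdivrMr// mulrC -ler_pdivrMr//.
Qed.

(** Both expansions hold up to O(1/N) with the same [N] and [U]. Their
harmonic sums cancel, and the difference of the two [JN] is an integral over
[l / N, m / N], which tends to [(ln m - ln l) / 2] by [Rint_log_frac]. *)
Lemma autocorrelation_diff l m : 0 < l -> l <= m ->
  autocorrelation l / l - autocorrelation m / m =
  (ln m - ln l) / 2 + (l * Phi l^-1 - 2 / l * M l) - (m * Phi m^-1 - 2 / m * M m).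
Proof.
move=> l0 lm; have m0 := lt_le_trans l0 lm.
apply/eqP; rewrite -subr_eq0; apply/eqP.
apply: (@eq_of_inv_bound _ (1 + 9 * l + (1 + 9 * m) + 4 * (1 + (m / l) ^+ 2) * m)) => N N0.
have N0' : 0 < N%:R :> R by rewrite ltr0n.
pose U := Num.max m 1.
have mU : m <= U by rewrite le_max lexx.
have U1 : 1 <= U by rewrite le_max lexx orbT.
have hl := autocorrelation_approx l0 N0 (le_trans lm mU) U1.
have hm := autocorrelation_approx m0 N0 mU U1.
have lN : 0 < l / N%:R by rewrite divr_gt0.
have mN : 0 < m / N%:R by rewrite divr_gt0.
have lmN : l / N%:R <= m / N%:R by rewrite ler_pM2r// invr_gt0.
have mNU : m / N%:R <= U.
  by rewrite (le_trans _ mU)// ler_pdivrMr// ler_peMr ?ler1n// ltW.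
have hJ : JN N l U - JN N m U =
    \int[mu]_(u in `[l / N%:R, m / N%:R]) (u^-1 * frac u^-1).
  rewrite /JN (@Rint_split _ _ (l / N%:R) (m / N%:R) U)//; first by rewrite addrK.
  apply: integrable_continuousM; first exact: frac_inv_integrable.
  apply: continuous_withinW => x /andP[lx _]; apply: inv_continuous.
  by rewrite gt_eqF// (lt_le_trans lN).
have rr : m / N%:R <= (m / l) * (l / N%:R).
  by rewrite le_eqVlt; apply/orP; left; apply/eqP; field; rewrite !gt_eqF.
have := Rint_log_frac lN lmN rr; rewrite -hJ !lnM ?posrE ?invr_gt0// => hlog.
have {}hlog : `|JN N l U - JN N m U - (ln m - ln l) / 2| <=
    4 * (1 + (m / l) ^+ 2) * m / N%:R.
  rewrite -mulrA (le_trans _ hlog)// le_eqVlt; apply/orP; left; apply/eqP.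
  by congr `| _ |; ring.
rewrite 2!(mulrDl _ _ N%:R^-1).
set A := autocorrelation l / l in hl *; set B := autocorrelation m / m in hm *.
rewrite (_ : _ - _ = (A - U^-1 -
    (JN N l U - harm N / 2 + 1 / 2 + l * Phi l^-1 - 2 / l * M l))
  - (B - U^-1 - (JN N m U - harm N / 2 + 1 / 2 + m * Phi m^-1 - 2 / m * M m))
  + (JN N l U - JN N m U - (ln m - ln l) / 2)); last by ring.
rewrite (le_trans (ler_normD _ _))// lerD//.
by rewrite (le_trans (ler_normB _ _))// lerD.
Qed.

Definition cA : R := autocorrelation 1 + 2 * M 1.

(** [autocorrelation_diff] between [l] and 1. *)
Theorem autocorrelation_formula l : 0 < l ->
  autocorrelation l = cA * l - l * ln l / 2 + l ^+ 2 * Phi l^-1 - 2 * M l.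
Proof.
move=> l0; have l1 : l != 0 by rewrite gt_eqF.
have ok : autocorrelation l / l = cA - ln l / 2 + l * Phi l^-1 - 2 / l * M l.
  rewrite /cA; have [l1'|/ltW l1'] := leP l 1.
    have := autocorrelation_diff l0 l1'.
    rewrite !invr1 Phi1 ln1 !mulr1 !mulr0 => /eqP; rewrite subr_eq => /eqP ->.
    by ring.
  have := autocorrelation_diff ltr01 l1'.
  rewrite !invr1 Phi1 ln1 !mulr1 !mulr0 => /eqP; rewrite subr_eq => /eqP h.
  by rewrite {1}h; ring.
have -> : autocorrelation l = l * (autocorrelation l / l) by field.
by rewrite ok; field.
Qed.

(** The form in which the argument of [Phi] is the variable itself; all the
other terms are continuously differentiable for [v > 0]. *)
Theorem autocorrelation_formula_inv v : 0 < v ->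
  autocorrelation v = cA + ln v / 2 + Phi v / v - 2 * v * M v^-1.
Proof.
move=> v0; have v1 : v != 0 by rewrite gt_eqF.
rewrite autocorrelation_inv// autocorrelation_formula ?invr_gt0//.
by rewrite invrK lnV ?posrE//; field.
Qed.

End closed_formula.

(** * The behaviour of Phi under inversion *)

Section weighted.
Context {R : realType}.
Notation mu := (@lebesgue_measure R).
Implicit Types x y a b : R.

(** The exponent 3 is the one for which [wt x^-1 = x ^+ 3 * wt x]: it absorbs
the factor [x ^+ 3] of [Phi_reflection], so that the two values of [Phi]
there enter with the same weight. *)
Definition wt x : R := (1 + x) ^- 3.
Definition wt4 x : R := (1 + x) ^- 4.

Lemma der_onep x : is_derive x (1 : R) (fun y : R => 1 + y) 1.
Proof. by apply: der_eq (derD (der_cst 1 x) (der_id x)) _; rewrite add0r. Qed.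

Lemma der_wt x : 0 <= x -> is_derive x (1 : R) wt (- 3 * wt4 x).
Proof.
move=> x0; have x1 : 1 + x != 0 by rewrite gt_eqF// ltr_pwDl.
apply: der_eq (derV _ (derX 3 (der_onep x))) _; first by rewrite expf_eq0.
by rewrite /wt4 /=; field.
Qed.

Lemma continuous_onepXV n x : 0 <= x -> {for x, continuous (fun y : R => (1 + y) ^- n)}.
Proof.
move=> x0; have x1 : 1 + x != 0 by rewrite gt_eqF// ltr_pwDl.
apply: (@der_continuous _ _ _ (- (n%:R * (1 + x) ^+ n.-1 * 1) / ((1 + x) ^+ n) ^+ 2)).
by apply: derV; [rewrite expf_neq0|exact: derX (der_onep x)].
Qed.

Lemma wt4_continuous x : 0 <= x -> {for x, continuous wt4}.
Proof. exact: continuous_onepXV. Qed.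

Lemma wt_continuous x : 0 <= x -> {for x, continuous wt}.
Proof. exact: continuous_onepXV. Qed.

Definition wprim0 (f : R -> R) x : R := \int[mu]_(u in `[0, x]) (wt4 u * f u).
(** Formally, [wprim f x] is [f 0] plus the integral of [wt * f'] over [0,
x]. The integration by parts makes sense of it for a merely continuous [f]. *)
Definition wprim (f : R -> R) x : R := wt x * f x + 3 * wprim0 f x.

Lemma wt4M_integrable (f : R -> R) a b : continuous f -> 0 <= a ->
  mu.-integrable `[a, b] (EFin \o (fun u => wt4 u * f u)).
Proof.
move=> cf a0; apply: continuous_integrable; apply: continuous_withinW => x /andP[ax _].
by apply: continuousM; [exact: wt4_continuous (le_trans a0 ax)|exact: cf].
Qed.

Lemma der_wprim0 (f : R -> R) x : continuous f -> 0 < x ->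
  is_derive x (1 : R) (wprim0 f) (wt4 x * f x).
Proof.
move=> cf x0; apply: (@der_Rint _ (fun u => wt4 u * f u) 0 x (x + 1)) => //.
- by rewrite ltrDl.
- exact: wt4M_integrable.
- by apply: continuousM; [exact: wt4_continuous (ltW x0)|exact: cf].
Qed.

Lemma wprim0_continuous (f : R -> R) : continuous f -> continuous (wprim0 f).
Proof. by move=> cf; apply: Rint_continuous => b; exact: wt4M_integrable. Qed.

Lemma wprim_continuous (f : R -> R) x : continuous f -> 0 <= x ->
  {for x, continuous (wprim f)}.
Proof.
move=> cf x0; apply: continuousD.
  by apply: continuousM; [exact: wt_continuous|exact: cf].
by apply: continuousM; [exact: cst_continuous|exact: wprim0_continuous].
Qed.

Lemma wprim_zero (f : R -> R) : wprim f 0 = f 0.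
Proof. by rewrite /wprim /wprim0 Rint_point /wt addr0 expr1n invr1 mul1r mulr0 addr0. Qed.

(** The right-hand side of the functional equation [f x + x * f x^-1 = Fhat
x] which the derivative [f] of [Phi] ought to satisfy. *)
Definition Fhat x : R :=
  (cA - 1 / 2) * (1 + x) + (1 - x) * ln x / 2 - autocorrelation x.

Let Nn x : R := 2 * x ^+ 2 * M x^-1 - 2 * x * M x + cA * (x ^+ 2 - x)
  - (x + x ^+ 2) * ln x / 2.

(** The two formulas for the autocorrelation, one in [Phi x] and one in [Phi
x^-1], have equal left-hand sides. *)
Lemma Phi_reflection x : 0 < x -> Phi x - x ^+ 3 * Phi x^-1 = Nn x.
Proof.
move=> x0; have x1 : x != 0 by rewrite gt_eqF.
have := autocorrelation_formula x0; rewrite (autocorrelation_formula_inv x0) => h.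
have {}h : Phi x = x * (cA * x - x * ln x / 2 + x ^+ 2 * Phi x^-1 - 2 * M x
    - (cA + ln x / 2 - 2 * x * M x^-1)).
  by rewrite -h; field.
by rewrite {1}h /Nn; ring.
Qed.

Lemma wt_inv x : 0 < x -> wt x^-1 = x ^+ 3 * wt x.
Proof.
move=> x0; rewrite /wt; field.
by rewrite !gt_eqF// addr_gt0.
Qed.

Let N1 x : R := wt x * Nn x + 3 * wprim0 Phi x - 3 * wprim0 Phi x^-1.

Let N1E x : 0 < x -> wprim Phi x - wprim Phi x^-1 = N1 x.
Proof. by move=> x0; rewrite /N1 -Phi_reflection// /wprim wt_inv//; ring. Qed.

Let der_inv x : 0 < x -> is_derive x (1 : R) (@GRing.inv R) (- x ^- 2).
Proof.
move=> x0; apply: der_eq (derV _ (der_id x)) _; first by rewrite gt_eqF.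
by rewrite mulN1r.
Qed.

Let der_N1 x : 0 < x -> is_derive x (1 : R) N1 (wt x * Fhat x).
Proof.
move=> x0; have x1 : x != 0 by rewrite gt_eqF.
have xp : 1 + x != 0 by rewrite gt_eqF// addr_gt0.
have xi : 0 < x^-1 by rewrite invr_gt0.
have dM := der_M x0; have dMi := der_comp (der_M xi) (der_inv x0).
have dx2 := derX 2 (der_id x); have dln := der_ln x0; have dw := der_wt (ltW x0).
have dI := der_wprim0 (@Phi_continuous R) x0.
have dIi := der_comp (der_wprim0 (@Phi_continuous R) xi) (der_inv x0).
have dNn := derB (derD (derB (derM (derM (der_cst 2 x) dx2) dMi)
  (derM (derM (der_cst 2 x) (der_id x)) dM)) (derM (der_cst cA x) (derB dx2 (der_id x))))
  (derM (derM (derD (der_id x) dx2) dln) (der_cst 2^-1 x)).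
apply: der_eq (derB (derD (derM dw dNn) (derM (der_cst 3 x) dI)) (derM (der_cst 3 x) dIi)) _.
rewrite -/(Nn x) -Phi_reflection// /Fhat.
(* One copy is expanded in [Phi x] and the other in [Phi x^-1]. *)
have -> : autocorrelation x = 2 * autocorrelation x - autocorrelation x by ring.
rewrite {1}autocorrelation_formula_inv// autocorrelation_formula//.
rewrite /wt /wt4 invrK /=.
by field; rewrite x1 xp.
Qed.

Lemma autocorrelation_continuous x : 0 < x -> {for x, continuous (@autocorrelation R)}.
Proof.
move=> x0; have x1 : x != 0 by rewrite gt_eqF.
have c : {for x, continuous (fun v : R => cA + ln v / 2 + Phi v / v - 2 * v * M v^-1)}.
  apply: continuousB.
    apply: continuousD.
      apply: continuousD; first exact: cst_continuous.
      apply: continuousM; [exact: continuous_ln|exact: cst_continuous].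
    by apply: continuousM; [exact: Phi_continuous|exact: inv_continuous].
  apply: continuousM.
    by apply: continuousM; [exact: cst_continuous|exact: cvg_id].
  apply: (@der_continuous _ (fun v => M v^-1)).
  by apply: der_comp (der_inv x0); apply: der_M; rewrite invr_gt0.
move: c; rewrite /prop_for /continuous_at -autocorrelation_formula_inv// => c.
apply: cvg_trans c; apply: near_eq_cvg; near=> v.
by apply/esym/autocorrelation_formula_inv; near: v; exact: lt_nbhsr.
Unshelve. all: by end_near. Qed.

Lemma Fhat_continuous x : 0 < x -> {for x, continuous Fhat}.
Proof.
move=> x0; apply: continuousB; last exact: autocorrelation_continuous.
apply: continuousD.
  apply: continuousM; first exact: cst_continuous.
  by apply: continuousD; [exact: cst_continuous|exact: cvg_id].
apply: continuousM; last exact: cst_continuous.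
apply: continuousM; last exact: continuous_ln.
by apply: continuousB; [exact: cst_continuous|exact: cvg_id].
Qed.

(** This is the functional equation for the derivative of [Phi], integrated
against [wt]. The left-hand side involves [Phi] outside an integral only
through the combination of [Phi_reflection], hence it is differentiable
although [Phi] need not be. *)
Theorem wprim_Phi_inversion x : 0 < x -> x <= 1 ->
  wprim Phi x - wprim Phi x^-1 = - \int[mu]_(u in `[x, 1]) (wt u * Fhat u).
Proof.
move=> x0 x1.
have -> : \int[mu]_(u in `[x, 1]) (wt u * Fhat u) = N1 1 - N1 x.
  apply: Rint_FTC => // y /andP[xy _]; have y0 := lt_le_trans x0 xy.
    exact: der_N1.
  by apply: continuousM; [exact: wt_continuous (ltW y0)|exact: Fhat_continuous].
by rewrite -(N1E x0) -(N1E ltr01) invr1 subrr; ring.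
Qed.

End weighted.

(** * A maximum principle for shift and inversion *)

Section uniqueness.
Context {R : realType}.
Notation mu := (@lebesgue_measure R).
Implicit Types x y a b : R.
Variable D : R -> R.
Hypothesis cD : continuous D.
Hypothesis Dshift : forall x, 0 <= x -> D (x + 1) = D x + D 1.
Hypothesis Dinv : forall x, 0 < x -> x <= 1 -> wprim D x = wprim D x^-1.
Hypothesis D0 : D 0 = 0.

Let E := wprim D.

(** The ratio [wt (x + 1) / wt x], which increases from 1/8 to 1; [dratio] is
its derivative. *)
Definition ratio x : R := (1 + x) ^+ 3 / (2 + x) ^+ 3.
Definition dratio x : R := 3 * (1 + x) ^+ 2 / (2 + x) ^+ 4.

Lemma der_twop x : is_derive x (1 : R) (fun y : R => 2 + y) 1.
Proof. by apply: der_eq (derD (der_cst 2 x) (der_id x)) _; rewrite add0r. Qed.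

Lemma der_ratio x : 0 <= x -> is_derive x (1 : R) ratio (dratio x).
Proof.
move=> x0; have x2 : 2 + x != 0 by rewrite gt_eqF// ltr_pwDl.
apply: der_eq (derM (derX 3 (der_onep x)) (derV _ (derX 3 (der_twop x)))) _.
  by rewrite expf_neq0.
by rewrite /dratio /=; field.
Qed.

Lemma dratio_continuous x : 0 <= x -> {for x, continuous dratio}.
Proof.
move=> x0; have x2 : 2 + x != 0 by rewrite gt_eqF// ltr_pwDl.
have d1 := derM (der_cst 3 x) (derX 2 (der_onep x)).
have x4 : (2 + x) ^+ 4 != 0 by rewrite expf_neq0.
exact (@der_continuous _ dratio _ _ (derM d1 (@derV _ (fun y => (2 + y) ^+ 4) x _ x4 (derX 4 (der_twop x))))).
Qed.

Lemma dratio_ge0 x : 0 <= x -> 0 <= dratio x.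
Proof. by move=> x0; rewrite divr_ge0 ?mulr_ge0 ?exprn_ge0 ?addr_ge0. Qed.

Lemma ratio_lt1 x : 0 <= x -> ratio x < 1.
Proof.
move=> x0; rewrite /ratio ltr_pdivrMr ?exprn_gt0 ?ltr_pwDl// mul1r.
by rewrite ltr_pXn2r// ?nnegrE ?addr_ge0// ltrD2r ltr1n.
Qed.

Lemma ratio_ge0 x : 0 <= x -> 0 <= ratio x.
Proof. by move=> x0; rewrite divr_ge0 ?exprn_ge0 ?addr_ge0. Qed.

Let cE x : 0 <= x -> {for x, continuous E}.
Proof. exact: wprim_continuous. Qed.

Let wt4_shift_int a b : 0 <= a ->
  mu.-integrable `[a, b] (EFin \o (fun u => wt4 (u + 1) * D u)).
Proof.
move=> a0; apply: continuous_integrable; apply: continuous_withinW => x /andP[ax _].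
have x0 := le_trans a0 ax.
apply: continuousM; last exact: cD.
apply: (@continuous_comp _ _ _ (fun u : R => u + 1) wt4).
  by apply: continuousD; [exact: cvg_id|exact: cst_continuous].
by apply: wt4_continuous; rewrite addr_ge0.
Qed.

Let E_shift0 b : 0 <= b -> E (b + 1) =
  E 1 + wt (b + 1) * D b + 3 * \int[mu]_(u in `[0, b]) (wt4 (u + 1) * D u).
Proof.
move=> b0; rewrite /E /wprim /wprim0 Dshift//.
rewrite (@Rint_split _ _ 0 1 (b + 1)) ?lerDr//; last exact: wt4M_integrable.
have -> : \int[mu]_(x in `[1, b + 1]) (wt4 x * D x) =
    \int[mu]_(u in `[0, b]) (wt4 (u + 1) * D u) + D 1 * (1 / 8 - wt (b + 1)) / 3.
  transitivity (\int[mu]_(x in `[0 + 1, b + 1]) (wt4 x * D x)); first by rewrite add0r.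
  rewrite -(@Rint_shift _ 1 0 b (fun x => wt4 x * D x)); last first.
    by apply: integrable_measurable; apply: wt4M_integrable => //; rewrite add0r.
  transitivity (\int[mu]_(x in `[0, b]) (wt4 (x + 1) * D x + D 1 * wt4 (x + 1))).
    apply: eq_Rintegral => x; rewrite in_segment => /andP[x0 _].
    by rewrite Dshift//; ring.
  have iw : mu.-integrable `[0, b] (EFin \o (fun x => wt4 (x + 1))).
    apply: continuous_integrable; apply: continuous_withinW => x /andP[x0 _].
    apply: (@continuous_comp _ _ _ (fun u : R => u + 1) wt4).
      by apply: continuousD; [exact: cvg_id|exact: cst_continuous].
    by apply: wt4_continuous; rewrite addr_ge0.
  rewrite (@RintegralD _ _ _ mu _ (fun x => wt4 (x + 1) * D x) (fun x => D 1 * wt4 (x + 1)))//; last 2 first.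
  - exact: wt4_shift_int.
  - exact: integrable_scale.
  rewrite (@RintegralZl _ _ _ mu _ (fun x => wt4 (x + 1)))//.
  have -> : \int[mu]_(x in `[0, b]) wt4 (x + 1) = - wt (b + 1) / 3 - (- wt (0 + 1) / 3).
    apply: (@Rint_FTC _ (fun x => - wt (x + 1) / 3)) => // x /andP[x0 _].
      have x1 : 0 <= x + 1 by rewrite addr_ge0.
      have d1 := derD (der_id x) (der_cst 1 x).
      apply: der_eq (derM (derN (@der_comp _ wt (fun y => y + 1) x _ _ (der_wt x1) d1)) (der_cst 3^-1 x)) _.
      by rewrite addr0 mulr0 addr0; field.
    apply: (@continuous_comp _ _ _ (fun u : R => u + 1) wt4).
      by apply: continuousD; [exact: cvg_id|exact: cst_continuous].
    by apply: wt4_continuous; rewrite addr_ge0.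
  have -> : wt (0 + 1) = 1 / 8 :> R by rewrite /wt; field.
  by ring.
have -> : wt 1 = 1 / 8 :> R by rewrite /wt; field.
by field.
Qed.

Let dE_int a b : 0 <= a -> mu.-integrable `[a, b] (EFin \o (fun u => dratio u * E u)).
Proof.
move=> a0; apply: continuous_integrable; apply: continuous_withinW => x /andP[ax _].
have x0 := le_trans a0 ax.
by apply: continuousM; [exact: dratio_continuous|exact: cE].
Qed.

(** The increments of [D] are invariant under the shift by 1, so that those
of [wprim D] after the shift are those of [wprim D] multiplied by [ratio];
integrate by parts. Subtracting the identities at [b] and at a large [B]
expresses [wprim D (b + 1)], up to terms at infinity, as a combination of
values of [wprim D] beyond [b] with nonnegative coefficients of sum at most
1. *)
Lemma wprim_shift b : 0 <= b ->
  E (b + 1) = E 1 + ratio b * E b - \int[mu]_(u in `[0, b]) (dratio u * E u).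
Proof.
move=> b0; rewrite E_shift0//.
pose S x := \int[mu]_(u in `[0, x]) (wt4 (u + 1) * D u).
pose K x := \int[mu]_(u in `[0, x]) (dratio u * E u).
(* The identity amounts to the vanishing of [Q], which has derivative 0. *)
pose Q x := 3 * S x - ratio x * (3 * wprim0 D x) + K x.
suff Q0 : Q 0 = Q b.
  have : Q b = 0.
    by rewrite -Q0 /Q /S /K /wprim0 !Rint_point !mulr0 subrr addr0.
  rewrite /Q -/(S b) -/(K b) => Qb.
  have -> : 3 * S b = ratio b * (3 * wprim0 D b) - K b by move: Qb; lra.
  have -> : wt (b + 1) = ratio b * wt b.
    rewrite /wt /ratio; field; rewrite !gt_eqF// ?ltr_pwDl//; lra.
  by rewrite /E /wprim; ring.
apply: derivative0_cst => // [x /andP[x0 xb]|].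
  have x1 := ltW x0.
  have dS : is_derive x (1 : R) S (wt4 (x + 1) * D x).
    apply: (@der_Rint _ (fun u => wt4 (u + 1) * D u) 0 x (x + 1)) => //.
    - by rewrite ltrDl.
    - exact: wt4_shift_int.
    - apply: continuousM; last exact: cD.
      apply: (@continuous_comp _ _ _ (fun u : R => u + 1) wt4).
        by apply: continuousD; [exact: cvg_id|exact: cst_continuous].
      by apply: wt4_continuous; rewrite addr_ge0.
  have dK : is_derive x (1 : R) K (dratio x * E x).
    apply: (@der_Rint _ (fun u => dratio u * E u) 0 x (x + 1)) => //.
    - by rewrite ltrDl.
    - exact: dE_int.
    - by apply: continuousM; [exact: dratio_continuous|exact: cE].
  apply: der_eq (derD (derB (derM (der_cst 3 x) dS) (derM (der_ratio x1)
    (derM (der_cst 3 x) (der_wprim0 cD x0)))) dK) _.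
  rewrite /E /wprim /dratio /ratio /wt /wt4.
  by field; rewrite !gt_eqF// ?ltr_pwDl//; lra.
apply: continuous_withinW => x /andP[x0 _].
apply: continuousD.
  apply: continuousB.
    apply: continuousM; first exact: cst_continuous.
    by apply: Rint_continuous => c; exact: wt4_shift_int.
  apply: continuousM; first exact: (@der_continuous _ ratio _ _ (der_ratio x0)).
  by apply: continuousM; [exact: cst_continuous|exact: wprim0_continuous].
by apply: Rint_continuous => c; exact: dE_int.
Qed.

Let dE_bound a b C : 0 <= a -> a <= b -> (forall x, a <= x <= b -> `|E x| <= C) ->
  `|\int[mu]_(u in `[a, b]) (dratio u * E u)| <= C * (ratio b - ratio a).
Proof.
move=> a0 ab EC.
apply: (le_trans (le_normr_Rintegral _ (dE_int b a0))) => //.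
have cdr x : a <= x <= b -> {for x, continuous dratio}.
  by move=> /andP[ax _]; apply: dratio_continuous; exact: le_trans ax.
have ir : mu.-integrable `[a, b] (EFin \o dratio).
  by apply: continuous_integrable; exact: continuous_withinW cdr.
have <- : \int[mu]_(u in `[a, b]) dratio u = ratio b - ratio a.
  apply: Rint_FTC => // x /andP[ax _]; apply: der_ratio; exact: le_trans ax.
rewrite -RintegralZl//; apply: le_Rintegral => //.
- exact: integrable_norm (dE_int b a0).
- exact: integrable_scale.
- move=> x /=; rewrite in_itv/= => axb; have /andP[ax _] := axb.
  rewrite normrM ger0_norm; last by apply: dratio_ge0; exact: le_trans ax.
  by rewrite mulrC ler_wpM2r// ?EC// dratio_ge0// (le_trans a0).
Qed.

Let E0 : E 0 = 0. Proof. by rewrite /E wprim_zero D0. Qed.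

(** The inversion carries neighbourhoods of infinity to neighbourhoods of 0,
where [E] vanishes. *)
Let E_small e : 0 < e -> exists2 V, 0 < V & forall x, V <= x -> `|E x| <= e.
Proof.
move=> e0; have /cvgrPdist_le/(_ _ e0) := cE (lexx 0); rewrite E0.
move=> /nbhs_ballP[d /= d0 h].
pose c := Num.min d 1 / 2.
have c0 : 0 < c by rewrite divr_gt0// lt_min d0 ltr01.
have cd : c < d.
  rewrite /c ltr_pdivrMr// (@le_lt_trans _ _ d) ?ge_min ?lexx//.
  by rewrite ltr_pMr// ltr1n.
have c1 : c <= 1.
  by rewrite /c ler_pdivrMr// mul1r (@le_trans _ _ 1) ?ge_min ?lexx ?orbT// ler1n.
exists c^-1; first by rewrite invr_gt0.
move=> x cx; have x0 : 0 < x by rewrite (lt_le_trans _ cx)// invr_gt0.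
have xi0 : 0 < x^-1 by rewrite invr_gt0.
have xic : x^-1 <= c by rewrite -[leRHS]invrK lef_pV2 ?posrE ?invr_gt0.
have := Dinv xi0 (le_trans xic c1); rewrite invrK -/E => <-.
rewrite -normrN -sub0r; apply: h.
by rewrite /ball/= sub0r normrN gtr0_norm// (le_lt_trans xic).
Qed.

(** A maximum principle. A nonzero maximum of [|E|] is attained on [1, +oo[
as well, by inversion. There [wprim_shift] writes it as a mean of values of
[E] further on, which is impossible since [E] tends to 0 at infinity. *)
Let E_eq0 : forall x, 0 <= x -> E x = 0.
Proof.
have cE01 : {within `[0, 1], continuous (fun x => `|E x|)}.
  apply: continuous_withinW => y /andP[y0 _].
  by apply: (@continuous_comp _ _ _ E); [exact: cE|exact: norm_continuous].
have [c c01 cmax] := @EVT_max R (fun x => `|E x|) 0 1 ler01 cE01.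
set S := `|E c| in cmax.
have Smax y : 0 <= y -> `|E y| <= S.
  move=> y0; have [y1|/ltW y1] := leP y 1; first by apply: cmax; rewrite in_itv/= y0.
  have yi0 : 0 < y^-1 by rewrite invr_gt0 (lt_le_trans ltr01).
  have yi1 : y^-1 <= 1 by rewrite invf_le1// (lt_le_trans ltr01).
  have := Dinv yi0 yi1; rewrite invrK -/E => <-; apply: cmax.
  by rewrite in_itv/= yi1 ltW.
suff S0 : S = 0.
  by move=> x x0; apply/eqP; rewrite -normr_le0 -S0; exact: Smax.
apply/eqP; rewrite eq_le normr_ge0 andbT leNgt; apply/negP => S0.
have [b b0 bS] : exists2 b, 0 <= b & `|E (b + 1)| = S.
  move: c01; rewrite in_itv/= => /andP[c0 c1].
  have cp : 0 < c.
    by rewrite lt_neqAle c0 andbT; apply/eqP => ce; move: S0; rewrite /S -ce E0 normr0 ltxx.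
  exists (c^-1 - 1); first by rewrite subr_ge0 invf_ge1.
  by rewrite subrK /S /E (Dinv cp c1).
have S2 : 0 < S / 2 by rewrite divr_gt0.
have [V0 V00 hV0] := E_small S2.
pose V := Num.max V0 b.
have bV : b <= V by rewrite le_max lexx orbT.
have V_0 : 0 <= V := le_trans b0 bV.
have r1 := ratio_lt1 V_0.
(* As [|E| <= S / 2] beyond [V], the mean falls short of [S] by at least
   [(1 - ratio V) * S / 2]; the two boundary terms near infinity, of size [e],
   only restore half of this. *)
pose e := (1 - ratio V) * S / 8.
have e0 : 0 < e by rewrite divr_gt0// mulr_gt0// subr_gt0.
have [B0 B00 hB0] := E_small e0.
pose B := Num.max B0 V.
have VB : V <= B by rewrite le_max lexx orbT.
have hB x : B <= x -> `|E x| <= e.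
  by move=> Bx; apply: hB0; rewrite (le_trans _ Bx)// le_max lexx.
have B_0 := le_trans V_0 VB.
have hb := wprim_shift b0; have hB' := wprim_shift B_0.
have i0B := dE_int B (lexx 0); have ibB := dE_int B b0.
rewrite (Rint_split b0 (le_trans bV VB) i0B) in hB'.
rewrite (Rint_split bV VB ibB) in hB'.
have n1 : `|\int[mu]_(u in `[b, V]) (dratio u * E u)| <= S * (ratio V - ratio b).
  by apply: dE_bound => // y /andP[yb _]; apply: Smax; exact: le_trans yb.
have n2 : `|\int[mu]_(u in `[V, B]) (dratio u * E u)| <= S / 2 * (ratio B - ratio V).
  apply: dE_bound => // y /andP[yb _]; apply: hV0.
  by rewrite (le_trans _ yb)// le_max lexx.
have n3 : `|E (B + 1)| <= e by apply: hB; rewrite lerDl.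
have rB := ratio_lt1 B_0; have rB0 := ratio_ge0 B_0; have rb0 := ratio_ge0 b0.
have n4 : `|ratio B * E B| <= e.
  rewrite normrM ger0_norm// -[leRHS]mul1r.
  by apply: ler_pM => //; [exact: ltW|exact: hB].
have n5 : `|ratio b * E b| <= ratio b * S.
  by rewrite normrM ger0_norm// ler_wpM2l// Smax.
have tot : S <= e + e + ratio b * S + S * (ratio V - ratio b) + S / 2 * (ratio B - ratio V).
  rewrite -{1}bS hb; move: n1 n2 n3 n4 n5; rewrite hB' !ler_norml.
  move=> /andP[? ?] /andP[? ?] /andP[? ?] /andP[? ?] /andP[? ?].
  by apply/andP; split; lra.
have l1 : S / 2 * (ratio B - ratio V) <= S / 2 * (1 - ratio V).
  by rewrite ler_pM2l// lerD2r ltW.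
have l2 : 0 < S * (1 - ratio V) by rewrite mulr_gt0// subr_gt0.
by move: tot l1 l2; rewrite /e; lra.
Qed.

(** Once [wprim D] vanishes, the integral [wprim0 D] solves a homogeneous
linear differential equation with zero initial value, whose integrating
factor is [(1 + x) ^+ 3]. *)
Theorem wprim_uniqueness x : 0 <= x -> D x = 0.
Proof.
move=> x0.
have I0 y : 0 <= y -> wprim0 D y = 0.
  move=> y0.
  have y1 : 1 + y != 0 by rewrite gt_eqF// ltr_pwDl.
  have H : wprim0 D 0 * (1 + 0) ^+ 3 = wprim0 D y * (1 + y) ^+ 3.
    apply: (@derivative0_cst _ (fun z => wprim0 D z * (1 + z) ^+ 3)) => //.
      move=> z /andP[z0 _]; have z1 : 1 + z != 0 by rewrite gt_eqF// addr_gt0.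
      apply: der_eq (derM (der_wprim0 cD z0) (derX 3 (der_onep z))) _.
      have := E_eq0 (ltW z0); rewrite /E /wprim => /eqP.
      rewrite addr_eq0 => /eqP h.
      have -> : D z = - (3 * wprim0 D z) * (1 + z) ^+ 3.
        by rewrite -h /wt; field.
      by rewrite /wt4 /=; field.
    apply: continuous_withinW => z /andP[z0 _].
    apply: continuousM; first exact: wprim0_continuous.
    exact: (@der_continuous _ (fun z => (1 + z) ^+ 3) _ _ (derX 3 (der_onep z))).
  move: H; rewrite {1}/wprim0 Rint_point mul0r => /esym/eqP.
  by rewrite mulf_eq0 expf_eq0 (negPf y1) andbF orbF => /eqP.
have := E_eq0 x0; rewrite /E /wprim I0// mulr0 addr0 => /eqP.
by rewrite mulf_eq0 /wt invr_eq0 expf_eq0 gt_eqF ?ltr_pwDl//= => /eqP.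
Qed.

End uniqueness.

(** * Continued fractions and alternating series along Gauss orbits *)

Section gauss.
Context {R : realType}.
Notation mu := (@lebesgue_measure R).
Implicit Types (x y : R) (h g : R -> R).

Lemma gauss_map_itv x : 0 <= gauss_map x < 1.
Proof. exact: frac_itv. Qed.

Lemma gauss_iterS k x : gauss_iter k.+1 x = gauss_iter k (gauss_map x).
Proof. by rewrite /gauss_iter iterSr. Qed.

Lemma cf_beta0 x : cf_beta 0 x = 1.
Proof. by rewrite /cf_beta big_ord0. Qed.

Lemma cf_betaS k x : cf_beta k.+1 x = x * cf_beta k (gauss_map x).
Proof.
rewrite /cf_beta big_ord_recl /=; congr (_ * _).
by apply: eq_bigr => i _; rewrite -gauss_iterS.
Qed.

Lemma gauss_iter_itv k x : 0 <= x < 1 -> 0 <= gauss_iter k x < 1.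
Proof.
by case: k => [//|k] _; rewrite /gauss_iter iterS; exact: gauss_map_itv.
Qed.

Lemma mul_gauss_map_le x : 0 <= x < 1 -> x * gauss_map x <= 1 / 2.
Proof.
move=> /andP[]; rewrite le_eqVlt => /predU1P[<- _|x0 x1].
  by rewrite mul0r; lra.
have x1' : x != 0 by rewrite gt_eqF.
rewrite /gauss_map /frac div1r mulrBr divff//.
set n := Num.floor _.
have n1 : 1 <= n%:~R :> R.
  by rewrite ler1z -gtz0_ge1 Num.Theory.floor_gt0 invf_ge1 ?(ltW x1).
have h : x^-1 < n%:~R + 1 by rewrite -intrD1 Num.Theory.floorD1_gt.
have {}h : x / x < x * (n%:~R + 1) by rewrite ltr_pM2l.
rewrite divff// in h.
have xn : x <= x * n%:~R by rewrite ler_peMr// ltW.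
by lra.
Qed.

Lemma cf_beta_ge0 k x : 0 <= x < 1 -> 0 <= cf_beta k x.
Proof.
move=> x01; apply: prodr_ge0 => i _.
by have /andP[] := gauss_iter_itv i x01.
Qed.

(** Two consecutive factors have a product at most 1/2, and 1/2 <= (3/4)^2.
The factor 4/3 starts the induction at [k = 0] and [k = 1]. *)
Lemma cf_beta_le k x : 0 <= x < 1 -> cf_beta k x <= 4 / 3 * (3 / 4) ^+ k.
Proof.
move: x; have [n] := ubnP k; elim: n k => // n IH [|[|k]] kn x x01.
- by rewrite cf_beta0 expr0; lra.
- by rewrite cf_betaS cf_beta0 expr1; move/andP: x01 => [_]; lra.
- rewrite !cf_betaS mulrA.
  have b := IH k (ltnW kn) _ (gauss_map_itv (gauss_map x)).
  have b0 := cf_beta_ge0 k (gauss_map_itv (gauss_map x)).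
  rewrite (@le_trans _ _ (1 / 2 * cf_beta k (gauss_map (gauss_map x))))//.
    by rewrite ler_wpM2r// mul_gauss_map_le.
  rewrite !exprS; set q := (3 / 4) ^+ k in b *.
  have q0 : 0 <= q by rewrite exprn_ge0//; lra.
  by lra.
Qed.

Lemma measurable_gauss_map : measurable_fun setT (@gauss_map R).
Proof.
apply: (measurableT_comp (@measurable_frac R)).
by apply: measurable_funM => //; exact: measurable_inv.
Qed.

Lemma measurable_gauss_iter k : measurable_fun setT (@gauss_iter R k).
Proof.
elim: k => [|k IH]; first exact: measurable_id.
by rewrite /gauss_iter; exact: (measurableT_comp measurable_gauss_map IH).
Qed.

Lemma measurable_cf_beta k : measurable_fun setT (@cf_beta R k).
Proof.
apply: (@eq_measurable_fun _ _ _ _ _ (fun x => \prod_(i < k) gauss_iter i x)) => //.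
by apply: measurable_prod => i _; exact: measurable_gauss_iter.
Qed.

(** The terms of the formal solution [\sum_k (-1)^k beta_(k-1) h(alpha_k)] of
the functional equation [g x + x * g (gauss_map x) = h x]; the Wilton
function is the case [h x = ln (1 / x)]. *)
Definition gterm h k x : R := (-1) ^+ k * (cf_beta k x * h (gauss_iter k x)).

Lemma measurable_gterm h k : measurable_fun setT h -> measurable_fun setT (gterm h k).
Proof.
move=> mh; apply: measurable_funM => //; apply: measurable_funM.
  exact: measurable_cf_beta.
exact: (measurableT_comp mh (measurable_gauss_iter k)).
Qed.

Lemma gterm0 h x : gterm h 0 x = h x.
Proof. by rewrite /gterm cf_beta0 expr0 !mul1r. Qed.

Lemma gtermS h k x : gterm h k.+1 x = - x * gterm h k (gauss_map x).
Proof. by rewrite /gterm cf_betaS gauss_iterS exprS; ring. Qed.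

Lemma series_gtermS h n x :
  series (fun k => gterm h k x) n.+1 = h x - x * series (fun k => gterm h k (gauss_map x)) n.
Proof.
elim: n => [|n IH].
  by rewrite seriesSr !seriesEnat/= !big_geq// gterm0 mulr0 subr0 add0r.
by rewrite seriesSr IH gtermS [in RHS]seriesSr; ring.
Qed.

Definition gseries h : R -> R := series_fun (gterm h).

(** The series at [x] is, after its first term, [- x] times the series at
[gauss_map x]. Convergence of the first gives that of the second because [x
!= 0]. *)
Lemma gseries_eq h x : x != 0 -> cvgn (series (fun k => gterm h k x)) ->
  gseries h x = h x - x * gseries h (gauss_map x).
Proof.
move=> x0 cx.
set s := series _ in cx; set s' := series (fun k => gterm h k (gauss_map x)).
have cS : s n.+1 @[n --> \oo] --> limn s by rewrite (cvg_shiftS s).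
have E : s' = (fun n => (h x - s n.+1) / x).
  by apply/funext => n; rewrite /s series_gtermS -/s'; field.
have c' : s' @ \oo --> (h x - limn s) / x.
  by rewrite E; apply: cvgMl; apply: cvgB => //; exact: cvg_cst.
rewrite /gseries /series_fun -/s -/s' (cvg_lim _ c')//.
by field.
Qed.

End gauss.

(** A divergent sequence has a default limit, so that the pointwise limit is
measurable on the measurable set where the sequence is Cauchy and constant on
the complement. *)
Lemma measurable_limn d (T : measurableType d) (R : realType) (D : set T)
    (u : nat -> T -> R) : measurable D ->
  (forall n, measurable_fun D (u n)) ->
  measurable_fun D (fun x => limn (fun n => u n x)).
Proof.
move=> mD mu_.
(* The set of convergence, by the Cauchy criterion. *)
pose C := \bigcap_(p : nat) \bigcup_(N : nat) \bigcap_(n : nat)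
  (D `&` [set x | `|u (n + N)%N x - u N x| <= p.+1%:R^-1]).
have mC : measurable C.
  apply: bigcapT_measurable => p; apply: bigcupT_measurable => N.
  apply: bigcapT_measurable => n.
  have mf : measurable_fun D (fun x => `|u (n + N)%N x - u N x|).
    apply: measurableT_comp; first exact: normr_measurable.
    exact: measurable_funB.
  rewrite -[X in measurable (D `&` X)]/((fun x => `|u (n + N)%N x - u N x| <= p.+1%:R^-1) @^-1` [set true]).
  by apply: (measurable_fun_ler mf (measurable_cst _)) => //.
have CD : C `<=` D by move=> x /(_ 0%N I)[N _ /(_ 0%N I)[]].
have Ccvg x : C x -> cvgn (fun n => u n x).
  move=> Cx; apply/cauchy_cvgP; apply: cauchy_exP => e e0.
  have [p pe] : exists p : nat, p.+1%:R^-1 < e.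
    exists (Num.truncn e^-1); rewrite invf_plt ?posrE//.
    exact: Num.Theory.truncnS_gt.
  have [N _ hN] := Cx p I; exists (u N x).
  exists N => // n /= Nn; have [_] := hN (n - N)%N I.
  rewrite /= subnK// distrC => h.
  exact: le_lt_trans pe.
have cvgC x : D x -> cvgn (fun n => u n x) -> C x.
  move=> Dx cx p _; have p0 : 0 < p.+1%:R^-1 / 2 :> R by rewrite divr_gt0 ?invr_gt0.
  have /cvgrPdist_le/(_ _ p0)[N _ hN] := cx.
  exists N => // n _; split => //=.
  have h1 := hN _ (leq_addl n N); have h2 := hN _ (leqnn N).
  rewrite (_ : u (n + N)%N x - u N x = (limn (u^~ x) - u N x) - (limn (u^~ x) - u (n + N)%N x)); last by ring.
  rewrite (le_trans (ler_normB _ _))// (le_trans (lerD h2 h1))//.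
  by rewrite -splitr.
have -> : D = C `|` (D `\` C) by rewrite setDUK.
apply/measurable_funU => //; first exact: measurableD.
split.
  apply: (@measurable_fun_cvg _ _ _ _ u) => [n|x Cx]; last exact: Ccvg.
  exact: measurable_funS (mu_ n).
apply: (@eq_measurable_fun _ _ _ _ _ (cst (0 : R))) => //.
move=> x; rewrite inE => -[Dx nCx] /=; apply/esym/dvgP => cx.
exact/nCx/cvgC.
Qed.

(** * The weighted contraction of the Gauss map *)

Section contraction.
Context {R : realType}.
Notation mu := (@lebesgue_measure R).
Implicit Types (x y s : R) (h g : R -> R).

Definition wt2 x : R := (1 + x) ^- 2.
(** The density obtained from [x * wt2 x] by the inversion [s = x^-1]. *)
Definition kern s : R := (s * (1 + s) ^+ 2)^-1.

Lemma measurable_wt2 : measurable_fun setT wt2.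
Proof.
apply: (measurableT_comp (@measurable_inv R)).
by apply: measurable_funX; exact: measurable_funD.
Qed.

Lemma measurable_kern : measurable_fun setT kern.
Proof.
apply: (measurableT_comp (@measurable_inv R)); apply: measurable_funM => //.
by apply: measurable_funX; exact: measurable_funD.
Qed.

Lemma wt2_ge0 x : 0 <= wt2 x. Proof. by rewrite invr_ge0 sqr_ge0. Qed.

Lemma kern_ge0 s : 0 <= s -> 0 <= kern s.
Proof. by move=> s0; rewrite invr_ge0 mulr_ge0// sqr_ge0. Qed.

(** This telescoping bound is the source of the factor 1/2 in
[gauss_contraction]; the weight [wt2] is chosen for it. *)
Lemma kern_telescope s : 0 <= s -> kern (s + 1) <= wt2 s / 2 - wt2 (s + 1) / 2.
Proof.
move=> s0; rewrite -subr_ge0.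
have s1 : 1 + s != 0 by rewrite gt_eqF// ltr_pwDl.
have s2 : 2 + s != 0 by rewrite gt_eqF// ltr_pwDl.
rewrite (_ : _ - _ = 1 / (2 * (1 + s) ^+ 2 * (2 + s) ^+ 2)).
  by rewrite divr_ge0// mulr_ge0 ?sqr_ge0// mulr_ge0 ?sqr_ge0.
rewrite /kern /wt2 (_ : 1 + (s + 1) = 2 + s); last by ring.
by rewrite [s + 1]addrC; field; rewrite s1 s2.
Qed.

Lemma kern_sum y N : 0 <= y -> \sum_(n < N) kern (y + n.+1%:R) <= wt2 y / 2.
Proof.
move=> y0; apply: (@le_trans _ _ (wt2 y / 2 - wt2 (y + N%:R) / 2)); last first.
  by rewrite lerBlDr lerDl divr_ge0// wt2_ge0.
elim: N => [|N IH]; first by rewrite big_ord0 addr0 subrr.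
rewrite big_ord_recr/= -natr1 addrA.
have := @kern_telescope (y + N%:R); rewrite addr_ge0// => /(_ isT).
by move: IH; lra.
Qed.

Variable g : R -> R.
Hypothesis mg : measurable_fun setT g.
Hypothesis g0 : forall x, 0 <= x < 1 -> 0 <= g x.

Let mgf : measurable_fun setT (fun s : R => kern s * g (frac s)).
Proof.
apply: measurable_funM; first exact: measurable_kern.
exact: measurableT_comp mg (@measurable_frac R).
Qed.

Let cell n : (\int[mu]_(s in `[n.+1%:R, n.+2%:R[) (kern s * g (frac s))%:E =
  \int[mu]_(y in `[0%R, 1%R[) (kern (y + n.+1%:R) * g y)%:E)%E.
Proof.
rewrite -(@ge0_integral_shift _ n.+1%:R `[n.+1%:R, n.+2%:R[%classic
  (fun s => (kern s * g (frac s))%:E))//; last 2 first.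
- by apply/measurable_EFinP; exact: measurable_funTS mgf.
- move=> x /=; rewrite in_itv/= => /andP[nx _]; rewrite lee_fin mulr_ge0//.
    by rewrite kern_ge0// (le_trans _ nx).
  by rewrite g0// frac_itv.
transitivity (\int[mu]_(y in `[0%R, 1%R[) (kern (y + n.+1%:R) * g (frac (y + n.+1%:R)))%:E)%E.
  congr (integral _ _ _); apply/seteqP; split => x /=; rewrite !in_itv/=.
    by rewrite -(natr1 n.+1) => /andP[h1 h2]; apply/andP; split; lra.
  by rewrite -(natr1 n.+1) => /andP[h1 h2]; apply/andP; split; lra.
apply: eq_integral => x; rewrite inE/= in_itv/= => x01.
by rewrite fracD frac_id.
Qed.

Let periodic_bound :
  (\int[mu]_(s in `]1%R, +oo[) (kern s * g (frac s))%:E <=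
   (1 / 2)%:E * \int[mu]_(y in `]0%R, 1%R[) (g y * wt2 y)%:E)%E.
Proof.
have k0 n y : 0 <= y < 1 -> 0 <= kern (y + n.+1%:R) * g y.
  by move=> /andP[y0 y1]; rewrite mulr_ge0 ?kern_ge0 ?addr_ge0// g0// y0.
have mkn n : measurable_fun setT (fun y => kern (y + n.+1%:R) * g y).
  apply: measurable_funM => //; apply: (measurableT_comp measurable_kern).
  exact: measurable_funD.
pose F (n : nat) : set R := `[n.+1%:R, n.+2%:R[%classic.
have FU : `]1%R, +oo[%classic `<=` \bigcup_n F n.
  move=> s /=; rewrite in_itv/= andbT => s1.
  have t1 : (0 < Num.truncn s)%N by rewrite Num.Theory.truncn_gt0 ltW.
  exists (Num.truncn s).-1 => //; rewrite /F/= in_itv/= prednK//.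
  by rewrite Num.Theory.truncn_le (ltW (lt_trans ltr01 s1))/= Num.Theory.truncnS_gt.
have tF : trivIset setT F.
  apply/trivIsetP => i j _ _ ij; apply/seteqP; split => // s [].
  rewrite /F/= !in_itv/= => /andP[i1 i2] /andP[j1 j2].
  have := le_lt_trans i1 j2; have := le_lt_trans j1 i2.
  by rewrite !ltr_nat; move: ij => /eqP; lia.
have Fpos x : (\bigcup_n F n) x -> (0 <= (kern x * g (frac x))%:E)%E.
  move=> [n _]; rewrite /F/= in_itv/= => /andP[nx _].
  by rewrite lee_fin mulr_ge0// ?g0 ?frac_itv// kern_ge0// (le_trans _ nx).
have mF n : measurable (F n) by exact: measurable_itv.
apply: (@le_trans _ _ (\int[mu]_(s in \bigcup_n F n) (kern s * g (frac s))%:E)%E).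
  apply: ge0_subset_integral => //.
  - exact (bigcup_measurable (fun n _ => mF n)).
  - by apply/measurable_EFinP; exact: measurable_funTS mgf.
rewrite ge0_integral_bigcup//; last first.
  by apply/measurable_EFinP; exact: measurable_funTS mgf.
have -> : (\int[mu]_(y in `]0%R, 1%R[) (g y * wt2 y)%:E =
    \int[mu]_(y in `[0%R, 1%R[) (g y * wt2 y)%:E)%E.
  rewrite integral_itv_obnd_cbnd//; apply/measurable_EFinP/measurable_funTS.
  by apply: measurable_funM => //; exact: measurable_wt2.
have gv0 x : `[0%R, 1%R[%classic x -> (0 <= (g x * wt2 x)%:E)%E.
  by rewrite /= in_itv/= => x01; rewrite lee_fin mulr_ge0 ?wt2_ge0// g0.
rewrite -ge0_integralZl//; last first.
  by apply/measurable_EFinP/measurable_funTS/measurable_funM => //; exact: measurable_wt2.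
apply: lime_le.
  by apply: is_cvg_nneseries => n _ _; rewrite integral_ge0// => x Fx; apply: Fpos; exists n.
near=> N.
rewrite (eq_bigr (fun n => \int[mu]_(y in `[0%R, 1%R[) (kern (y + n.+1%:R) * g y)%:E)%E); last first.
  by move=> n _; exact: cell.
rewrite -ge0_integral_sum//; last first.
  by move=> n; apply/measurable_EFinP; exact: measurable_funTS (mkn n).
apply: ge0_le_integral => //.
- by move=> x; rewrite /= in_itv/= => x01; apply: sume_ge0 => n _; rewrite lee_fin k0.
- by apply: emeasurable_sum => n; apply/measurable_EFinP; exact: measurable_funTS (mkn n).
- apply/measurable_EFinP/measurable_funTS/measurable_funM => //.
  by apply: measurable_funM => //; exact: measurable_wt2.
- move=> x; rewrite /= in_itv/= => x01; have /andP[x0 _] := x01.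
  rewrite sumEFin lee_fin -mulr_suml big_mkord mulrCA mulrC ler_wpM2l ?g0//.
  by rewrite (_ : 1 / 2 * wt2 x = wt2 x / 2); [exact: kern_sum|ring].
Unshelve. all: by end_near. Qed.

(** After the inversion, [gauss_map] becomes the fractional part. Cutting the
half-line into unit cells and translating them to [0, 1[ replaces the weight
by the sum of the translates of [kern], at most [wt2 / 2] by [kern_sum]. *)
Lemma gauss_contraction :
  (\int[mu]_(x in `]0%R, 1%R[) (x * g (gauss_map x) * wt2 x)%:E <=
   (1 / 2)%:E * \int[mu]_(y in `]0%R, 1%R[) (g y * wt2 y)%:E)%E.
Proof.
apply: le_trans periodic_bound.
rewrite -(@ge0_integral_inv _ `]0%R, 1%R[%classic
  (fun x => (x * g (gauss_map x) * wt2 x)%:E))//; last 3 first.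
- by move=> x /=; rewrite in_itv/= => /andP[].
- apply/measurable_EFinP; apply: measurable_funTS.
  apply: measurable_funM; last exact: measurable_wt2.
  by apply: measurable_funM => //; exact: measurableT_comp mg (@measurable_gauss_map R).
- move=> x /=; rewrite in_itv/= => /andP[x0 x1]; rewrite lee_fin.
  by rewrite mulr_ge0 ?wt2_ge0// mulr_ge0 ?(ltW x0)// g0// gauss_map_itv.
rewrite le_eqVlt; apply/orP; left; apply/eqP.
transitivity (\int[mu]_(x in `]1%R, +oo[) (x^-1 * g (gauss_map x^-1) * wt2 x^-1 * x ^- 2)%:E)%E.
  congr (integral _ _ _); apply/seteqP; split => x /=; rewrite !in_itv/= andbT.
    by move=> [x0 /andP[_]]; rewrite invf_lt1.
  move=> x1; have x0 := lt_trans ltr01 x1.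
  by rewrite invr_gt0 x0 invf_lt1// x1.
apply: eq_integral => x; rewrite inE/= in_itv/= andbT => x1.
have x0 := lt_trans ltr01 x1.
congr (_%:E); rewrite /gauss_map div1r invrK /wt2 /kern.
by field; rewrite !gt_eqF// ?addr_gt0//.
Qed.

End contraction.

(** * Integrability of the alternating series *)

Section gseries_L1.
Context {R : realType}.
Notation mu := (@lebesgue_measure R).
Implicit Types (x y s : R).
Variable h : R -> R.
Hypothesis mh : measurable_fun setT h.
Hypothesis hi : mu.-integrable `]0, 1[ (EFin \o h).

Let mabs k : measurable_fun setT (fun x => `|gterm h k x|).
Proof. by apply: measurableT_comp; [exact: normr_measurable|exact: measurable_gterm]. Qed.

Let c : R := \int[mu]_(x in `]0, 1[) `|h x|.

Let cE : (\int[mu]_(x in `]0%R, 1%R[) (`|h x|)%:E = c%:E)%E.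
Proof.
rewrite /c /Rintegral fineK//; apply: integrable_fin_num => //.
exact: integrable_norm.
Qed.

Let wt2_le1 x : 0 <= x -> wt2 x <= 1.
Proof. by move=> x0; rewrite /wt2 invf_le1 ?exprn_gt0 ?ltr_pwDl// exprn_ege1// lerDl. Qed.

Let wt2_ge14 x : 0 <= x -> x <= 1 -> 1 <= 4 * wt2 x.
Proof.
move=> x0 x1; rewrite /wt2 ler_pdivlMr ?exprn_gt0 ?ltr_pwDl// mul1r.
rewrite (_ : 4 = 2 ^+ 2); last by ring.
by rewrite ler_sqr ?nnegrE ?addr_ge0//; lra.
Qed.

(** Each step [gtermS] is one application of the contraction. *)
Let weighted_bound k :
  (\int[mu]_(x in `]0%R, 1%R[) (`|gterm h k x| * wt2 x)%:E <= ((1 / 2) ^+ k * c)%:E)%E.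
Proof.
elim: k => [|k IH].
  rewrite expr0 mul1r -cE; apply: ge0_le_integral => //.
  - by move=> x _; rewrite lee_fin mulr_ge0// wt2_ge0.
  - apply/measurable_EFinP/measurable_funTS.
    by apply: measurable_funM; [exact: mabs|exact: measurable_wt2].
  - apply/measurable_EFinP/measurable_funTS.
    by apply: measurableT_comp; [exact: normr_measurable|exact: mh].
  - move=> x; rewrite /= in_itv/= => /andP[x0 _].
    by rewrite lee_fin gterm0 ler_piMr// wt2_le1// ltW.
rewrite exprS -mulrA EFinM.
apply: (@le_trans _ _ ((1 / 2)%:E * \int[mu]_(x in `]0%R, 1%R[) (`|gterm h k x| * wt2 x)%:E)%E).
  rewrite (le_trans _ (gauss_contraction (mabs k) _))// le_eqVlt.
  apply/orP; left; apply/eqP; apply: eq_integral => x; rewrite inE/= in_itv/= => /andP[x0 _].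
  by rewrite gtermS normrM normrN (gtr0_norm x0).
by apply: lee_wpmul2l IH; rewrite lee_fin divr_ge0.
Qed.

Let term_bound k :
  (\int[mu]_(x in `]0%R, 1%R[) (`|gterm h k x|)%:E <= (4 * ((1 / 2) ^+ k * c))%:E)%E.
Proof.
rewrite EFinM; apply: (@le_trans _ _ (4%:E * \int[mu]_(x in `]0%R, 1%R[) (`|gterm h k x| * wt2 x)%:E)%E); last first.
  by apply: lee_wpmul2l (weighted_bound k); rewrite lee_fin.
rewrite -ge0_integralZl//; last 2 first.
- apply/measurable_EFinP/measurable_funTS.
  by apply: measurable_funM; [exact: mabs|exact: measurable_wt2].
- by move=> x _; rewrite lee_fin mulr_ge0// wt2_ge0.
apply: ge0_le_integral => //.
- by apply/measurable_EFinP; exact: measurable_funTS (mabs k).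
- apply/measurable_EFinP/measurable_funTS; apply: measurable_funM => //.
  by apply: measurable_funM; [exact: mabs|exact: measurable_wt2].
- move=> x; rewrite /= in_itv/= => /andP[x0 x1].
  by rewrite lee_fin mulrCA ler_peMr// wt2_ge14// ltW.
Qed.

(** The dominating function in the sense of Lebesgue; it is finite almost
everywhere because its integral is finite. *)
Definition abs_gseries x : \bar R := (\sum_(k <oo) (`|gterm h k x|)%:E)%E.

Let abs_gseries_ge0 x : (0 <= abs_gseries x)%E.
Proof. by apply: nneseries_ge0 => n _ _. Qed.

Let abs_gseries_int : (\int[mu]_(x in `]0%R, 1%R[) abs_gseries x <= (8 * c)%:E)%E.
Proof.
rewrite /abs_gseries integral_nneseries//; last first.
  by move=> n; apply/measurable_EFinP; exact: measurable_funTS (mabs n).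
apply: lime_le; first by apply: is_cvg_nneseries => n _ _; exact: integral_ge0.
near=> n.
apply: (@le_trans _ _ (\sum_(0 <= k < n) (4 * ((1 / 2) ^+ k * c))%:E)%E).
  by apply: lee_sum => k _; exact: term_bound.
rewrite sumEFin lee_fin big_mkord.
have c0 : 0 <= c by apply: Rintegral_ge0.
have geo m : \sum_(i < m) 4 * ((1 / 2) ^+ i * c) = 8 * c - 8 * c * (1 / 2) ^+ m.
  elim: m => [|m IH]; first by rewrite big_ord0 expr0 mulr1 subrr.
  by rewrite big_ord_recr/= IH exprS; field.
by rewrite geo lerBlDr lerDl mulr_ge0 ?mulr_ge0 ?exprn_ge0.
Unshelve. all: by end_near. Qed.

Let mabs_gseries : measurable_fun (`]0, 1[%classic : set R) abs_gseries.
Proof.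
apply: (ge0_emeasurable_sum (P := xpredT)) => [k x _ _|k _]; first by rewrite lee_fin.
by apply/measurable_EFinP; exact: measurable_funTS (mabs k).
Qed.

Lemma abs_gseries_integrable : mu.-integrable `]0, 1[ abs_gseries.
Proof.
apply/integrableP; split=> //.
under eq_integral do rewrite gee0_abs//.
by rewrite (le_lt_trans abs_gseries_int)// ltry.
Qed.

Let partial_le x n : (abs_gseries x < +oo)%E ->
  series (fun k => `|gterm h k x|) n <= fine (abs_gseries x).
Proof.
move=> dx; rewrite -lee_fin fineK ?ge0_fin_numE//.
rewrite seriesEnat/= -sumEFin; apply: nneseries_lim_ge => k _ _.
by rewrite lee_fin.
Qed.

Lemma abs_gseries_cvg x : (abs_gseries x < +oo)%E -> cvgn (series (fun k => gterm h k x)).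
Proof.
move=> dx; apply: normed_cvg.
suff : cvgn (series (fun k => `|gterm h k x|)) by [].
apply: nondecreasing_is_cvgn.
  by apply/nondecreasing_seqP => n; rewrite seriesSr lerDl.
by exists (fine (abs_gseries x)) => _ [n _ <-]; exact: partial_le.
Qed.

Lemma gseries_le_abs x : (`|(gseries h x)%:E| <= abs_gseries x)%E.
Proof.
have [->|] := eqVneq (abs_gseries x) +oo%E; first exact: leey.
rewrite -ltey => dx.
rewrite -[leRHS]fineK ?ge0_fin_numE//= lee_fin.
have cx := abs_gseries_cvg dx.
have cn : `|series (fun k => gterm h k x) n| @[n --> \oo] --> `|gseries h x|.
  exact: cvg_norm.
rewrite -(cvg_lim _ cn)//; apply: limr_le; first by apply/cvg_ex; eexists; exact: cn.
near=> n; rewrite (le_trans _ (partial_le n dx))//.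
by rewrite !seriesEnat/= ler_norm_sum.
Unshelve. all: by end_near. Qed.

Lemma measurable_gseries : measurable_fun setT (gseries h).
Proof.
apply: measurable_limn => // n; rewrite /series.
by apply: measurable_sum => k; exact: measurable_gterm.
Qed.

Lemma gseries_integrable : mu.-integrable `]0, 1[ (EFin \o gseries h).
Proof.
apply: le_integrable abs_gseries_integrable => //.
  by apply/measurable_EFinP; exact: measurable_funTS measurable_gseries.
by move=> x _; rewrite (le_trans (gseries_le_abs x))// lee_abs.
Qed.

Lemma gseries_ae : {ae mu, forall x, `]0, 1[%classic x ->
  gseries h x = h x - x * gseries h (gauss_map x)}.
Proof.
have := @integrable_ae _ _ _ mu _ (measurable_itv _) _ abs_gseries_integrable.
apply: filterS => x dx x01; have := dx x01; rewrite ge0_fin_numE// => dxy.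
apply: gseries_eq; last exact: abs_gseries_cvg.
by move: x01; rewrite /= in_itv/= => /andP[x0 _]; rewrite gt_eqF.
Qed.

End gseries_L1.

(** * Integrability of the logarithm *)

Section log.
Context {R : realType}.
Notation mu := (@lebesgue_measure R).
Implicit Types x y : R.

Definition hlog x : R := ln (1 / x).

Lemma measurable_hlog : measurable_fun setT hlog.
Proof.
apply: (measurableT_comp (@measurable_ln R)).
by apply: measurable_funM => //; exact: measurable_inv.
Qed.

Lemma hlogE x : 0 < x -> hlog x = - ln x.
Proof. by move=> x0; rewrite /hlog div1r lnV ?posrE//. Qed.

Lemma hlog_ge0 x : 0 < x -> x <= 1 -> 0 <= hlog x.
Proof. by move=> x0 x1; rewrite hlogE// oppr_ge0 ln_le0. Qed.

Lemma Rint_hlog e : 0 < e -> e <= 1 -> \int[mu]_(x in `[e, 1]) hlog x <= 1.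
Proof.
move=> e0 e1.
have -> : \int[mu]_(x in `[e, 1]) hlog x = \int[mu]_(x in `[e, 1]) (- ln x).
  apply: eq_Rintegral => x; rewrite in_segment => /andP[ex _].
  by rewrite hlogE// (lt_le_trans e0).
have -> : \int[mu]_(x in `[e, 1]) (- ln x) = (1 - 1 * ln 1) - (e - e * ln e).
  apply: (@Rint_FTC _ (fun x => x - x * ln x)) => // x /andP[ex _].
    have x0 := lt_le_trans e0 ex; have x1 : x != 0 by rewrite gt_eqF.
    apply: der_eq (derB (der_id x) (derM (der_id x) (der_ln x0))) _.
    by rewrite divff//; ring.
  by apply: continuousN; apply: continuous_ln; exact: lt_le_trans ex.
rewrite ln1 mulr0 subr0.
have : e * ln e <= 0 by rewrite pmulr_rle0// ln_le0.
by lra.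
Qed.

(** Monotone convergence along the segments [1/n, 1], on which the integrals
are at most 1. *)
Lemma hlog_integrable : mu.-integrable `]0, 1[ (EFin \o hlog).
Proof.
pose F (n : nat) : set R := `[n.+1%:R^-1, 1%R]%classic.
have nF n : 0 < n.+1%:R^-1 :> R by rewrite invr_gt0.
have n1 n : n.+1%:R^-1 <= 1 :> R by rewrite invf_le1// ler1n.
have F0 x n : F n x -> (0 <= (hlog x)%:E)%E.
  by rewrite /F/= in_itv/= => /andP[nx x1]; rewrite lee_fin hlog_ge0// (lt_le_trans (nF n)).
have FI n : mu.-integrable (F n) (EFin \o hlog).
  apply: continuous_integrable; apply: continuous_withinW => x /andP[nx _].
  have x0 := lt_le_trans (nF n) nx.
  apply: (@continuous_comp _ _ _ (fun x : R => 1 / x) (@ln R)).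
    by apply: continuousM; [exact: cst_continuous|apply: inv_continuous; rewrite gt_eqF].
  by apply: continuous_ln; rewrite divr_gt0.
have sub : `]0, 1[%classic `<=` \bigcup_n F n.
  move=> x /=; rewrite in_itv/= => /andP[x0 x1].
  exists (Num.truncn x^-1) => //; rewrite /F/= in_itv/= (ltW x1) andbT.
  by rewrite invf_ple ?posrE//; exact/ltW/Num.Theory.truncnS_gt.
apply/integrableP; split; first by apply/measurable_EFinP; exact: measurable_funTS measurable_hlog.
have -> : (\int[mu]_(x in `]0%R, 1%R[) `|(EFin \o hlog) x| =
    \int[mu]_(x in `]0%R, 1%R[) (hlog x)%:E)%E.
  apply: eq_integral => x; rewrite inE/= in_itv/= => /andP[x0 x1].
  by rewrite ger0_norm// hlog_ge0// ltW.
apply: (@le_lt_trans _ _ 1%E); last exact: ltry.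
apply: (@le_trans _ _ (\int[mu]_(x in \bigcup_n F n) (hlog x)%:E)%E).
  apply: ge0_subset_integral => //.
  - exact (bigcup_measurable (fun n _ => measurable_itv _)).
  - by apply/measurable_EFinP; exact: measurable_funTS measurable_hlog.
  - by move=> x [n _]; exact: F0.
have ndF : nondecreasing_seq F.
  apply/nondecreasing_seqP => n; apply/subsetPset => x; rewrite /F/= !in_itv/=.
  move=> /andP[h ->]; rewrite andbT (le_trans _ h)//.
  by rewrite lef_pV2 ?posrE// ler_nat.
have mFh n : measurable_fun (F n) (EFin \o hlog).
  by apply/measurable_EFinP; exact: measurable_funTS measurable_hlog.
have mF n : measurable (F n) by exact: measurable_itv.
have cv := @ge0_nondecreasing_set_cvg_integral _ (measurableTypeR R) R F (EFin \o hlog) mu ndF mF mFh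
  (fun i x => @F0 x i).
rewrite -(cvg_lim _ cv)//; apply: lime_le; first exact: cvgP cv.
near=> n.
rewrite -[leLHS]fineK; last exact: (@integrable_fin_num _ _ _ mu _ (mF n) _ (FI n)).
rewrite lee_fin; exact: Rint_hlog.
Unshelve. all: by end_near. Qed.

End log.

(** * Phi as the primitive of an alternating series *)

Section Ffun.
Context {R : realType}.
Notation mu := (@lebesgue_measure R).
Implicit Types x y : R.

(** [Fhat] without its logarithmic singularity at 0, set to 0 outside the
interval; it is bounded, and continuous on the interval. *)
Definition Ffun : R -> R := (fun x => Fhat x - ln x / 2) \_ `]0, 1[.

Lemma FfunE x : 0 < x -> x < 1 -> Ffun x = Fhat x - ln x / 2.
Proof. by move=> x0 x1; rewrite /Ffun patchE mem_set//= in_itv/= x0. Qed.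

Lemma Fexpr_continuous x : 0 < x -> {for x, continuous (fun x => Fhat x - ln x / 2)}.
Proof.
move=> x0; apply: continuousB; first exact: Fhat_continuous.
by apply: continuousM; [exact: continuous_ln|exact: cst_continuous].
Qed.

Lemma measurable_Ffun : measurable_fun setT Ffun.
Proof.
apply/(measurable_restrictT (fun x => Fhat x - ln x / 2) (measurable_itv `]0, 1[)).
apply: open_continuous_measurable_fun => // x; rewrite inE/= in_itv/= => /andP[x0 _].
exact: Fexpr_continuous.
Qed.

Lemma Ffun_continuous x : 0 < x -> x < 1 -> {for x, continuous Ffun}.
Proof.
move=> x0 x1; have := Fexpr_continuous x0.
rewrite /prop_for /continuous_at -(FfunE x0 x1) => c.
apply: cvg_trans c; apply: near_eq_cvg; near=> y.
have y0 : 0 < y by near: y; exact: lt_nbhsr.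
have y1 : y < 1 by near: y; exact: lt_nbhsl.
by rewrite FfunE.
Unshelve. all: by end_near. Qed.

Lemma autocorrelation_bound x : 0 < x -> x <= 1 -> 0 <= autocorrelation x <= 2.
Proof.
move=> x0 x1; rewrite (autocorrelation_tail x0 x1 (lexx 1)) divr1.
have h1 : 0 <= \int[mu]_(u in `[0, 1]) inv_integrand x u.
  by apply: Rintegral_ge0 => u _; exact: inv_integrand_ge0.
have h2 : `|\int[mu]_(u in `[0, 1]) inv_integrand x u| <= 1 * (1 - 0).
  apply: normr_Rint_le => //; first exact: inv_integrand_integrable.
  by move=> u _; rewrite ger0_norm ?inv_integrand_ge0// inv_integrand_le1.
move: h1 h2; rewrite subr0 mulr1; set I := Rintegral _ _ _ => h1.
rewrite ger0_norm// => h2; rewrite addr_ge0 ?(ltW x0)//=.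
by rewrite (_ : 2 = 1 + 1) ?lerD.
Qed.

Lemma Ffun_bounded : exists2 C, 0 <= C & forall x, `|Ffun x| <= C.
Proof.
exists (2 * `|cA - 1 / 2| + 1 + 2); first by rewrite !addr_ge0// mulr_ge0.
move=> x; have [x01|nx] := boolP (x \in `]0, 1[%classic); last first.
  by rewrite /Ffun patchE (negPf nx) normr0 !addr_ge0// mulr_ge0.
move: x01; rewrite inE/= in_itv/= => /andP[x0 x1]; rewrite FfunE// /Fhat.
have /andP[a0 a2] := autocorrelation_bound x0 (ltW x1).
have lnx : `|x * ln x| <= 1.
  have l0 := ln_le0 (ltW x1).
  have : ln x^-1 <= x^-1 - 1 by rewrite -[X in ln X](subrK 1) addrC le_ln1Dx// ltrBrDl subrr invr_gt0.
  rewrite lnV ?posrE// => h.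
  have : x * - ln x <= x * (x^-1 - 1) by rewrite ler_pM2l.
  rewrite mulrBr divff ?gt_eqF// mulr1 mulrN => h2.
  rewrite ler0_norm; first by move: h2; lra.
  by rewrite pmulr_rle0.
rewrite (_ : _ - _ = (cA - 1 / 2) * (1 + x) - x * ln x / 2 - autocorrelation x); last by ring.
rewrite (le_trans (ler_normB _ _))// lerD//; last by rewrite ger0_norm.
rewrite (le_trans (ler_normB _ _))// lerD//.
  rewrite normrM mulrC ler_wpM2r// ger0_norm; last by rewrite addr_ge0// ltW.
  by move: x1; lra.
rewrite normrM (ger0_norm (_ : 0 <= 2^-1)) ?invr_ge0//.
by move: lnx; lra.
Qed.

Lemma bounded_integrable_oo (f : R -> R) C : measurable_fun setT f ->
  (forall x, `|f x| <= C) -> mu.-integrable `]0, 1[ (EFin \o f).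
Proof.
move=> mf fC; apply: (@integrableS _ _ _ mu `[0, 1]) => //.
  exact: subset_itv_oo_cc.
by apply: (@bounded_integrable _ _ _ _ C) => //; exact: measurable_funTS.
Qed.

Lemma Ffun_integrable : mu.-integrable `]0, 1[ (EFin \o Ffun).
Proof.
have [C _ FC] := Ffun_bounded.
by apply: bounded_integrable_oo FC; exact: measurable_Ffun.
Qed.

Definition Gfun : R -> R := gseries Ffun.

Lemma wiltonE : @wilton R = gseries hlog.
Proof. by []. Qed.

(** The candidate for the derivative of [Phi] on the unit interval: the
alternating series for [Fhat = ln / 2 + Ffun] is [- wilton / 2 + gseries
Ffun]. *)
Definition Phi_slope x : R := - (wilton x / 2) + Gfun x.

Lemma measurable_Phi_slope : measurable_fun setT Phi_slope.
Proof.
apply: measurable_funD.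
  apply: measurable_funN; apply: measurable_funM => //; rewrite wiltonE.
  exact: measurable_gseries measurable_hlog.
exact: measurable_gseries measurable_Ffun.
Qed.

Lemma wilton_integrable : mu.-integrable `]0, 1[ (EFin \o @wilton R).
Proof. by rewrite wiltonE; exact: gseries_integrable measurable_hlog hlog_integrable. Qed.

Lemma Gfun_integrable : mu.-integrable `]0, 1[ (EFin \o Gfun).
Proof. exact: gseries_integrable measurable_Ffun Ffun_integrable. Qed.

Lemma Phi_slope_integrable : mu.-integrable `]0, 1[ (EFin \o Phi_slope).
Proof.
apply: integrable_add => //; last exact: Gfun_integrable.
rewrite (_ : EFin \o _ = EFin \o (fun x => (- 2^-1) * wilton x)).
  by apply: integrable_scale => //; exact: wilton_integrable.
by apply/funext => x /=; congr (_%:E); ring.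
Qed.

Lemma Phi_slope_ae : {ae mu, forall x, `]0, 1[%classic x ->
  Phi_slope x + x * Phi_slope (gauss_map x) = Fhat x}.
Proof.
have h1 := gseries_ae (@measurable_hlog R) (@hlog_integrable R).
have h2 := gseries_ae measurable_Ffun Ffun_integrable.
have F := ae_filter_ringOfSetsType mu.
apply: filterS2 h1 h2 => x e1 e2 x01.
move: (x01); rewrite /= in_itv/= => /andP[x0 x1].
rewrite /Phi_slope wiltonE /Gfun e1// e2// hlogE// FfunE//.
by field.
Qed.

Lemma integrable_oo_cc (f : R -> R) : measurable_fun setT f ->
  mu.-integrable `]0, 1[ (EFin \o f) -> mu.-integrable `[0, 1] (EFin \o f).
Proof.
move=> mf /integrableP[_ fi]; apply/integrableP; split.
  by apply/measurable_EFinP; exact: measurable_funTS mf.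
have mn (A : set R) : measurable_fun A (fun x => `|(EFin \o f) x|%E).
  by apply: measurableT_comp => //; apply/measurable_EFinP; exact: measurable_funTS mf.
by rewrite -integral_itv_bndo_bndc// -integral_itv_obnd_cbnd.
Qed.

Definition Phi_slope_per x : R := Phi_slope (frac x).

Lemma measurable_Phi_slope_per : measurable_fun setT Phi_slope_per.
Proof. exact: measurableT_comp measurable_Phi_slope (@measurable_frac R). Qed.

Lemma Phi_slope_perD1 x : Phi_slope_per (x + 1) = Phi_slope_per x.
Proof. by rewrite /Phi_slope_per fracD1. Qed.

Lemma Phi_slope_per_integrable01 : mu.-integrable `[0, 1] (EFin \o Phi_slope_per).
Proof.
apply: integrable_oo_cc; first exact: measurable_Phi_slope_per.
apply: eq_integrable Phi_slope_integrable => //.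
move=> x; rewrite inE/= in_itv/= => /andP[x0 x1].
by rewrite /Phi_slope_per frac_id// (ltW x0).
Qed.

Let mtn (A : set R) : measurable_fun A (fun x => `|(EFin \o Phi_slope_per) x|%E).
Proof.
apply: measurableT_comp => //; apply/measurable_EFinP.
exact: measurable_funTS measurable_Phi_slope_per.
Qed.

Lemma Phi_slope_per_integrable_nat n : mu.-integrable `[0, n%:R] (EFin \o Phi_slope_per).
Proof.
apply/integrableP; split.
  by apply/measurable_EFinP; exact: measurable_funTS measurable_Phi_slope_per.
elim: n => [|n IH]; first by rewrite set_itv1 integral_set1.
have -> : `[0, n.+1%:R]%classic = `[0, n%:R[%classic `|` `[n%:R, n.+1%:R]%classic :> set R.
  by rewrite -itv_bndbnd_setU ?bnd_simp// ler_nat.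
rewrite ge0_integral_setU//=; last 2 first.
- exact: mtn.
- apply/disj_setPS => x [/=]; rewrite !in_itv/= => /andP[_ xn] /andP[nx _].
  by move: xn; rewrite ltNge nx.
apply: lte_add_pinfty; first by rewrite integral_itv_bndo_bndc//; exact: mtn.
have := Phi_slope_per_integrable01 => /integrableP[_].
rewrite (_ : \int[mu]_(x in `[0%R, 1%R]) `|(EFin \o Phi_slope_per) x| =
  \int[mu]_(x in `[n%:R, n.+1%:R]) `|(EFin \o Phi_slope_per) x|)%E//.
have sh := @ge0_integral_shift R n%:R `[n%:R, n.+1%:R]%classic
  (fun x => `|(EFin \o Phi_slope_per) x|%E) (measurable_itv _) (@mtn _) (fun x _ => abse_ge0 _).
apply: eq_trans sh; transitivity (\int[mu]_(x in `[0%R, 1%R]) `|(EFin \o Phi_slope_per) (x + n%:R)%R|)%E.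
  by apply: eq_integral => x _; rewrite /= /Phi_slope_per fracD.
congr (integral _ _ _); apply/seteqP; split => x /=; rewrite !in_itv/= -natr1;
  by move=> /andP[? ?]; apply/andP; split; lra.
Qed.

Lemma Phi_slope_per_integrable a b : 0 <= a -> mu.-integrable `[a, b] (EFin \o Phi_slope_per).
Proof.
move=> a0; apply: integrable_itvS a0 _ (Phi_slope_per_integrable_nat (Num.truncn b).+1).
by rewrite ltW// Num.Theory.truncnS_gt.
Qed.

Definition Psi x : R := \int[mu]_(u in `[0, x]) Phi_slope_per u.

Lemma Psi_continuous : continuous Psi.
Proof. by apply: Rint_continuous => b; exact: Phi_slope_per_integrable. Qed.

Lemma PsiD1 x : 0 <= x -> Psi (x + 1) = Psi x + Psi 1.
Proof.
move=> x0; rewrite /Psi (@Rint_split _ _ 0 1 (x + 1)) ?lerDr//; last exact: Phi_slope_per_integrable.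
rewrite addrC; congr (_ + _).
transitivity (\int[mu]_(x in `[0 + 1, x + 1]) Phi_slope_per x); first by rewrite add0r.
rewrite -(@Rint_shift _ 1 0 x Phi_slope_per); last exact: measurable_funTS measurable_Phi_slope_per.
by apply: eq_Rintegral => u _; rewrite Phi_slope_perD1.
Qed.

Lemma wt_Phi_slope_per_integrable a b : 0 <= a ->
  mu.-integrable `[a, b] (EFin \o (fun u => wt u * Phi_slope_per u)).
Proof.
move=> a0; apply: integrable_continuousM; first exact: Phi_slope_per_integrable.
by apply: continuous_withinW => x /andP[ax _]; apply: wt_continuous; exact: le_trans ax.
Qed.

(** For an absolutely continuous function [wprim] is the integral of [wt]
times the derivative. *)
Lemma wprim_Psi x : 0 <= x -> wprim Psi x = \int[mu]_(u in `[0, x]) (wt u * Phi_slope_per u).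
Proof.
move=> x0.
have dw y : 0 <= y <= x -> is_derive y (1 : R) wt (- 3 * wt4 y).
  by move=> /andP[y0 _]; exact: der_wt.
have cw y : 0 <= y <= x -> {for y, continuous (fun y => - 3 * wt4 y)}.
  move=> /andP[y0 _]; apply: continuousM; first exact: cst_continuous.
  exact: wt4_continuous.
have -> := @Rint_by_parts _ Phi_slope_per wt (fun y => - 3 * wt4 y) 0 x x0
  (Phi_slope_per_integrable x (lexx 0)) dw cw.
rewrite /wprim /wprim0 -/(Psi x).
have -> : \int[mu]_(y in `[0, x]) (- 3 * wt4 y * \int[mu]_(t in `[0, y]) Phi_slope_per t) =
    \int[mu]_(y in `[0, x]) (- 3 * (wt4 y * Psi y)).
  by apply: eq_Rintegral => y _; rewrite mulrA.
rewrite (@RintegralZl _ _ _ mu _ (fun y => wt4 y * Psi y))//; first by ring.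
by apply: wt4M_integrable => //; exact: Psi_continuous.
Qed.

(** The substitution [u -> u^-1] carries the integral over [1, x^-1] to one
over [x, 1], where [wt_inv] and the periodicity of [Phi_slope_per] turn the integrand
into the left-hand side of [Phi_slope_ae]. *)
Lemma wprim_Psi_inversion x : 0 < x -> x <= 1 ->
  wprim Psi x - wprim Psi x^-1 = - \int[mu]_(u in `[x, 1]) (wt u * Fhat u).
Proof.
move=> x0 x1; have xi0 : 0 < x^-1 by rewrite invr_gt0.
have xi1 : 1 <= x^-1 by rewrite invf_ge1.
have xx : x <= x^-1 by exact: le_trans xi1.
rewrite !wprim_Psi ?ltW//.
rewrite (@Rint_split _ _ 0 x x^-1 (ltW x0) xx); last exact: wt_Phi_slope_per_integrable.
rewrite (@Rint_split _ _ x 1 x^-1 x1 xi1); last exact: wt_Phi_slope_per_integrable (ltW x0).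
rewrite opprD addrA subrr add0r; congr (- _).
have mwt : measurable_fun `[1, x^-1] (fun u => wt u * Phi_slope_per u).
  by apply: (@integrable_measurable R); exact: wt_Phi_slope_per_integrable.
rewrite -(@Rint_inv _ 1 x^-1 (fun u => wt u * Phi_slope_per u))// invr1 invrK.
have i1 := wt_Phi_slope_per_integrable 1 (ltW x0).
have i2 : mu.-integrable `[x, 1] (EFin \o (fun u => wt u^-1 * Phi_slope_per u^-1 * u ^- 2)).
  have := @integrable_inv R 1 x^-1 (fun u => wt u * Phi_slope_per u) ltr01 xi0
    (wt_Phi_slope_per_integrable _ ler01).
  by rewrite invr1 invrK.
have i3 : mu.-integrable `[x, 1] (EFin \o (fun u => wt u * Fhat u)).
  apply: continuous_integrable; apply: continuous_withinW => u /andP[xu _].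
  have u0 := lt_le_trans x0 xu.
  by apply: continuousM; [exact: wt_continuous (ltW u0)|exact: Fhat_continuous].
rewrite -(@RintegralD _ _ _ mu `[x, 1]%classic (fun u => wt u * Phi_slope_per u)
  (fun u => wt u^-1 * Phi_slope_per u^-1 * u ^- 2))//.
have i4 := integrable_add (measurable_itv _) i1 i2.
rewrite -Rintegral_itv_bndo_bndc; last first.
  by apply: integrableS i4 => //; exact: subset_itv_co_cc.
rewrite -[RHS]Rintegral_itv_bndo_bndc; last first.
  by apply: integrableS i3 => //; exact: subset_itv_co_cc.
rewrite /Rintegral; congr fine; apply: ae_eq_integral => //.
- apply/measurable_EFinP; apply: measurable_funS (integrable_measurable i4) => //.
  exact: subset_itv_co_cc.
- apply/measurable_EFinP; apply: measurable_funS (integrable_measurable i3) => //.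
  exact: subset_itv_co_cc.
have F := ae_filter_ringOfSetsType mu.
move: Phi_slope_ae; apply: filterS => u h; rewrite /= in_itv/= => /andP[xu u1].
have u0 := lt_le_trans x0 xu.
have := h; rewrite /= in_itv/= u0 u1 => /(_ isT) <-.
congr (_%:E); rewrite wt_inv// /Phi_slope_per frac_id ?u1 ?(ltW u0)//.
rewrite /gauss_map div1r; field.
by rewrite gt_eqF.
Qed.

(** The difference has periodic increments, and both functions have the same
defect of invariance under inversion, so that [wprim_uniqueness] applies. It
replaces a proof that [Phi] is absolutely continuous. *)
Lemma Phi_eq_Psi x : 0 <= x -> Phi x = Psi x.
Proof.
move=> x0; apply/eqP; rewrite -subr_eq0; apply/eqP; move: x x0.
have cP := @Phi_continuous R; have cS := Psi_continuous.
have wB y : 0 <= y -> wprim (fun x => Phi x - Psi x) y = wprim Phi y - wprim Psi y.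
  move=> y0; rewrite /wprim /wprim0.
  have -> : \int[mu]_(u in `[0, y]) (wt4 u * (Phi u - Psi u)) =
      \int[mu]_(u in `[0, y]) (wt4 u * Phi u) - \int[mu]_(u in `[0, y]) (wt4 u * Psi u).
    rewrite -(@RintegralB _ _ _ mu _ (fun u => wt4 u * Phi u) (fun u => wt4 u * Psi u))//;
      try exact: wt4M_integrable.
    by apply: eq_Rintegral => u _; rewrite mulrBr.
  by ring.
apply: wprim_uniqueness.
- by move=> x; apply: continuousB; [exact: cP|exact: cS].
- by move=> x x0; rewrite PhiD1 PsiD1// Phi1; ring.
- move=> x x0 x1; have xi0 : 0 < x^-1 by rewrite invr_gt0.
  rewrite !wB ?ltW//.
  have := wprim_Phi_inversion x0 x1; have := wprim_Psi_inversion x0 x1.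
  by lra.
- by rewrite Phi0 /Psi Rint_point subrr.
Qed.

End Ffun.

(** * Regularity at irrational points and conclusion *)

Section irrational_points.
Context {R : realType}.
Notation mu := (@lebesgue_measure R).
Implicit Types x y : R.

Lemma gauss_map_irrational x : irrational x -> irrational (gauss_map x).
Proof.
move=> ix [q _ qx]; apply: ix.
exists ((q + (Num.floor (1 / x))%:~R)^-1) => //.
by rewrite fmorphV rmorphD/= ratr_int qx /gauss_map /frac subrK div1r invrK.
Qed.

Lemma gauss_iter_irrational k x : irrational x -> irrational (gauss_iter k x).
Proof.
move=> ix; elim: k => [//|k IH]; rewrite /gauss_iter iterS.
exact: gauss_map_irrational.
Qed.

Lemma irrational_neq0 x : irrational x -> x != 0.
Proof. by move=> ix; apply/eqP => x0; apply: ix; exists 0 => //; rewrite x0 rmorph0. Qed.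

(** The discontinuities of the Gauss map lie at 0 and at the reciprocals of
integers, where [frac x^-1 = 0]. *)
Lemma gauss_map_continuous x : irrational x -> {for x, continuous (@gauss_map R)}.
Proof.
move=> ix; have x0 := irrational_neq0 ix.
apply: (@continuous_comp _ _ _ (fun y : R => 1 / y) frac).
  apply: continuousM; first exact: cst_continuous.
  exact: inv_continuous.
apply: frac_continuous; exact: irrational_neq0 (gauss_map_irrational ix).
Qed.

Lemma gauss_iter_continuous k x : irrational x -> {for x, continuous (@gauss_iter R k)}.
Proof.
move=> ix; elim: k => [|k IH]; first exact: cvg_id.
apply: (@continuous_comp _ _ _ (gauss_iter k) gauss_map) => //.
exact (gauss_map_continuous (gauss_iter_irrational (k := k) ix)).
Qed.

Lemma cf_beta_continuous k x : irrational x -> {for x, continuous (@cf_beta R k)}.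
Proof.
move=> ix; elim: k => [|k IH].
  rewrite (_ : cf_beta 0 = cst 1); first exact: cst_continuous.
  by apply/funext => y; rewrite cf_beta0.
rewrite (_ : cf_beta k.+1 = fun y => cf_beta k y * gauss_iter k y).
  by apply: continuousM => //; exact: gauss_iter_continuous.
by apply/funext => y; rewrite /cf_beta big_ord_recr.
Qed.

(** [Ffun] is bounded and [cf_beta] decays geometrically, so that the series
converges uniformly on the unit interval. *)
Lemma Gfun_continuous x : 0 < x -> x < 1 -> irrational x -> {for x, continuous (@Gfun R)}.
Proof.
move=> x0 x1 ix; have [C C0 FC] := @Ffun_bounded R.
have q1 : `|3 / 4 : R| < 1 by rewrite ger0_norm; lra.
(* The differences of this sequence are the bounds [4 / 3 * (3 / 4) ^+ k * C] of
   the terms, since 16/3 * (1 - 3/4) = 4/3. *)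
apply: (@series_fun_continuous _ _ (fun k => 16 / 3 * C * (3 / 4) ^+ k) `]0, 1[%classic).
- move=> k y /=; rewrite in_itv/= => /andP[y0 y1].
  have y01 : 0 <= y < 1 by rewrite (ltW y0).
  rewrite /gterm normrM normrX normrN1 expr1n mul1r normrM.
  rewrite (ger0_norm (cf_beta_ge0 _ y01)).
  rewrite (le_trans (ler_pM (cf_beta_ge0 _ y01) (normr_ge0 _) (cf_beta_le k y01) (FC _)))//.
  by rewrite le_eqVlt exprS; apply/orP; left; apply/eqP; field.
- by move=> k; rewrite !mulr_ge0// ?exprn_ge0//; lra.
- rewrite -[X in _ --> X](mulr0 (16 / 3 * C)); apply: cvgM; first exact: cvg_cst.
  exact: cvg_expr.
- by apply: near_in_itvoo; rewrite in_itv/= x0.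
move=> k; apply: continuousM; first exact: cst_continuous.
apply: continuousM; first exact: cf_beta_continuous.
apply: (@continuous_comp _ _ _ (gauss_iter k) Ffun); first exact: gauss_iter_continuous.
have /andP[g0 g1] : 0 <= gauss_iter k x < 1 by apply: gauss_iter_itv; rewrite (ltW x0).
apply: Ffun_continuous => //; rewrite lt_neqAle g0 eq_sym andbT.
exact (irrational_neq0 (gauss_iter_irrational (k := k) ix)).
Qed.

Definition Gprim x : R := \int[mu]_(t in `[0, x]) Gfun t.

Lemma Gfun_integrable01 : mu.-integrable `[0, 1] (EFin \o @Gfun R).
Proof.
apply: integrable_oo_cc; last exact: Gfun_integrable.
exact: measurable_gseries (@measurable_Ffun R).
Qed.

Lemma wilton_integrable01 : mu.-integrable `[0, 1] (EFin \o @wilton R).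
Proof.
apply: integrable_oo_cc; last exact: wilton_integrable.
by rewrite wiltonE; exact: measurable_gseries (@measurable_hlog R).
Qed.

Lemma Gprim_continuous x : 0 < x < 1 -> {for x, continuous Gprim}.
Proof.
move=> x01.
have /(continuous_within_itvP _ ltr01)[c _ _] :=
  parameterized_integral_continuous (@ler01 R) Gfun_integrable01.
by apply: c; rewrite in_itv.
Qed.

Lemma Psi_wilton l : 0 < l < 1 -> Psi l = - (wilton_primitive l / 2) + Gprim l.
Proof.
move=> /andP[l0 l1].
have wi := integrable_itvS (lexx 0) (ltW l1) wilton_integrable01.
have Gi := integrable_itvS (lexx 0) (ltW l1) Gfun_integrable01.
have w2i := integrable_scale (- 2^-1) (measurable_itv _) wi.
rewrite mulrC -mulNr /wilton_primitive.
have <- := @RintegralZl _ _ _ mu `[0, l]%classic (@wilton R) (- 2^-1) (measurable_itv _) wi.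
apply: eq_trans (@RintegralD _ _ _ mu `[0, l]%classic (fun u => - 2^-1 * wilton u)
  (@Gfun R) (measurable_itv _) w2i Gi).
apply: eq_Rintegral => u; rewrite inE/= in_itv/= => /andP[u0 ul].
rewrite /Phi_slope_per frac_id ?u0 ?(le_lt_trans ul)// /Phi_slope.
by rewrite mulrC mulNr.
Qed.

Definition rho x : R := cA + ln x / 2 - 2 * x * M x^-1 + Gprim x / x.

Lemma der_Minv x : 0 < x -> exists c, is_derive x (1 : R) (fun y => M y^-1) c.
Proof.
move=> x0; have xn : x != 0 by rewrite gt_eqF.
have xi0 : 0 < x^-1 by rewrite invr_gt0.
by eexists; apply: der_comp (der_M xi0) (derV xn (der_id x)).
Qed.

Lemma rho_continuous x : 0 < x < 1 -> {for x, continuous rho}.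
Proof.
move=> /[dup] x01 /andP[x0 x1]; have [c cM] := der_Minv x0.
apply: continuousD; last first.
  apply: continuousM; first exact: Gprim_continuous.
  by apply: inv_continuous; rewrite gt_eqF.
apply: continuousB.
  apply: continuousD; first exact: cst_continuous.
  by apply: continuousM; [exact: continuous_ln|exact: cst_continuous].
apply: continuousM; last exact: der_continuous cM.
by apply: continuousM; [exact: cst_continuous|exact: cvg_id].
Qed.

Lemma rho_derivable x : 0 < x < 1 -> irrational x -> derivable rho x 1.
Proof.
move=> /andP[x0 x1] ix; have [c cM] := der_Minv x0.
have xn : x != 0 by rewrite gt_eqF.
have dH := der_Rint x0 x1 Gfun_integrable01 (Gfun_continuous x0 x1 ix).
have d2 := derM (derM (der_cst 2 x) (der_id x)) cM.
have d1 := derD (der_cst cA x) (derM (der_ln x0) (der_cst 2^-1 x)).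
by have [] := derD (derB d1 d2) (derM dH (derV xn (der_id x))).
Qed.

Lemma autocorrelation_rho l : 0 < l < 1 ->
  autocorrelation l = rho l - wilton_primitive l / (2 * l).
Proof.
move=> /[dup] l01 /andP[l0 l1].
rewrite autocorrelation_formula_inv// Phi_eq_Psi ?(ltW l0)// Psi_wilton// /rho.
by field; rewrite gt_eqF.
Qed.

End irrational_points.

Theorem proposition1 (R : realType) :
  exists rho : R -> R,
    [/\ forall x : R, 0 < x < 1 -> {for x, continuous rho},
        forall x : R, 0 < x < 1 -> irrational x -> derivable rho x 1
      & forall l : R, 0 < l < 1 ->
          autocorrelation l = rho l - wilton_primitive l / (2 * l)].
Proof.
exists rho; split.
- exact: rho_continuous.
- exact: rho_derivable.
- exact: autocorrelation_rho.
Qed.
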